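(* Let $T_1,T_2,T_3,T_4$ be the four triangles of integral Okubo idempotents of $\mathbb{O}_{E_8}$ listed in the context. For each $i$, $T_i\cup(-T_i)$ is a root system of type $A_2$, and the four together form a rank-eight subsystem of type $A_2^4$ in $\Phi(E_8)$. Choose one of the triangles, $T_i$, and let $\Phi_{\mathrm{ext}}=T_i\cup(-T_i)$. (1) The set of roots of $\Phi(E_8)$ orthogonal to $\Phi_{\mathrm{ext}}$ is a root system of type $E_6$ ($72$ roots), and the $240$ roots are organized as $240=6+72+6\cdot 27$: the $6$ roots of $\Phi_{\mathrm{ext}}$, the $72$ roots of $E_6$, and six sets of $27$ roots, which are the fibers of the orthogonal projection to the plane spanned by $\Phi_{\mathrm{ext}}$ over the six weights of $\mathbf{3}\oplus\overline{\mathbf{3}}$ of $\mathfrak{sl}_3$. Correspondingly, for the complex Lie algebra $\mathfrak{e}_8$ and its subalgebra $\mathfrak{e}_6\oplus\mathfrak{sl}_3$ determined by these orthogonal subsystems, $$\mathfrak{e}_8=(\mathfrak{e}_6,\mathbf{1})\oplus(\mathbf{1},\mathfrak{sl}_3)\oplus(\mathbf{27},\mathbf{3})\oplus(\overline{\mathbf{27}},\overline{\mathbf{3}}).$$ (2) The remaining nine idempotents $\bigsqcup_{j\ne i}T_j$ together with their antipodes are $18$ roots forming a full-rank subsystem of type $A_2^3$ in the root system of type $E_6$ consisting of the roots of $\Phi(E_8)$ orthogonal to $\Phi_{\mathrm{ext}}$. The corresponding decomposition of $\mathfrak{e}_6$ is the $\mathbb{Z}_3$-grading (trinification) $$\mathfrak{e}_6=\mathfrak{sl}_3^{\oplus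 3}\oplus(\mathbf{3},\mathbf{3},\mathbf{3})\oplus(\overline{\mathbf{3}},\overline{\mathbf{3}},\overline{\mathbf{3}}).$$
   Context: Octonions. $\mathbb{O}$ is the real division algebra of octonions with unit $1$ and basis $1,\mathrm{i},\mathrm{j},\mathrm{k},\mathrm{l},\mathrm{il},\mathrm{jl},\mathrm{kl}$; each imaginary basis unit squares to $-1$, distinct imaginary basis units anticommute, and the remaining products are given by the oriented triples $(\mathrm{i},\mathrm{j},\mathrm{k})$, $(\mathrm{i},\mathrm{l},\mathrm{il})$, $(\mathrm{j},\mathrm{l},\mathrm{jl})$, $(\mathrm{k},\mathrm{l},\mathrm{kl})$, $(\mathrm{jl},\mathrm{i},\mathrm{kl})$, $(\mathrm{kl},\mathrm{j},\mathrm{il})$, $(\mathrm{il},\mathrm{k},\mathrm{jl})$, where $(x,y,z)$ means $xy=z$, $yz=x$, $zx=y$. Relabel $(e_1,\dots,e_7)=(\mathrm{i},\mathrm{j},\mathrm{l},\mathrm{k},\mathrm{kl},\mathrm{jl},\mathrm{il})$. $\bar x$ is octonionic conjugation, $n(x)=x\bar x$, and $\langle x,y\rangle=x\bar y+y\bar x=2\operatorname{Re}(x\bar y)$. Lattice. $\mathbb{O}_{E_8}$ is the $\mathbb{Z}$-span of $1,\mathrm{i},\mathrm{j},\mathrm{k},\mathrm{h},\mathrm{i}\mathrm{h},\mathrm{j}\mathrm{h},\mathrm{k}\mathrm{h}$, where $\mathrm{h}=\tfrac12(\mathrm{i}+\mathrm{j}+\mathrm{k}+\mathrm{l})$. With $\langle\cdot,\cdot\rangle$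 it is an $E_8$ lattice, and its $240$ elements with $n=1$ form the root system $\Phi(E_8)$. Okubo idempotents. The Okubo product is $x*y=\tau(\bar x)\cdot\tau^2(\bar y)$, where $\tau$ is the $\mathbb{R}$-linear order-three octonion automorphism with $\tau(1)=1$, $\tau(e_3)=e_3$, $\tau(e_1)=e_2$, $\tau(e_2)=-e_4$, $\tau(e_4)=-e_1$, $\tau(e_5)=-e_7$, $\tau(e_7)=e_6$, $\tau(e_6)=-e_5$. The nonzero solutions of $e*e=e$ in $\mathbb{O}_{E_8}$ are the twelve elements of $T_1=\{1,\ \tfrac12(-1-e_5+e_6+e_7),\ \tfrac12(-1+e_5-e_6-e_7)\}$, $T_2=\{-e_1,\ \tfrac12(e_1+e_3+e_5+e_6),\ \tfrac12(e_1-e_3-e_5-e_6)\}$, $T_3=\{-e_2,\ \tfrac12(e_2+e_3-e_5-e_7),\ \tfrac12(e_2-e_3+e_5+e_7)\}$, $T_4=\{e_4,\ \tfrac12(e_3-e_4-e_6+e_7),\ \tfrac12(-e_3-e_4+e_6-e_7)\}$. Lie algebras are complex; $\mathfrak{e}_8$ has root system identified with $\Phi(E_8)$, and the subalgebra determined by a subsystem is the one generated by its root spaces. $\mathbf{27},\overline{\mathbf{27}}$ are the two minuscule representations of $\mathfrak{e}_6$, and $\mathbf{3},\overline{\mathbf{3}}$ are the standard representation of $\mathfrak{sl}_3$ and its dual. For each factor, the naming of which is $\mathbf{27}$ or $\overline{\mathbf{27}}$ (respectively $\mathbf{3}$ or $\overline{\mathbf{3}}$) is a matter of identification of the subalgebra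 with $\mathfrak{e}_6$ (respectively $\mathfrak{sl}_3$), chosen suitably. *)

(* Defs.v *)
From HB Require Import structures.
From mathcomp Require Import all_boot all_order all_algebra.
From mathcomp Require Import boolp classical_sets cardinality reals.
From mathcomp Require Import complex mxtens.

Set Implicit Arguments.
Unset Strict Implicit.
Unset Printing Implicit Defensive.

Import Order.TTheory GRing.Theory Num.Theory.

Local Open Scope classical_set_scope.
Local Open Scope ring_scope.
Local Open Scope complex_scope.

(* The linear span of an arbitrary (possibly infinite) set of vectors. *)
Definition lspan (K : fieldType) (V : vectType K) (A : set V) : set V :=
  [set x | exists2 s : seq V, (forall y, y \in s -> A y) & x \in <<s>>%VS].

(** * Octonions *)

(* Over the reals this is the division algebra of octonions.  The scalars are
   kept general because the form is also needed over the complex numbers,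
   where it is the complex-bilinear extension of the real one. *)
Notation oct K := 'rV[K]_8.

Section Octonions.
Variable K : fieldType.

(* oe 0 = 1 and (oe 1, ..., oe 7) = (i, j, l, k, kl, jl, il). *)
Definition oe (k : nat) : oct K := \row_j ((j : nat) == k)%:R.

(* The triples (i,j,k), (i,l,il), (j,l,jl), (k,l,kl), (jl,i,kl), (kl,j,il),
   (il,k,jl) in this labelling. *)
Definition oct_triples : seq (nat * nat * nat) :=
  [:: (1, 2, 4); (1, 3, 7); (2, 3, 6); (4, 3, 5);
      (6, 1, 5); (5, 2, 7); (7, 4, 6)]%N.

Definition oct_cyclic_triples : seq (nat * nat * nat) :=
  flatten [seq let: (x, y, z) := t in [:: (x, y, z); (y, z, x); (z, x, y)]
          | t <- oct_triples].

Definition oe_mul (a b : nat) : oct K :=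
  if a == 0%N then oe b else
  if b == 0%N then oe a else
  if a == b then - oe 0 else
  \sum_(t <- oct_cyclic_triples)
    (let: (x, y, z) := t in
     if (a == x) && (b == y) then oe z else
     if (b == x) && (a == y) then - oe z else 0).

Definition omul (x y : oct K) : oct K :=
  \sum_(a < 8) \sum_(b < 8) (x 0 a * y 0 b) *: oe_mul a b.

Definition oconj (x : oct K) : oct K :=
  \row_j (if (j : nat) == 0%N then x 0 j else - x 0 j).

(* x * conj y + y * conj x is a multiple of 1; oform is that multiple. *)
Definition oform (x y : oct K) : K :=
  (omul x (oconj y) + omul y (oconj x)) 0 0.

(** ** The Okubo product *)

Definition tau_basis : seq (oct K) :=
  [:: oe 0; oe 2; - oe 4; oe 3; - oe 1; - oe 7; - oe 5; oe 6].

Definition tau (x : oct K) : oct K := \sum_(k < 8) x 0 k *: tau_basis`_k.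

Definition okubo (x y : oct K) : oct K :=
  omul (tau (oconj x)) (tau (tau (oconj y))).

End Octonions.

(** * The lattice, its roots, and the triangles of idempotents *)

Section Lattice.
Variable R : realType.
Local Notation O := (oct R).
Local Notation e := (@oe R).

Definition oct_h : O := 2^-1 *: (e 1 + e 2 + e 4 + e 3).

Definition E8_generators : seq O :=
  [:: e 0; e 1; e 2; e 4;
      oct_h; omul (e 1) oct_h; omul (e 2) oct_h; omul (e 4) oct_h].

Definition E8_lattice : set O :=
  [set x | exists c : 'I_8 -> int,
             x = \sum_(k < 8) (c k)%:~R *: E8_generators`_k].

Definition Phi_E8 : set O :=
  [set x | E8_lattice x /\ omul x (oconj x) = e 0].

Definition triangles : seq (seq O) :=
  [:: [:: e 0;
          2^-1 *: (- e 0 - e 5 + e 6 + e 7);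
          2^-1 *: (- e 0 + e 5 - e 6 - e 7)];
      [:: - e 1;
          2^-1 *: (e 1 + e 3 + e 5 + e 6);
          2^-1 *: (e 1 - e 3 - e 5 - e 6)];
      [:: - e 2;
          2^-1 *: (e 2 + e 3 - e 5 - e 7);
          2^-1 *: (e 2 - e 3 + e 5 + e 7)];
      [:: e 4;
          2^-1 *: (e 3 - e 4 - e 6 + e 7);
          2^-1 *: (- e 3 - e 4 + e 6 - e 7)]].

Definition triangle (i : 'I_4) : set O := [set x | x \in nth [::] triangles i].

Definition antipodal (A : set O) : set O := [set x | A x \/ A (- x)].

Definition Phi_ext (i : 'I_4) : set O := antipodal (triangle i).

Definition Phi_perp (i : 'I_4) : set O :=
  [set x | Phi_E8 x /\ forall y, Phi_ext i y -> oform x y = 0].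

(* The triangles different from the i-th one. *)
Definition other_triangles (i : 'I_4) : set O :=
  [set x | exists2 j, j != i & triangle j x].

(** ** Root systems and their types *)

Definition cartan_integer (x a : O) : R := 2 * oform x a / oform a a.

Definition root_system (Psi : set O) : Prop :=
  [/\ finite_set Psi,
      ~ Psi 0,
      forall a b, Psi a -> Psi b -> Psi (b - cartan_integer b a *: a),
      forall a b, Psi a -> Psi b -> exists z : int, cartan_integer b a = z%:~R &
      forall a (c : R), Psi a -> Psi (c *: a) -> c = 1 \/ c = -1].

(* Psi is a root system possessing a base of simple roots with Cartan
   matrix C. *)
Definition root_system_of_type n (C : 'M[int]_n) (Psi : set O) : Prop :=
  root_system Psi /\
  exists b : 'I_n -> O,
    [/\ forall k, Psi (b k),
        free [seq b k | k : 'I_n],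
        forall a, Psi a -> exists z : 'I_n -> int,
          a = \sum_k (z k)%:~R *: b k /\
          ((forall k, 0 <= z k) \/ (forall k, z k <= 0)) &
        forall k l, cartan_integer (b k) (b l) = (C k l)%:~R].

(* Cartan matrix of a simply laced Dynkin diagram with n nodes. *)
Definition simply_laced_cartan n (edges : seq (nat * nat)) : 'M[int]_n :=
  \matrix_(k, l)
    if k == l then 2
    else if (((k : nat), (l : nat)) \in edges) ||
            (((l : nat), (k : nat)) \in edges) then -1
    else 0.

Definition cartan_A2 : 'M[int]_2 := simply_laced_cartan 2 [:: (0, 1)]%N.
Definition cartan_A2_3 : 'M[int]_6 :=
  simply_laced_cartan 6 [:: (0, 1); (2, 3); (4, 5)]%N.
Definition cartan_A2_4 : 'M[int]_8 :=
  simply_laced_cartan 8 [:: (0, 1); (2, 3); (4, 5); (6, 7)]%N.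
Definition cartan_E6 : 'M[int]_6 :=
  simply_laced_cartan 6 [:: (0, 2); (2, 3); (3, 4); (4, 5); (1, 3)]%N.
Definition cartan_E8 : 'M[int]_8 :=
  simply_laced_cartan 8
    [:: (0, 2); (2, 3); (3, 4); (4, 5); (5, 6); (6, 7); (1, 3)]%N.

(* An identification of Psi with the root system of sl_3.  The roots of sl_3
   are eps_k - eps_l, where eps_k is the k-th diagonal entry, a functional on
   traceless diagonal matrices, so that eps_0 + eps_1 + eps_2 = 0; the eps_k
   are the weights of the standard representation 3 and the - eps_k those of
   its dual.  Here v k is the vector corresponding to eps_k. *)
Definition sl3_frame (Psi : set O) (v : 'I_3 -> O) : Prop :=
  \sum_k v k = 0 /\
  Psi = [set x | exists k l, k != l /\ x = v k - v l].

Definition weights_3 (v : 'I_3 -> O) : set O := [set v k | k in [set: 'I_3]].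
Definition weights_3bar (v : 'I_3 -> O) : set O :=
  [set - v k | k in [set: 'I_3]].

(* The roots in Phi_E8 whose orthogonal projection to the span of Psi is w. *)
Definition projection_fiber (Psi : set O) (w : O) : set O :=
  [set a | [/\ Phi_E8 a, lspan Psi w &
               forall y, lspan Psi y -> oform (a - w) y = 0]].

End Lattice.

Arguments Phi_E8 R : clear implicits.
Arguments triangle R i : clear implicits.
Arguments Phi_ext R i : clear implicits.
Arguments Phi_perp R i : clear implicits.
Arguments other_triangles R i : clear implicits.

(** * Finite-dimensional Lie algebras *)

HB.mixin Record Vector_isLie (K : fieldType) L of Vector K L := {
  lie : L -> L -> L;
  lieDl : forall a x y z, lie (a *: x + y) z = a *: lie x z + lie y z;
  lieDr : forall a x y z, lie z (a *: x + y) = a *: lie z x + lie z y;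
  liexx : forall x, lie x x = 0;
  lie_jacobi : forall x y z,
    lie x (lie y z) + lie y (lie z x) + lie z (lie x y) = 0
}.

#[short(type="lieAlgType")]
HB.structure Definition LieAlgebra (K : fieldType) :=
  { L of Vector_isLie K L & Vector K L }.

(* Lie algebras are handled as subspaces g of an ambient Lie algebra, and maps
   defined on g as maps on the ambient algebra whose values off g are
   irrelevant. *)
Section LieTheory.
Variables (K : fieldType) (L : lieAlgType K).
Implicit Types (g h V : {vspace L}) (x y t : L) (lam mu alpha : 'Hom(L, K^o)).

Definition subalgebra g : Prop :=
  forall x y, x \in g -> y \in g -> lie x y \in g.

Definition generated_subalgebra (A : set L) g : Prop :=
  [/\ subalgebra g,
      forall x, A x -> x \in g &
      forall g', subalgebra g' -> (forall x, A x -> x \in g') -> (g <= g')%VS].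

Definition simple_lie g : Prop :=
  [/\ subalgebra g,
      exists x y, [/\ x \in g, y \in g & lie x y != 0] &
      forall J : {vspace L}, (J <= g)%VS ->
        (forall x y, x \in g -> y \in J -> lie x y \in J) ->
        J = 0%VS \/ J = g].

Definition commuting g1 g2 : Prop :=
  forall x y, x \in g1 -> y \in g2 -> lie x y = 0.

(** ** Cartan subalgebras and roots *)

Definition root_space g h lam : set L :=
  [set x | x \in g /\ forall t, t \in h -> lie t x = (lam t : K) *: x].

(* For semisimple g over the complex numbers: h is abelian, equal to its own
   centralizer in g, and ad h is diagonalizable on g. *)
Definition cartan_subalgebra g h : Prop :=
  [/\ (h <= g)%VS,
      commuting h h,
      forall x, x \in g -> (forall t, t \in h -> lie t x = 0) -> x \in h &
      forall x, x \in g -> lspan [set y | exists lam, root_space g h lam y] x].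

(* Functionals are only relevant through their restriction to h. *)
Definition is_root g h lam : Prop :=
  (exists2 t, t \in h & lam t != 0) /\
  (exists2 x, x != 0 & root_space g h lam x).

(** ** Representations, by matrices acting on column vectors *)

Definition representation g n (rho : L -> 'M[K]_n) : Prop :=
  (forall a x y, x \in g -> y \in g -> rho (a *: x + y) = a *: rho x + rho y)
  /\ (forall x y, x \in g -> y \in g ->
        rho (lie x y) = rho x *m rho y - rho y *m rho x).

Definition dual_rep n (rho : L -> 'M[K]_n) : L -> 'M[K]_n :=
  fun x => - (rho x)^T.

Definition isomorphic_rep g n (rho rho' : L -> 'M[K]_n) : Prop :=
  exists2 P : 'M[K]_n, P \in unitmx &
    forall x, x \in g -> P *m rho x = rho' x *m P.

Definition irreducible_rep g n (rho : L -> 'M[K]_n) : Prop :=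
  [/\ representation g rho, (0 < n)%N &
      forall U : {vspace 'cV[K]_n},
        (forall x u, x \in g -> u \in U -> rho x *m u \in U) ->
        U = 0%VS \/ U = fullv].

Definition is_weight h n (rho : L -> 'M[K]_n) lam : Prop :=
  exists2 u : 'cV[K]_n, u != 0 &
    forall t, t \in h -> rho t *m u = (lam t : K) *: u.

(* mu is the image of lam under the reflection in the root alpha; lie e f is
   the coroot of alpha. *)
Definition weyl_reflected g h lam mu : Prop :=
  exists alpha e f,
    [/\ is_root g h alpha, root_space g h alpha e, root_space g h (- alpha) f,
        alpha (lie e f) = 2 :> K &
        forall t, t \in h ->
          mu t = (lam t : K) - (lam (lie e f) : K) * (alpha t : K) :> K].

Inductive weyl_conjugate g h lam : 'Hom(L, K^o) -> Prop :=
| WeylRefl mu : {in h, lam =1 mu} -> weyl_conjugate g h lam mu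
| WeylStep mu mu' : weyl_conjugate g h lam mu -> weyl_reflected g h mu mu' ->
    weyl_conjugate g h lam mu'.

(* Irreducible, with the Weyl group acting transitively on the weights. *)
Definition minuscule_rep g h n (rho : L -> 'M[K]_n) : Prop :=
  irreducible_rep g rho /\
  forall lam mu, is_weight h rho lam -> is_weight h rho mu ->
    weyl_conjugate g h lam mu.

(* sigma is an isomorphism from g onto sl_n; it is then also the standard
   representation of g so identified. *)
Definition iso_sl g n (sigma : L -> 'M[K]_n) : Prop :=
  [/\ subalgebra g,
      representation g sigma,
      forall x, x \in g -> sigma x = 0 -> x = 0 &
      forall A : 'M[K]_n, \tr A = 0 <-> exists2 x, x \in g & sigma x = A].

(* V, under the adjoint action of the sum of the commuting subalgebras g1 and
   g2, is the module (rho1, rho2), i.e., the external tensor product. *)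
Definition tensor_module2 g1 g2 V n1 n2
    (rho1 : L -> 'M[K]_n1) (rho2 : L -> 'M[K]_n2) : Prop :=
  exists phi : 'Hom('cV[K]_(n1 * n2), L),
    [/\ lker phi = 0%VS, limg phi = V &
        forall x1 x2 u, x1 \in g1 -> x2 \in g2 ->
          lie (x1 + x2) (phi u) =
          phi ((rho1 x1 *t 1%:M + 1%:M *t rho2 x2) *m u)].

Definition tensor_module3 g1 g2 g3 V n1 n2 n3
    (rho1 : L -> 'M[K]_n1) (rho2 : L -> 'M[K]_n2) (rho3 : L -> 'M[K]_n3) :
    Prop :=
  exists phi : 'Hom('cV[K]_(n1 * n2 * n3), L),
    [/\ lker phi = 0%VS, limg phi = V &
        forall x1 x2 x3 u, x1 \in g1 -> x2 \in g2 -> x3 \in g3 ->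
          lie (x1 + x2 + x3) (phi u) =
          phi (((rho1 x1 *t 1%:M) *t 1%:M +
                (1%:M *t rho2 x2) *t 1%:M +
                (1%:M *t 1%:M) *t rho3 x3) *m u)].

End LieTheory.

(** * Complex Lie algebras whose roots are octonions *)

Section OctonionRoots.
Variables (R : realType) (L : lieAlgType R[i]).
Local Notation C := R[i].

Definition oct_complex (x : oct R) : oct C := map_mx (real_complex R) x.

Definition complex_span (Psi : set (oct R)) : set (oct C) :=
  lspan (oct_complex @` Psi).

(* h is a Cartan subalgebra of the simple Lie algebra g, and the roots of
   (g, h) are identified with Psi: theta identifies h with the complex span of
   Psi in such a way that the roots are the functionals <alpha, _> with alpha
   in Psi. *)
Definition simple_with_roots (g h : {vspace L}) (Psi : set (oct R))
    (theta : 'Hom(oct C, L)) : Prop :=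
  let S := complex_span Psi in
  [/\ simple_lie g,
      cartan_subalgebra g h,
      forall t, t \in h <-> exists2 c, S c & theta c = t,
      forall c, S c -> theta c = 0 -> c = 0 &
      forall lam : 'Hom(L, C^o),
        is_root g h lam <->
        exists2 a, Psi a & forall c, S c -> lam (theta c) = oform (oct_complex a) c].

(* The union of the root spaces of e_8 for the roots in Psi. *)
Definition root_vectors (theta : 'Hom(oct C, L)) (Psi : set (oct R)) : set L :=
  [set x | exists2 a, Psi a &
             forall c, lie (theta c) x = oform (oct_complex a) c *: x].

End OctonionRoots.

(* Main.v *)
Require Import Defs.
From HB Require Import structures.
From mathcomp Require Import all_boot all_order all_algebra.
From mathcomp Require Import boolp classical_sets cardinality reals.
From mathcomp Require Import finmap complex mxtens.
From mathcomp Require Import ring lra zify.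

(** The roots of E8 have half-integral coordinates, so they can be listed
    ([roots]) and the finitely many assertions on types, cardinalities and
    orthogonality are settled by evaluation.  A nonzero idempotent of the
    lattice is a root because the norm is multiplicative for the Okubo product
    ([onorm_okubo]), hence equal to 1 on idempotents; testing the 240 roots
    leaves the twelve members of the triangles ([idempotentsE]).

    The planes of the four triangles are orthogonal and the twelve idempotents
    form a tight frame ([tight_frame]); every statement on spans and on
    nondegeneracy of the form, over the reals as well as over the complex
    numbers, follows from this.  The weights of 3 in the plane of a triangle
    t_0, t_1, t_2 are v_k = (t_k - t_(k+1)) / 3, and the differences
    d_k = v_k - v_0 are roots for k <> 0.  A root over v_k is recognized by its
    inner products with the d_l ([in_fiber]); as the inner product of v_k with
    v_l - v_k is -1, adding d_l - d_k takes the fiber over v_k to the fiber over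
    v_l ([in_fiber_shift]).  So the 81 roots over the three weights are the
    sums F_p + d_k, where F_p runs through the fiber over v_0.

    The structure of e_8 is derived from the bare hypothesis that it is simple
    with the given roots, without the Killing form.  Opposite root vectors
    bracket to a multiple of the coroot ([lie_opposite]); were that bracket
    zero for some root, such root spaces would span a proper ideal
    ([all_nondeg]).  Hence root spaces are lines, and two root vectors with
    inner product -1 have a nonzero bracket ([lie_root_neq0]).  For a closed
    subsystem P, the span of its coroots and root spaces is the subalgebra
    generated by the root spaces ([gr_generated]), with the expected Cartan
    subalgebra and roots ([gr_cartan], [is_rootP]), and simple if P is
    irreducible ([gr_simple]).

    The algebra sl_3 of a triangle acts on the three root vectors
    u, [x_1, u], [x_2, u], where u and the x_k have weights F_0 and d_k, by an
    isomorphism onto the traceless matrices ([A2_iso_sl]).  Since e_6 commutes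
    with sl_3, this matrix does not change when u is moved by e_6, so it is the
    same over all F_p ([link_typical]), and the 81 root spaces form an external
    tensor product ([tensor_V]).  The opposite 81 root spaces carry the dual
    matrices, by the Jacobi identity on a basis dual with respect to the bracket
    ([dual_coef]).  The 27-dimensional modules are minuscule because every
    weight is joined to a fixed one by at most two steps along roots of E6
    ([fiber_link], [module_minuscule]), and they are not isomorphic because the
    sum of two weights of the fiber is never orthogonal to E6
    ([fiber_not_opposite]).

    For the trinification the same argument is run with three commuting copies
    of sl_3, starting from a root all of whose three projections are weights
    ([glue], [trini_tensor]); inner products with a suitable vector, taken
    modulo 3, give the grading ([grade], [graded_bracket]). *)

Set Implicit Arguments.
Unset Strict Implicit.
Unset Printing Implicit Defensive.

Import Order.TTheory GRing.Theory Num.Theory.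

Local Open Scope classical_set_scope.
Local Open Scope card_scope.
Local Open Scope ring_scope.
Local Open Scope complex_scope.

(** * Octonions in coordinates *)

Section OctonionProduct.
Variable K : fieldType.
Implicit Types (x y : oct K) (v w : seq int).

(** Octonions with integral coordinates are handled as lists of integers, on
    which the statements about the finitely many roots can be evaluated. *)
Definition vec v : oct K := \row_j (v`_j)%:~R.

Definition vmap2 (f : int -> int -> int) v w : seq int :=
  mkseq (fun j => f v`_j w`_j) 8.
Definition vadd := vmap2 +%R.
Definition vopp v : seq int := mkseq (fun j => - v`_j) 8.
Definition vscale (c : int) v : seq int := mkseq (fun j => c * v`_j) 8.
Definition unitv k : seq int := mkseq (fun j => (j == k)%:Z) 8.

Lemma vecD v w : vec (vadd v w) = vec v + vec w.
Proof. by apply/rowP => j; rewrite !mxE nth_mkseq // rmorphD. Qed.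

Lemma vecN v : vec (vopp v) = - vec v.
Proof. by apply/rowP => j; rewrite !mxE nth_mkseq // rmorphN. Qed.

Lemma vecZ c v : vec (vscale c v) = c%:~R *: vec v.
Proof. by apply/rowP => j; rewrite !mxE nth_mkseq // rmorphM. Qed.

Lemma vec0 : vec (nseq 8 0) = 0.
Proof. by apply/rowP => j; rewrite !mxE nth_nseq if_same. Qed.

Lemma vec_unit k : vec (unitv k) = oe K k.
Proof. by apply/rowP => j; rewrite !mxE nth_mkseq //; case: (_ == _). Qed.

Lemma vec_foldr (I : Type) (r : seq I) (F : I -> seq int) :
  vec (foldr (fun i => vadd (F i)) (nseq 8 0) r) = \sum_(i <- r) vec (F i).
Proof.
elim: r => [|i r IH]; first by rewrite big_nil vec0.
by rewrite big_cons /= vecD IH.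
Qed.

Definition oe_mulz (a b : nat) : seq int :=
  if a == 0%N then unitv b else
  if b == 0%N then unitv a else
  if a == b then vopp (unitv 0) else
  foldr (fun t => vadd (let: (x, y, z) := t in
     if (a == x) && (b == y) then unitv z else
     if (b == x) && (a == y) then vopp (unitv z) else nseq 8 0))
   (nseq 8 0) oct_cyclic_triples.

Lemma oe_mulE a b : oe_mul K a b = vec (oe_mulz a b).
Proof.
rewrite /oe_mul /oe_mulz; do 3! (case: ifP => _; first by rewrite ?vecN ?vec_unit).
rewrite vec_foldr; apply: eq_bigr => -[[x y] z] _ /=.
case: ifP => _; first by rewrite vec_unit.
by case: ifP => _; rewrite ?vecN ?vec_unit ?vec0.
Qed.

(** The multiplication table read backwards: e_a times e_(mul_ix j a) is
    e_j up to the sign mul_sg j a, and no other product with left factor e_a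
    has a component along e_j. *)
Definition mul_ix (j a : nat) : nat := nth 0%N (nth [::]
  [:: [:: 0; 1; 2; 3; 4; 5; 6; 7]; [:: 1; 0; 4; 7; 2; 6; 5; 3];
      [:: 2; 4; 0; 6; 1; 7; 3; 5]; [:: 3; 7; 6; 0; 5; 4; 2; 1];
      [:: 4; 2; 1; 5; 0; 3; 7; 6]; [:: 5; 6; 7; 4; 3; 0; 1; 2];
      [:: 6; 5; 3; 2; 7; 1; 0; 4]; [:: 7; 3; 5; 1; 6; 2; 4; 0]]%N j) a.
Definition mul_sg (j a : nat) : int := nth 0 (nth [::]
  [:: [:: 1; -1; -1; -1; -1; -1; -1; -1]; [:: 1; 1; 1; 1; -1; 1; -1; -1];
      [:: 1; -1; 1; 1; 1; -1; -1; 1]; [:: 1; -1; -1; 1; -1; 1; 1; 1];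
      [:: 1; 1; -1; 1; 1; -1; 1; -1]; [:: 1; -1; 1; -1; 1; 1; 1; -1];
      [:: 1; 1; 1; -1; -1; -1; 1; 1]; [:: 1; 1; -1; -1; 1; 1; -1; 1]] j) a.

Lemma oe_mul_table (a b j : 'I_8) :
  oe_mul K a b 0 j = ((b : nat) == mul_ix j a)%:R * (mul_sg j a)%:~R.
Proof.
rewrite oe_mulE mxE.
have H : all (fun a => all (fun b => all (fun j =>
    (oe_mulz a b)`_j == (b == mul_ix j a)%:R * mul_sg j a)
  (iota 0 8)) (iota 0 8)) (iota 0 8) by vm_compute.
have I (i : 'I_8) : (i : nat) \in iota 0 8 by rewrite mem_iota ltn_ord.
rewrite (eqP (allP (allP (allP H _ (I a)) _ (I b)) _ (I j))).
by rewrite rmorphM /= rmorph_nat.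
Qed.

(** The index is a natural number so that a sum over the eight coordinates
    unfolds into an explicit polynomial. *)
Definition co x (k : nat) : K := x 0 (inord k).

Lemma coE x (j : 'I_8) : x 0 j = co x j.
Proof. by rewrite /co inord_val. Qed.

Lemma mul_ix_lt (a j : 'I_8) : (mul_ix j a < 8)%N.
Proof.
have H : all (fun j => all (fun a => mul_ix j a < 8)%N (iota 0 8)) (iota 0 8).
  by vm_compute.
have I (i : 'I_8) : (i : nat) \in iota 0 8 by rewrite mem_iota ltn_ord.
exact: allP (allP H _ (I j)) _ (I a).
Qed.

Lemma omulE x y (j : 'I_8) :
  omul x y 0 j = \sum_(a < 8) (mul_sg j a)%:~R * (co x a * co y (mul_ix j a)).
Proof.
rewrite summxE; apply: eq_bigr => a _; rewrite summxE.
rewrite (bigD1 (inord (mul_ix j a))) //= big1 => [|b nb].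
  rewrite addr0 mxE oe_mul_table inordK ?mul_ix_lt // eqxx mul1r mulrC.
  by rewrite -coE.
rewrite mxE oe_mul_table.
case: eqP => [E|_]; last by rewrite mul0r mulr0.
by case/eqP: nb; apply: val_inj; rewrite /= inordK ?mul_ix_lt.
Qed.

Lemma oconjE x j : oconj x 0 j = (if (j : nat) == 0%N then 1 else -1) * x 0 j.
Proof. by rewrite mxE; case: ifP; rewrite ?mul1r ?mulN1r. Qed.

Lemma oformE x y : oform x y = 2 * \sum_(k < 8) x 0 k * y 0 k.
Proof.
have E (u w : oct K) : omul u (oconj w) 0 0 = \sum_(k < 8) u 0 k * w 0 k.
  rewrite omulE; apply: eq_bigr => a _.
  have -> : mul_ix (0%R : 'I_8) a = a by case: a => -[|[|[|[|[|[|[|[|]]]]]]]].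
  rewrite /co inord_val oconjE /mul_sg.
  by case: a => -[|[|[|[|[|[|[|[|a]]]]]]]] //= H; ring.
rewrite /oform mxE !E (mulr_natl _ 2) mulr2n; congr (_ + _).
by apply: eq_bigr => k _; rewrite mulrC.
Qed.

Lemma sum8 (F : nat -> K) :
  \sum_(k < 8) F k = F 0%N + F 1%N + F 2%N + F 3%N + F 4%N + F 5%N + F 6%N + F 7%N.
Proof. by do 8 rewrite big_ord_recr /=; rewrite big_ord0 add0r. Qed.

End OctonionProduct.

(** * The norm and the Okubo product *)

Section OkuboProduct.
Variable K : fieldType.
Implicit Types (x y : oct K) (v w : seq int).

Definition onorm x : K := \sum_(k < 8) co x k ^+ 2.

Lemma onormE x : oform x x = 2 * onorm x.
Proof. by rewrite oformE; congr (_ * _); apply: eq_bigr => k _; rewrite coE. Qed.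

(** Degen's eight-square identity. *)
Lemma onormM x y : onorm (omul x y) = onorm x * onorm y.
Proof.
have -> : onorm (omul x y) = \sum_(j < 8)
    (\sum_(a < 8) (mul_sg j a)%:~R * (co x a * co y (mul_ix j a))) ^+ 2.
  by apply: eq_bigr => j _; rewrite -coE omulE.
rewrite /onorm (sum8 (fun j => (\sum_(a < 8)
   (mul_sg j a)%:~R * (co x a * co y (mul_ix j a))) ^+ 2)).
rewrite !(sum8 (fun a => (mul_sg _ a)%:~R * (co x a * co y (mul_ix _ a)))).
rewrite (sum8 (fun k => co x k ^+ 2)) (sum8 (fun k => co y k ^+ 2)).
rewrite /mul_sg /mul_ix /=; ring.
Qed.

Lemma omul_conj x : omul x (oconj x) = onorm x *: oe K 0.
Proof.
apply/rowP => j; rewrite omulE !mxE.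
have E k : (k < 8)%N -> co (oconj x) k = (if k == 0%N then 1 else -1) * co x k.
  by move=> lt; rewrite /co oconjE inordK.
have -> : onorm x = \sum_(k < 8) co x k ^+ 2 by [].
rewrite (sum8 (fun a => (mul_sg j a)%:~R * (co x a * co (oconj x) (mul_ix j a)))).
rewrite (sum8 (fun k => co x k ^+ 2)).
by case: j => -[|[|[|[|[|[|[|[|j]]]]]]]] //= lt;
  rewrite /mul_sg /mul_ix /= !E //=; ring.
Qed.

Definition tau_ix (j : nat) : nat := nth 0%N [:: 0; 4; 1; 3; 2; 6; 7; 5]%N j.
Definition tau_sg (j : nat) : int := nth 0 [:: 1; -1; 1; 1; -1; -1; 1; -1] j.

Lemma tauE x (j : 'I_8) : tau x 0 j = (tau_sg j)%:~R * co x (tau_ix j).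
Proof.
rewrite /tau summxE.
have -> : \sum_(k < 8) (x 0 k *: (tau_basis K)`_k) 0 j =
          \sum_(k < 8) co x k * (tau_basis K)`_k 0 j.
  by apply: eq_bigr => k _; rewrite mxE coE.
rewrite (sum8 (fun k => co x k * (tau_basis K)`_k 0 j)) /tau_basis /=.
by case: j => -[|[|[|[|[|[|[|[|j]]]]]]]] //= lt;
  rewrite /tau_sg /tau_ix !mxE /=; ring.
Qed.

Lemma onorm_tau x : onorm (tau x) = onorm x.
Proof.
have -> : onorm (tau x) =
    \sum_(j < 8) ((tau_sg j)%:~R * co x (tau_ix j)) ^+ 2.
  by apply: eq_bigr => j _; rewrite -coE tauE.
rewrite /onorm (sum8 (fun j => ((tau_sg j)%:~R * co x (tau_ix j)) ^+ 2)).
rewrite (sum8 (fun k => co x k ^+ 2)) /tau_sg /tau_ix /=; ring.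
Qed.

Lemma onorm_conj x : onorm (oconj x) = onorm x.
Proof.
apply: eq_bigr => j _; rewrite -!coE oconjE.
by case: ifP => _; rewrite ?mul1r // mulN1r sqrrN.
Qed.

(** The Okubo product is a composition product: its norm is multiplicative,
    since the norms of O are and both conjugation and tau are isometries. *)
Lemma onorm_okubo x y : onorm (okubo x y) = onorm x * onorm y.
Proof. by rewrite /okubo onormM !onorm_tau !onorm_conj. Qed.

Definition mulz v w : seq int := mkseq (fun j =>
  foldr (fun a s => mul_sg j a * (v`_a * w`_(mul_ix j a)) + s) 0 (iota 0 8)) 8.
Definition conjz v : seq int :=
  mkseq (fun j => if j == 0%N then v`_j else - v`_j) 8.
Definition tauz v : seq int := mkseq (fun j => tau_sg j * v`_(tau_ix j)) 8.
Definition okuboz v w := mulz (tauz (conjz v)) (tauz (tauz (conjz w))).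

Lemma co_vec v k : (k < 8)%N -> co (vec K v) k = (v`_k)%:~R.
Proof. by move=> lt; rewrite /co mxE inordK. Qed.

Lemma vec_mul v w : omul (vec K v) (vec K w) = vec K (mulz v w).
Proof.
apply/rowP => j; rewrite omulE mxE nth_mkseq //.
rewrite (sum8 (fun a => (mul_sg j a)%:~R *
   (co (vec K v) a * co (vec K w) (mul_ix j a)))).
rewrite [foldr _ _ _]/= addr0 !rmorphD !rmorphM /= !addrA.
by case: j => -[|[|[|[|[|[|[|[|j]]]]]]]] //= lt; rewrite /mul_ix /= !co_vec.
Qed.

Lemma vec_conj v : oconj (vec K v) = vec K (conjz v).
Proof.
apply/rowP => j; rewrite oconjE !mxE nth_mkseq //.
by case: ifP; rewrite ?mul1r // mulN1r rmorphN.
Qed.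

Lemma vec_tau v : tau (vec K v) = vec K (tauz v).
Proof.
apply/rowP => j; rewrite tauE mxE nth_mkseq // rmorphM /= co_vec //.
by case: j => -[|[|[|[|[|[|[|[|j]]]]]]]].
Qed.

Lemma vec_okubo v w : okubo (vec K v) (vec K w) = vec K (okuboz v w).
Proof. by rewrite /okubo !vec_conj !vec_tau vec_mul. Qed.

Lemma coZ (c : K) x k : co (c *: x) k = c * co x k.
Proof. by rewrite /co mxE. Qed.

Lemma omulZl (c : K) x y : omul (c *: x) y = c *: omul x y.
Proof.
apply/rowP => j; rewrite [RHS]mxE !omulE mulr_sumr; apply: eq_bigr => a _.
by rewrite coZ; ring.
Qed.

Lemma omulZr (c : K) x y : omul x (c *: y) = c *: omul x y.
Proof.
apply/rowP => j; rewrite [RHS]mxE !omulE mulr_sumr; apply: eq_bigr => a _.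
by rewrite coZ; ring.
Qed.

Lemma oconjZ (c : K) x : oconj (c *: x) = c *: oconj x.
Proof.
by apply/rowP => j; rewrite oconjE [RHS]mxE oconjE !coE coZ; ring.
Qed.

Lemma tauZ (c : K) x : tau (c *: x) = c *: tau x.
Proof. by apply/rowP => j; rewrite [RHS]mxE !tauE coZ; ring. Qed.

Lemma okuboZ (a b : K) x y : okubo (a *: x) (b *: y) = (a * b) *: okubo x y.
Proof. by rewrite /okubo !oconjZ !tauZ omulZl omulZr scalerA. Qed.

End OkuboProduct.

(** * The lattice and its 240 roots *)

Section RootList.
Variable R : realType.
Implicit Types (x y : oct R) (v w : seq int).

(** All the vectors that matter have coordinates in 1/2 Z; v encodes the
    octonion v / 2. *)
Definition half v : oct R := 2^-1 *: vec R v.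

Definition dotz v w : int := foldr (fun p s => p.1 * p.2 + s) 0 (zip v w).

Lemma oform_half v w : size v = 8%N -> size w = 8%N ->
  oform (half v) (half w) = (dotz v w)%:~R / 2.
Proof.
case: v => [|v0 [|v1 [|v2 [|v3 [|v4 [|v5 [|v6 [|v7 [|v8 v]]]]]]]]] //= _.
case: w => [|w0 [|w1 [|w2 [|w3 [|w4 [|w5 [|w6 [|w7 [|w8 w]]]]]]]]] //= _.
rewrite oformE.
rewrite (eq_bigr (fun k : 'I_8 => 2^-1 * 2^-1 *
   ([:: v0; v1; v2; v3; v4; v5; v6; v7]`_k)%:~R *
   ([:: w0; w1; w2; w3; w4; w5; w6; w7]`_k)%:~R)); last first.
  by move=> k _; rewrite !mxE; ring.
rewrite (sum8 (fun k => 2^-1 * 2^-1 *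
   ([:: v0; v1; v2; v3; v4; v5; v6; v7]`_k)%:~R *
   ([:: w0; w1; w2; w3; w4; w5; w6; w7]`_k)%:~R)) /dotz /=; field; rewrite ?pnatr_eq0 //.
Qed.

Lemma half_inj v w : size v = 8%N -> size w = 8%N -> half v = half w -> v = w.
Proof.
move=> sv sw /(congr1 (fun x => 2 *: x)); rewrite !scalerA divff ?pnatr_eq0 //.
rewrite !scale1r => E; apply: (@eq_from_nth _ 0) => [|k]; rewrite ?sw // sv.
move=> lt; move/rowP/(_ (Ordinal lt)): E; rewrite !mxE /=.
exact: intr_inj.
Qed.

(** The congruences that cut the lattice out of the half-integral vectors:
    coordinates 3, 5, 6 and 7 can be prescribed, and determine the parities of
    the other four. *)
Definition in_latz v : bool :=
  if v is [:: y0; y1; y2; y3; y4; y5; y6; y7] then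
    [&& (2 %| y0 + y5 + y6 + y7)%Z, (2 %| y1 - y3 - y6 + y5)%Z,
        (2 %| y2 - y3 + y7 - y5)%Z & (2 %| y4 - y3 - y7 + y6)%Z]
  else false.

Lemma in_latz_size v : in_latz v -> size v = 8%N.
Proof. by case: v => [|v0 [|v1 [|v2 [|v3 [|v4 [|v5 [|v6 [|v7 [|v8 v]]]]]]]]]. Qed.

Definition E8_genz : seq (seq int) :=
  let h := [:: 0; 1; 1; 1; 1; 0; 0; 0] in
  [:: vscale 2 (unitv 0); vscale 2 (unitv 1); vscale 2 (unitv 2);
      vscale 2 (unitv 4);
      h; mulz (unitv 1) h; mulz (unitv 2) h; mulz (unitv 4) h].

Lemma half_double v : half (vscale 2 v) = vec R v.
Proof. by rewrite /half vecZ scalerA mulVf ?scale1r // pnatr_eq0. Qed.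

Lemma E8_generatorsE : E8_generators R = [seq half v | v <- E8_genz].
Proof.
have hE : oct_h R = half [:: 0; 1; 1; 1; 1; 0; 0; 0].
  apply/rowP => j; rewrite !mxE.
  by case: j => -[|[|[|[|[|[|[|[|j]]]]]]]] //= lt; ring.
by rewrite /E8_generators /E8_genz /map hE !half_double !vec_unit -!vec_unit
  /half !omulZr !vec_mul.
Qed.

(** The coefficients of the generators containing h are read off from
    coordinates 3, 5, 6 and 7; the other four generators then account for
    coordinates 0, 1, 2 and 4, which is where the congruences come from. *)
Lemma E8_latticeP x :
  E8_lattice x <-> exists2 v, in_latz v & x = half v.
Proof.
have combE (c : 'I_8 -> int) (d : nat -> int) (j : 'I_8) :
    (forall k : 'I_8, c k = d k) ->
  (\sum_(k < 8) (c k)%:~R *: (E8_generators R)`_k) 0 j =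
  2^-1 * (foldr (fun k s => d k * (nth [::] E8_genz k)`_j + s) 0 (iota 0 8))%:~R.
  move=> cd; rewrite summxE (eq_bigr (fun k : 'I_8 =>
     2^-1 * (d k)%:~R * ((nth [::] E8_genz k)`_j)%:~R)).
    rewrite (sum8 (fun k => 2^-1 * (d k)%:~R * ((nth [::] E8_genz k)`_j)%:~R)).
    by rewrite [foldr _ _ _]/=; ring.
  move=> k _; rewrite cd E8_generatorsE (nth_map [::]) ?ltn_ord //.
  by rewrite !mxE; ring.
split=> [[c ->]|[v vL ->]].
  pose d k := c (inord k).
  exists [:: 2 * d 0%N - d 5%N - d 6%N - d 7%N; 2 * d 1%N + d 4%N + d 6%N - d 7%N;
     2 * d 2%N + d 4%N - d 5%N + d 7%N; d 4%N; 2 * d 3%N + d 4%N + d 5%N - d 6%N;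
     d 7%N; d 6%N; d 5%N].
    by apply/and4P; split; apply/dvdzP;
      [exists (d 0%N) | exists (d 1%N) | exists (d 2%N) | exists (d 3%N)]; ring.
  apply/rowP => j; rewrite (combE c d) => [|k]; last by rewrite /d inord_val.
  rewrite !mxE; congr (_ * _%:~R).
  by case: j => -[|[|[|[|[|[|[|[|j]]]]]]]] //= lt; rewrite /mul_ix /mul_sg /=; ring.
case: v vL => [|v0 [|v1 [|v2 [|v3 [|v4 [|v5 [|v6 [|v7 [|v8 v]]]]]]]]] //=.
case/and4P=> /dvdzP[q0 E0] /dvdzP[q1 E1] /dvdzP[q2 E2] /dvdzP[q3 E3].
pose d k := [:: q0; q1; q2; q3; v3; v7; v6; v5]`_k.
exists (fun k => d k); apply/rowP => j; rewrite (combE _ d) // !mxE.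
congr (_ * _%:~R).
by case: j => -[|[|[|[|[|[|[|[|j]]]]]]]] //= lt;
  rewrite /d /mul_ix /mul_sg /=; lia.
Qed.

(** The integer vectors of length n and squared norm N; entries between -2 and 2
    suffice as long as N <= 4. *)
Fixpoint vectors (n N : nat) : seq (seq int) :=
  if n is n'.+1 then
    flatten [seq [seq d :: v | v <- vectors n' (N - `|d| ^ 2)]
            | d <- [seq d <- [:: -2; -1; 0; 1; 2] | (`|d| ^ 2 <= N)%N]]
  else if N == 0%N then [:: [::]] else [::].

Lemma vectorsS n N : vectors n.+1 N =
  flatten [seq [seq d :: v | v <- vectors n (N - `|d| ^ 2)]
          | d <- [seq d <- [:: -2; -1; 0; 1; 2] | (`|d| ^ 2 <= N)%N]].
Proof. by []. Qed.

Lemma vectorsP v N : (N <= 4)%N -> dotz v v = N -> v \in vectors (size v) N.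
Proof.
elim: v N => [|d v IH] N leN E.
  by have /= -> : N = 0%N by case: E => /esym.
rewrite {1}/dotz /= -/(dotz v v) in E.
have ge0 u : 0 <= dotz u u.
  by elim: u => [|a u IHu] //=; rewrite /dotz /= addr_ge0 // sqr_ge0.
have dE : d * d = (`|d| ^ 2)%N%:Z by rewrite -mulnn PoszM; case: d {E} => k /=; nia.
have E' : (`|d| ^ 2)%N%:Z + dotz v v = N%:Z by rewrite -dE.
have le : (`|d| ^ 2 <= N)%N by have := ge0 v; lia.
rewrite vectorsS; apply/flatten_mapP; exists d; last first.
  by apply: map_f; apply: IH; [lia | lia].
rewrite mem_filter le.
have : (`|d| <= 2)%N by nia.
by case: d {E dE E' le} => [[|[|[|]]]|[|[|]]].
Qed.

End RootList.

(* Locked, so that simplification does not expand the 240 vectors. *)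
HB.lock Definition roots : seq (seq int) :=
  [seq v <- vectors 8 4 | in_latz v].

Section PhiE8.
Variable R : realType.
Implicit Types (x y : oct R) (v w : seq int).
Local Notation half := (@half R).

Lemma size_roots : size roots = 240%N. Proof. by rewrite unlock; vm_compute. Qed.
Lemma uniq_roots : uniq roots. Proof. by rewrite unlock; vm_compute. Qed.

Lemma roots_size v : v \in roots -> size v = 8%N.
Proof. by rewrite unlock mem_filter => /andP[/in_latz_size]. Qed.

Lemma roots_dot v : v \in roots -> dotz v v = 4.
Proof.
have /allP H : all (fun v => dotz v v == 4) roots.
  by rewrite unlock; vm_compute.
by move/H/eqP.
Qed.

Lemma Phi_E8_form x : Phi_E8 R x <-> E8_lattice x /\ oform x x = 2.
Proof.
split=> -[xL E]; split=> //.
  rewrite onormE; move: E; rewrite omul_conj => /rowP/(_ 0).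
  by rewrite !mxE /= mulr1 => ->; rewrite mulr1.
move: E; rewrite onormE omul_conj => E.
have -> : onorm x = 1.
  by apply: (@mulfI _ 2); rewrite ?pnatr_eq0 // E mulr1.
by rewrite scale1r.
Qed.

Lemma Phi_E8E : Phi_E8 R = [set` [seq half v | v <- roots]].
Proof.
apply/seteqP; split=> x.
  case/Phi_E8_form=> /E8_latticeP[v vL ->] /=; have sv := in_latz_size vL.
  rewrite oform_half // => E. apply/mapP; exists v => //.
  rewrite unlock mem_filter vL -{1}sv.
  apply: vectorsP => //; apply: (@intr_inj R).
  have -> : (dotz v v)%:~R = 2 * ((dotz v v)%:~R / 2) :> R by field.
  by rewrite E; ring.
move=> /mapP[v vr ->]; apply/Phi_E8_form; split.
  by apply/E8_latticeP; exists v => //; move: vr; rewrite unlock mem_filter => /andP[].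
by rewrite oform_half ?roots_size // roots_dot //; field.
Qed.

End PhiE8.

(** * Root systems inside the roots of E8 *)

Section RealForm.
Variable K : fieldType.
Implicit Types x y z : oct K.

Lemma oformC x y : oform x y = oform y x.
Proof. by rewrite !oformE; congr (_ * _); apply: eq_bigr => k _; rewrite mulrC. Qed.

Lemma oformDl x y z : oform (x + y) z = oform x z + oform y z.
Proof.
rewrite !oformE -mulrDr -big_split /=; congr (_ * _).
by apply: eq_bigr => k _; rewrite mxE mulrDl.
Qed.

Lemma oformZl (c : K) x y : oform (c *: x) y = c * oform x y.
Proof.
rewrite !oformE mulrCA; congr (_ * _); rewrite mulr_sumr.
by apply: eq_bigr => k _; rewrite mxE mulrA.
Qed.

Lemma oformNl x y : oform (- x) y = - oform x y.
Proof. by rewrite -scaleN1r oformZl mulN1r. Qed.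

Lemma oformBl x y z : oform (x - y) z = oform x z - oform y z.
Proof. by rewrite oformDl oformNl. Qed.

Lemma oform0l y : oform 0 y = 0.
Proof. by rewrite -(scale0r (0 : oct K)) oformZl mul0r. Qed.

Lemma oformDr x y z : oform z (x + y) = oform z x + oform z y.
Proof. by rewrite !(oformC z) oformDl. Qed.

Lemma oformZr (c : K) x y : oform y (c *: x) = c * oform y x.
Proof. by rewrite !(oformC y) oformZl. Qed.

Lemma oformNr x y : oform y (- x) = - oform y x.
Proof. by rewrite !(oformC y) oformNl. Qed.

Lemma oformBr x y z : oform z (x - y) = oform z x - oform z y.
Proof. by rewrite oformDr oformNr. Qed.

Lemma oform0r y : oform y 0 = 0.
Proof. by rewrite oformC oform0l. Qed.

Lemma oform_suml (I : Type) (r : seq I) (F : I -> oct K) y :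
  oform (\sum_(i <- r) F i) y = \sum_(i <- r) oform (F i) y.
Proof.
elim: r => [|i r IH]; first by rewrite !big_nil oform0l.
by rewrite !big_cons oformDl IH.
Qed.

Lemma oform_sumr (I : Type) (r : seq I) (F : I -> oct K) y :
  oform y (\sum_(i <- r) F i) = \sum_(i <- r) oform y (F i).
Proof. by rewrite oformC oform_suml; apply: eq_bigr => i _; rewrite oformC. Qed.

End RealForm.

Section RootPairs.
Variable R : realType.
Implicit Types (x y a b : oct R) (v w : seq int).
Local Notation half := (@half R).

Lemma oform_eq0 x : oform x x = 0 -> x = 0.
Proof.
rewrite oformE => /eqP; rewrite mulf_eq0 pnatr_eq0 /= psumr_eq0; last first.
  by move=> k _; rewrite -expr2 sqr_ge0.
move/allP => H; apply/rowP => k; rewrite mxE.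
by have := H k (mem_index_enum k); rewrite mulf_eq0 orbb => /eqP.
Qed.

Lemma E8_lattice_comb (c d : int) x y :
  E8_lattice x -> E8_lattice y -> E8_lattice (c%:~R *: x + d%:~R *: y).
Proof.
case=> cx -> [cy ->]; exists (fun k => c * cx k + d * cy k).
rewrite !scaler_sumr -big_split; apply: eq_bigr => k _ /=.
by rewrite rmorphD !rmorphM /= scalerDl !scalerA.
Qed.

Lemma roots_pair v w : v \in roots -> w \in roots ->
  exists2 z : int, dotz v w = 2 * z & z \in [:: -2; -1; 0; 1; 2].
Proof.
have H : all (fun v => all (fun w => dotz v w \in [:: -4; -2; 0; 2; 4]) roots)
   roots by rewrite roots.unlock; vm_compute.
move=> vr wr; move: (allP (allP H _ vr) _ wr).
rewrite !inE => /or4P[/eqP->|/eqP->|/eqP->|/orP[/eqP->|/eqP->]].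
- by exists (-2).
- by exists (-1).
- by exists 0.
- by exists 1.
- by exists 2.
Qed.

Lemma Phi_norm a : Phi_E8 R a -> oform a a = 2.
Proof. by case/Phi_E8_form. Qed.

Lemma Phi_int a b : Phi_E8 R a -> Phi_E8 R b ->
  exists2 z : int, oform a b = z%:~R & z \in [:: -2; -1; 0; 1; 2].
Proof.
rewrite Phi_E8E => /mapP[v vr ->] /mapP[w wr ->].
have [z E zr] := roots_pair vr wr; exists z => //.
by rewrite oform_half ?roots_size // E rmorphM /=; field.
Qed.

Lemma Phi_opp a : Phi_E8 R a -> Phi_E8 R (- a).
Proof.
case/Phi_E8_form=> aL E; apply/Phi_E8_form.
rewrite oformNl oformNr opprK; split=> //.
have := E8_lattice_comb (-1) 0 aL aL.
by rewrite mulrNz mulr1z scale0r addr0 scaleN1r.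
Qed.

Lemma Phi_neq0 a : Phi_E8 R a -> a != 0.
Proof.
move/Phi_norm => E; apply/eqP => a0; move: E; rewrite a0 oform0l => /eqP.
by rewrite eq_sym pnatr_eq0.
Qed.

(** Phi(E8) is simply laced: two roots that are not proportional have inner
    product -1, 0 or 1, because a vector of norm 0 vanishes. *)
Lemma Phi_pair a b : Phi_E8 R a -> Phi_E8 R b ->
  [\/ b = a, b = - a | [\/ oform a b = -1, oform a b = 0 | oform a b = 1]].
Proof.
move=> aP bP; have [z E] := Phi_int aP bP; rewrite E.
have eq2 c : Phi_E8 R c -> oform a c = 2 -> c = a.
  move=> cP Ec; apply/eqP; rewrite -subr_eq0; apply/eqP; apply: oform_eq0.
  rewrite oformBl !oformBr (oformC c a) Ec !Phi_norm //; ring.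
rewrite !inE => /or4P[/eqP z2|/eqP->|/eqP->|/orP[/eqP->|/eqP z2]].
- apply: Or32; apply: oppr_inj; rewrite opprK; apply: eq2; first exact: Phi_opp.
  by rewrite oformNr E z2 /= opprK.
- by apply: Or33; apply: Or31.
- by apply: Or33; apply: Or32.
- by apply: Or33; apply: Or33.
- by apply: Or31; apply: eq2 => //; rewrite E z2.
Qed.

(** As |a + b|^2 = 4 + 2 <a, b>, the condition says that a + b has norm 2. *)
Lemma Phi_add a b : Phi_E8 R a -> Phi_E8 R b ->
  oform a b = -1 <-> Phi_E8 R (a + b).
Proof.
move=> aP bP; have /Phi_E8_form[aL aE] := aP; have /Phi_E8_form[bL bE] := bP.
have E : oform (a + b) (a + b) = 4 + 2 * oform a b.
  by rewrite oformDl !oformDr (oformC b a) aE bE; ring.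
split=> [ab|/Phi_norm]; last by rewrite E => H; lra.
apply/Phi_E8_form; split; last by rewrite E ab; ring.
by have := E8_lattice_comb 1 1 aL bL; rewrite !scale1r.
Qed.

Lemma Phi_reflection a b : Phi_E8 R a -> Phi_E8 R b ->
  Phi_E8 R (b - oform b a *: a).
Proof.
move=> aP bP; have /Phi_E8_form[aL aE] := aP; have /Phi_E8_form[bL bE] := bP.
have [z E _] := Phi_int bP aP; apply/Phi_E8_form; split.
  have := E8_lattice_comb 1 (- z) bL aL.
  by rewrite scale1r E rmorphN scaleNr.
by rewrite oformBl !oformBr !oformZl !oformZr (oformC a b) aE bE; ring.
Qed.

Lemma cartan_integerE a b : Phi_E8 R a -> cartan_integer b a = oform b a.
Proof. by move/Phi_norm=> E; rewrite /cartan_integer E; field. Qed.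

Lemma finite_Phi_sub (Psi : set (oct R)) : Psi `<=` Phi_E8 R -> finite_set Psi.
Proof.
by move/sub_finite_set; apply; rewrite Phi_E8E; apply: finite_seq.
Qed.

(** A set of roots is a root system as soon as it is stable under its own
    reflections: the remaining axioms are inherited. *)
Lemma root_system_sub (Psi : set (oct R)) : Psi `<=` Phi_E8 R ->
  (forall a b, Psi a -> Psi b -> Psi (b - oform b a *: a)) -> root_system Psi.
Proof.
move=> sP refl; split; first exact: finite_Phi_sub.
- by move/sP/Phi_neq0/eqP.
- by move=> a b aP bP; rewrite cartan_integerE; [exact: refl | exact: sP].
- move=> a b /sP aP /sP bP; rewrite cartan_integerE //.
  by have [z -> _] := Phi_int bP aP; exists z.
- move=> a c /sP aP /sP /Phi_norm; rewrite oformZl oformZr Phi_norm // => E.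
  have /eqP : (c - 1) * (c + 1) = 0 by lra.
  by rewrite mulf_eq0 subr_eq0 addr_eq0 => /orP[/eqP|/eqP]; [left|right].
Qed.

(** ** Sets of roots given by lists of integer vectors *)

Definition hset (s : seq (seq int)) : set (oct R) := [set` [seq half v | v <- s]].

Lemma hsetP s x : hset s x <-> exists2 v, v \in s & x = half v.
Proof. by split=> [/mapP|H]; [|apply/mapP]. Qed.

Lemma hset_sub s t : {subset s <= t} -> hset s `<=` hset t.
Proof. by move=> st x /hsetP[v vs ->]; apply/hsetP; exists v; rewrite ?st. Qed.

Lemma hset_half s v : all (fun v => size v == 8%N) s -> size v = 8%N ->
  hset s (half v) -> v \in s.
Proof. by move=> /allP sz sv /hsetP[w ws /half_inj ->] //; apply/eqP/sz. Qed.

Lemma card_seq (s : seq (oct R)) n : uniq s -> size s = n -> [set` s] #= `I_n.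
Proof.
move=> us <-; have -> : [set` s] = [set` seq_fset tt s].
  by apply/seteqP; split=> x; rewrite /mkset seq_fsetE.
by apply/card_eq_fsetP; rewrite size_seq_fset (undup_id us).
Qed.

Lemma card_hset s : uniq s -> all (fun v => size v == 8%N) s ->
  hset s #= `I_(size s).
Proof.
move=> us /allP sz; apply: card_seq; last by rewrite size_map.
rewrite map_inj_in_uniq // => v w vs ws; apply: half_inj; exact/eqP/sz.
Qed.

Lemma reflection_half v w z : dotz w v = 2 * z -> size v = 8%N ->
  size w = 8%N -> half w - oform (half w) (half v) *: half v =
  half (vadd w (vscale (- z) v)).
Proof.
move=> E sv sw; rewrite oform_half // E /half vecD vecZ scalerDr; congr (_ + _).
by rewrite rmorphM rmorphN /= !scalerA -scaleNr; congr (_ *: _); field.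
Qed.

Definition reflection_closed (s : seq (seq int)) : bool :=
  all (fun v => all (fun w => vadd w (vscale (- (dotz w v %/ 2)%Z) v) \in s) s) s.

Lemma root_system_list s : {subset s <= roots} -> reflection_closed s ->
  root_system (hset s).
Proof.
move=> sr cl; apply: root_system_sub; first by rewrite Phi_E8E; apply: hset_sub.
move=> a b /hsetP[v vs ->] /hsetP[w ws ->].
have [z E _] := roots_pair (sr _ ws) (sr _ vs).
rewrite (reflection_half E) ?roots_size ?sr //; apply/hsetP; eexists => //.
by have := allP (allP cl _ vs) _ ws; rewrite E mulKz.
Qed.

Definition cartanz (edges : seq (nat * nat)) (k l : nat) : int :=
  if k == l then 2
  else if ((k, l) \in edges) || ((l, k) \in edges) then -1 else 0.

Definition combz n (z : seq int) (b : seq (seq int)) : seq int :=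
  foldr (fun k => vadd (vscale z`_k (nth [::] b k))) (nseq 8 0) (iota 0 n).

(** A boolean test for b being a base of the root system s with the diagram
    given by edges.  The matrix M is meant to be d times the inverse of the
    Cartan matrix, so that the coefficient of b_k in v is the sum of the
    M_km <v, b_m>, divided by d. *)
Definition is_basez n edges (M : seq (seq int)) (d : int) (b s : seq (seq int))
    : bool :=
  let dual := [seq combz n m b | m <- M] in
  [&& size b == n, all (mem s) b,
      all (fun k => all (fun l =>
        (dotz (nth [::] b k) (nth [::] b l) == 2 * cartanz edges k l) &&
        (dotz (nth [::] b k) (nth [::] dual l) == 2 * d * (k == l)%:R))
        (iota 0 n)) (iota 0 n),
      all (fun w => size w == 8%N) dual, size dual == n, d != 0 &
      all (fun v => let z := [seq (dotz v w %/ (2 * d))%Z | w <- dual] in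
        (combz n z b == v) && (all (>= 0) z || all (<= 0) z)) s].

Lemma half_comb n (z : seq int) (b : seq (seq int)) : half (combz n z b) =
  \sum_(k < n) (z`_k)%:~R *: half (nth [::] b k).
Proof.
rewrite /half vec_foldr scaler_sumr -(big_mkord xpredT
  (fun k => (z`_k)%:~R *: (2^-1 *: vec R (nth [::] b k)))) /index_iota subn0.
by apply: eq_bigr => k _; rewrite vecZ !scalerA mulrC.
Qed.

Lemma root_system_type_list n edges M d (b s : seq (seq int)) : {subset s <= roots} ->
  root_system (hset s) -> is_basez n edges M d b s ->
  root_system_of_type (simply_laced_cartan n edges) (hset s).
Proof.
move=> sr rs /and5P[/eqP sb /allP bs /allP CM /allP sd
  /and3P[/eqP sdn d0 /allP coef]].
split=> //; exists (fun k => half (nth [::] b k)).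
have bm (k : 'I_n) : nth [::] b k \in s by apply: bs; rewrite mem_nth // sb.
have I (k : 'I_n) : (k : nat) \in iota 0 n by rewrite mem_iota ltn_ord.
have CMkl (k l : 'I_n) := andP (allP (CM _ (I k)) _ (I l)).
have sz (k : 'I_n) : size (nth [::] b k) = 8%N by rewrite roots_size // sr.
split=> [k|||k l].
- by apply/hsetP; exists (nth [::] b k).
- have -> : [seq half (nth [::] b k) | k : 'I_n] =
      [tuple half (nth [::] b k) | k < n] :> seq _ by [].
  apply/freeP => c E l.
  set w := nth [::] [seq combz n m b | m <- M] l.
  have sw : size w = 8%N by apply/eqP/sd; rewrite mem_nth // sdn.
  have /(congr1 (fun x => oform x (half w))) := E; rewrite oform0l oform_suml.
  rewrite (bigD1 l) //= big1 => [|k kl].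
    rewrite nth_mktuple oformZl oform_half // addr0.
    have [_ /eqP ->] := CMkl l l; rewrite eqxx mulr1 rmorphM /= => H.
    have /eqP : c l * d%:~R = 0 by rewrite -H; field.
    by rewrite mulf_eq0 intr_eq0 (negPf d0) orbF => /eqP.
  rewrite nth_mktuple oformZl oform_half //.
  rewrite -val_eqE /= in kl.
  by have [_ /eqP ->] := CMkl k l; rewrite (negPf kl) !(mulr0, mul0r).
- move=> a /hsetP[v vs ->]; have /andP[/eqP E sgn] := coef _ vs.
  set z := [seq (dotz v w %/ (2 * d))%Z | w <- _] in E sgn.
  have sz' : size z = n by rewrite size_map.
  exists (fun k => z`_k); split; first by rewrite -half_comb E.
  by case/orP: sgn => /allP H; [left|right] => k; apply: H; rewrite mem_nth ?sz'.
- rewrite cartan_integerE; last first.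
    by rewrite Phi_E8E; apply/hsetP; exists (nth [::] b l); rewrite ?sr.
  rewrite oform_half //; have [/eqP -> _] := CMkl k l; rewrite mxE /cartanz.
  by rewrite rmorphM /= mulrAC divff ?pnatr_eq0 // mul1r.
Qed.

End RootPairs.

(** * The triangles of idempotents *)

Definition trianglez : seq (seq (seq int)) :=
  [:: [:: [:: 2; 0; 0; 0; 0; 0; 0; 0]; [:: -1; 0; 0; 0; 0; -1; 1; 1];
          [:: -1; 0; 0; 0; 0; 1; -1; -1]];
      [:: [:: 0; -2; 0; 0; 0; 0; 0; 0]; [:: 0; 1; 0; 1; 0; 1; 1; 0];
          [:: 0; 1; 0; -1; 0; -1; -1; 0]];
      [:: [:: 0; 0; -2; 0; 0; 0; 0; 0]; [:: 0; 0; 1; 1; 0; -1; 0; -1];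
          [:: 0; 0; 1; -1; 0; 1; 0; 1]];
      [:: [:: 0; 0; 0; 0; 2; 0; 0; 0]; [:: 0; 0; 0; 1; -1; 0; -1; 1];
          [:: 0; 0; 0; -1; -1; 0; 1; -1]]].

Definition tri (i : nat) : seq (seq int) := nth [::] trianglez i.
Definition antiz (s : seq (seq int)) : seq (seq int) := s ++ [seq vopp v | v <- s].
Definition ext (i : nat) : seq (seq int) := antiz (tri i).
Definition perp (i : nat) : seq (seq int) :=
  [seq v <- roots | all (fun t => dotz v t == 0) (tri i)].
Definition other_tri (i : nat) : seq (seq (seq int)) :=
  [seq tri j | j <- iota 0 4 & j != i].
Definition others (i : nat) : seq (seq int) := flatten (other_tri i).

(* Reduces a statement on the four triangles to an evaluation. *)
Lemma ord4_ind (P : nat -> bool) : all P (iota 0 4) -> forall i : 'I_4, P i.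
Proof. by move/allP => H i; apply: H; rewrite mem_iota ltn_ord. Qed.

Lemma flatten_roots : {subset flatten trianglez <= roots}.
Proof. by apply/allP; rewrite roots.unlock; vm_compute. Qed.

Lemma tri_flatten (i : 'I_4) : {subset tri i <= flatten trianglez}.
Proof.
apply/allP; move: i; apply: (@ord4_ind (fun i => all _ (tri i))).
by vm_compute.
Qed.

Lemma tri_roots (i : 'I_4) : {subset tri i <= roots}.
Proof. by move=> v /tri_flatten/flatten_roots. Qed.

Lemma ext_roots (i : 'I_4) : {subset ext i <= roots}.
Proof.
apply/allP; move: i; apply: (@ord4_ind (fun i => all _ (ext i))).
by rewrite roots.unlock; vm_compute.
Qed.

Lemma perp_roots i : {subset perp i <= roots}.
Proof. by move=> v; rewrite mem_filter => /andP[]. Qed.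

Lemma all_size (s : seq (seq int)) : {subset s <= roots} ->
  all (fun v => size v == 8%N) s.
Proof. by move=> sr; apply/allP => v /sr/roots_size/eqP. Qed.

Section Triangles.
Variable R : realType.
Implicit Types (x y a b : oct R) (v w : seq int) (i j : 'I_4).
Local Notation half := (@half R).
Local Notation hset := (@hset R).

Lemma trianglesE : triangles R = [seq [seq half v | v <- s] | s <- trianglez].
Proof.
by congr [:: [:: _; _; _]; [:: _; _; _]; [:: _; _; _]; [:: _; _; _]];
  apply/rowP => k; rewrite !mxE; case: k => -[|[|[|[|[|[|[|[|k]]]]]]]] //= lt;
  field.
Qed.

Lemma triangleE i : triangle R i = hset (tri i).
Proof.
by rewrite /triangle trianglesE (nth_map [::]).
Qed.

Lemma halfN v : size v = 8%N -> half (vopp v) = - half v.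
Proof. by move=> sv; rewrite /half vecN scalerN. Qed.

Lemma antipodalE s : all (fun v => size v == 8%N) s ->
  antipodal (hset s) = hset (antiz s).
Proof.
move=> /allP sz; apply/seteqP; split=> x.
  case=> /hsetP[v vs E]; apply/hsetP.
    by exists v; rewrite // mem_cat vs.
  exists (vopp v); last by rewrite halfN ?opprK -?E ?opprK //; apply/eqP/sz.
  by rewrite mem_cat map_f ?orbT.
case/hsetP=> w; rewrite mem_cat => /orP[ws ->|/mapP[v vs ->] ->].
  by left; apply/hsetP; exists w.
right; apply/hsetP; exists v => //; rewrite halfN ?opprK //; exact/eqP/sz.
Qed.

Lemma Phi_extE i : Phi_ext R i = hset (ext i).
Proof.
rewrite /Phi_ext triangleE antipodalE //; apply: all_size; exact: tri_roots.
Qed.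

Lemma oform_half0 v w : v \in roots -> w \in roots ->
  (oform (half v) (half w) == 0) = (dotz v w == 0).
Proof.
move=> vr wr; rewrite oform_half ?roots_size // -(intr_eq0 R).
by apply/eqP/eqP => E; lra.
Qed.

Lemma Phi_perpE i : Phi_perp R i = hset (perp i).
Proof.
apply/seteqP; split=> x.
  case; rewrite Phi_E8E => /hsetP[v vr ->] ort; apply/hsetP; exists v => //.
  rewrite mem_filter vr andbT; apply/allP => t ti.
  rewrite -oform_half0 ?(tri_roots ti) //; apply/eqP/ort; rewrite Phi_extE.
  by apply/hsetP; exists t => //; rewrite mem_cat ti.
case/hsetP=> v; rewrite mem_filter => /andP[/allP ort vr] ->; split.
  by rewrite Phi_E8E; apply/hsetP; exists v.
have ortt t : t \in tri i -> oform (half v) (half t) = 0.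
  by move=> ti; apply/eqP; rewrite oform_half0 ?(tri_roots ti) ?ort.
rewrite Phi_extE => _ /hsetP[w wi ->].
move: wi; rewrite mem_cat => /orP[/ortt //|/mapP[t ti ->]].
rewrite halfN ?oformNr ?ortt ?oppr0 //.
exact: roots_size (tri_roots ti).
Qed.

Lemma others_mem i v : v \in others i <-> exists2 j : 'I_4, j != i & v \in tri j.
Proof.
split=> [/flatten_mapP[j]|[j ji vj]].
  rewrite mem_filter mem_iota => /andP[ji lt] vj.
  by exists (Ordinal (lt : (j < 4)%N)).
apply/flatten_mapP; exists (j : nat) => //.
by rewrite mem_filter mem_iota ltn_ord !andbT.
Qed.

Lemma other_trianglesE i : other_triangles R i = hset (others i).
Proof.
apply/seteqP; split=> x.
  by case=> j ji; rewrite triangleE => /hsetP[v vj ->]; apply/hsetP; exists v => //;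
    apply/others_mem; exists j.
case/hsetP=> v /others_mem[j ji vj] ->; exists j => //.
by rewrite triangleE; apply/hsetP; exists v.
Qed.

(** ** Idempotents *)

Lemma idempotent_roots : all (fun v =>
  (okuboz v v == vscale 2 v) == (v \in flatten trianglez)) roots.
Proof. by rewrite roots.unlock; vm_compute. Qed.

Lemma vec_inj (K : numFieldType) v w : size v = 8%N -> size w = 8%N ->
  vec K v = vec K w -> v = w.
Proof.
move=> sv sw E; apply: (@eq_from_nth _ 0) => [|k]; rewrite ?sw // sv.
move=> lt; move/rowP/(_ (Ordinal lt)): E; rewrite !mxE /=.
exact: intr_inj.
Qed.

Lemma okubo_half v : okubo (half v) (half v) = half v <->
  okuboz v v = vscale 2 v.
Proof.
rewrite okuboZ vec_okubo; split=> [E|->]; last first.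
  by rewrite vecZ !scalerA; congr (_ *: _); field.
apply: (@vec_inj R); rewrite ?size_mkseq // vecZ.
apply: (@scalerI _ (oct R) (2^-1 * 2^-1)).
  by rewrite mulf_neq0 // invr_eq0 pnatr_eq0.
by rewrite E !scalerA; congr (_ *: _); field.
Qed.

(** A nonzero idempotent has norm 1 because the norm is multiplicative for the
    Okubo product; the idempotents in the lattice are thus among the 240 roots. *)
Lemma idempotentsE x : [/\ E8_lattice x, x <> 0 & okubo x x = x] <->
  exists i, triangle R i x.
Proof.
split=> [[xL x0 xx]|[j]]; last first.
  rewrite triangleE => /hsetP[v vi ->]; have vr := tri_roots vi.
  have vT : half v \in [seq half v | v <- roots] by rewrite map_f.
  have vP : Phi_E8 R (half v) by rewrite Phi_E8E.
  split; first by case/Phi_E8_form: vP.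
    by apply/eqP; apply: Phi_neq0.
  apply/okubo_half/eqP; have := allP idempotent_roots _ vr.
  by rewrite (tri_flatten vi) => /eqP.
have n1 : onorm x = 1.
  have /eqP := onorm_okubo x x; rewrite xx -subr_eq0 -{1}[onorm x]mulr1 -mulrBr.
  rewrite mulf_eq0 => /orP[/eqP nx|]; last by rewrite subr_eq0 => /eqP.
  by case: x0; apply: oform_eq0; rewrite onormE nx mulr0.
have : Phi_E8 R x by apply/Phi_E8_form; rewrite onormE n1 mulr1.
rewrite Phi_E8E => /hsetP[v vr xv]; move: xx; rewrite xv => /okubo_half vv.
have := allP idempotent_roots _ vr; rewrite vv eqxx => /eqP/esym.
case/flattenP=> T /(nthP nil)[k lt <-] vk.
exists (Ordinal (lt : (k < 4)%N)); rewrite triangleE.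
by apply/hsetP; exists v.
Qed.

Lemma union_triangles :
  [set x : oct R | exists i, triangle R i x] = hset (flatten trianglez).
Proof.
apply/seteqP; split=> x.
  case=> i; rewrite triangleE => /hsetP[v vi ->]; apply/hsetP; exists v => //.
  exact: tri_flatten vi.
case/hsetP=> v /flattenP[T /(nthP nil)[k lt <-] vk] ->.
exists (Ordinal (lt : (k < 4)%N)); rewrite triangleE.
by apply/hsetP; exists v.
Qed.

Definition all_ext : seq (seq int) := flatten [seq antiz T | T <- trianglez].

Lemma union_ext :
  [set x : oct R | exists i, Phi_ext R i x] = hset all_ext.
Proof.
apply/seteqP; split=> x.
  case=> i; rewrite Phi_extE => /hsetP[v vi ->]; apply/hsetP; exists v => //.
  apply/flattenP; exists (antiz (tri i)) => //; apply: map_f; apply: mem_nth.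
  exact: (ltn_ord i).
case/hsetP=> v /flattenP[T /mapP[T' /(nthP nil)[k lt <-] ->] vk] ->.
exists (Ordinal (lt : (k < 4)%N)); rewrite Phi_extE.
by apply/hsetP; exists v.
Qed.

(** ** Types of the root systems *)

Definition E8_base : seq (seq int) :=
  [:: [:: 0; -1; 1; -1; -1; 0; 0; 0]; [:: 0; -1; 0; 0; 1; -1; 0; -1];
      [:: -1; 0; -1; 1; 0; 0; -1; 0]; [:: 1; 1; 1; 0; 0; 1; 0; 0];
      [:: 0; 0; -1; 0; -1; -1; 1; 0]; [:: 0; -1; 0; 0; 1; 1; 0; 1];
      [:: 0; 1; 0; -1; 0; -1; -1; 0]; [:: -1; 0; 1; 1; 0; 0; 1; 0]].

(* The inverse of the Cartan matrix of type E_8. *)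
Definition E8_inverse : seq (seq int) :=
  [:: [:: 4; 5; 7; 10; 8; 6; 4; 2]; [:: 5; 8; 10; 15; 12; 9; 6; 3];
      [:: 7; 10; 14; 20; 16; 12; 8; 4]; [:: 10; 15; 20; 30; 24; 18; 12; 6];
      [:: 8; 12; 16; 24; 20; 15; 10; 5]; [:: 6; 9; 12; 18; 15; 12; 8; 4];
      [:: 4; 6; 8; 12; 10; 8; 6; 3]; [:: 2; 3; 4; 6; 5; 4; 3; 2]].

Lemma hset_reflection s : {subset s <= roots} ->
  (forall a b, hset s a -> hset s b -> hset s (b - oform b a *: a)) ->
  root_system (hset s).
Proof.
by move=> sr H; apply: root_system_sub => //; rewrite Phi_E8E; apply: hset_sub.
Qed.

Lemma type_E8 : root_system_of_type cartan_E8 (Phi_E8 R).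
Proof.
have E : Phi_E8 R = hset roots by exact: Phi_E8E.
rewrite E; apply: (@root_system_type_list R 8 _ E8_inverse 1 E8_base) => //.
  apply: hset_reflection => // a b; rewrite -E; exact: Phi_reflection.
by rewrite roots.unlock; vm_compute.
Qed.

Definition E6_base (i : nat) : seq (seq int) := nth [::]
  [:: [:: [:: 0; 1; 0; -1; 0; -1; -1; 0]; [:: 0; -1; 0; 0; 1; -1; 0; -1];
          [:: 0; -1; 0; 0; 1; 1; 0; 1]; [:: 0; 1; -1; 1; -1; 0; 0; 0];
          [:: 0; -1; 1; -1; -1; 0; 0; 0]; [:: 0; 1; 1; 1; 1; 0; 0; 0]];
      [:: [:: -1; 0; -1; 1; 0; 0; -1; 0]; [:: -1; 0; 1; 0; 1; 0; 0; 1];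
          [:: 1; 0; 1; 0; 1; 0; 0; -1]; [:: 0; 0; -1; 0; -1; -1; 1; 0];
          [:: 0; 0; 1; 0; -1; 1; -1; 0]; [:: 1; 0; -1; 0; 1; 0; 0; 1]];
      [:: [:: -1; 0; 0; 0; 0; -1; 1; 1]; [:: 0; 1; 0; -1; 0; -1; -1; 0];
          [:: 0; 1; 0; 1; 0; 1; -1; 0]; [:: 1; -1; 0; 0; 1; 0; 1; 0];
          [:: -1; -1; 0; 0; -1; 0; -1; 0]; [:: 1; 1; 0; 0; -1; 0; 1; 0]];
      [:: [:: -1; 0; 1; 1; 0; 0; 1; 0]; [:: 0; -1; 1; 0; 0; 0; -1; -1];
          [:: 0; 1; 0; -1; 0; -1; -1; 0]; [:: 0; -1; -1; 0; 0; 0; 1; 1];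
          [:: 1; 1; 1; 0; 0; 1; 0; 0]; [:: 0; 0; -1; 1; 0; -1; 0; -1]]] i.

(* Three times the inverse of the Cartan matrix of type E_6. *)
Definition E6_inverse : seq (seq int) :=
  [:: [:: 4; 3; 5; 6; 4; 2]; [:: 3; 6; 6; 9; 6; 3]; [:: 5; 6; 10; 12; 8; 4];
      [:: 6; 9; 12; 18; 12; 6]; [:: 4; 6; 8; 12; 10; 5]; [:: 2; 3; 4; 6; 5; 4]].

Lemma type_E6 i : root_system_of_type cartan_E6 (Phi_perp R i).
Proof.
have E := Phi_perpE i; rewrite E.
apply: (@root_system_type_list R 6 _ E6_inverse 3 (E6_base i)).
- exact: perp_roots.
- apply: hset_reflection => [|a b]; first exact: perp_roots.
  rewrite -E => -[aP aort] [bP bort]; split; first exact: Phi_reflection.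
  by move=> y yE; rewrite oformBl oformZl aort // bort // mulr0 subrr.
move: i {E}; apply: (@ord4_ind (fun k => is_basez 6
  [:: (0, 2); (2, 3); (3, 4); (4, 5); (1, 3)]%N E6_inverse 3 (E6_base k) (perp k))).
by rewrite /perp roots.unlock; vm_compute.
Qed.

(* Three times the inverse of the Cartan matrix of type A_2^m. *)
Definition A2_inverse (m : nat) : seq (seq int) :=
  mkseq (fun k => mkseq (fun l =>
    if k == l then 2 else if (k %/ 2 == l %/ 2)%N then 1 else 0) (2 * m)) (2 * m).

(* The three members of a triangle add up to 0, so any two form a base. *)
Definition A2_base (s : seq (seq (seq int))) : seq (seq int) :=
  flatten [seq take 2 T | T <- s].

Lemma type_A2 i : root_system_of_type cartan_A2 (Phi_ext R i).
Proof.
rewrite Phi_extE.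
apply: (@root_system_type_list R 2 _ (A2_inverse 1) 3 (A2_base [:: tri i])).
- exact: ext_roots.
- apply: root_system_list; first exact: ext_roots.
  by move: i; apply: (@ord4_ind (fun k => reflection_closed (ext k))); vm_compute.
by move: i; apply: (@ord4_ind (fun k => is_basez 2 [:: (0, 1)]%N (A2_inverse 1) 3
  (A2_base [:: tri k]) (ext k))); vm_compute.
Qed.

Lemma all_ext_roots : {subset all_ext <= roots}.
Proof. by apply/allP; rewrite roots.unlock; vm_compute. Qed.

Lemma type_A2_4 : root_system_of_type cartan_A2_4
  [set x : oct R | exists i, Phi_ext R i x].
Proof.
rewrite union_ext.
apply: (@root_system_type_list R 8 _ (A2_inverse 4) 3 (A2_base trianglez)).
- exact: all_ext_roots.
- by apply: root_system_list; [exact: all_ext_roots | vm_compute].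
by vm_compute.
Qed.

Lemma others_roots i : {subset antiz (others i) <= roots}.
Proof.
apply/allP; move: i; apply: (@ord4_ind (fun k => all _ (antiz (others k)))).
by rewrite roots.unlock; vm_compute.
Qed.

Lemma antipodal_others i :
  antipodal (other_triangles R i) = hset (antiz (others i)).
Proof.
rewrite other_trianglesE antipodalE //; apply: all_size => v vi.
by apply: (@others_roots i); rewrite mem_cat vi.
Qed.

Lemma type_A2_3 i :
  root_system_of_type cartan_A2_3 (antipodal (other_triangles R i)).
Proof.
rewrite antipodal_others.
apply: (@root_system_type_list R 6 _ (A2_inverse 3) 3
  (A2_base (other_tri i))).
- exact: others_roots.
- apply: root_system_list; first exact: others_roots.
  by move: i; apply: (@ord4_ind (fun k => reflection_closed (antiz (others k))));
    vm_compute.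
by move: i; apply: (@ord4_ind (fun k => is_basez 6
  [:: (0, 1); (2, 3); (4, 5)]%N (A2_inverse 3) 3
  (A2_base (other_tri k)) (antiz (others k)))); vm_compute.
Qed.

(** ** Cardinalities *)

Lemma card_hset_roots n s : {subset s <= roots} -> uniq s && (size s == n) ->
  hset s #= `I_n.
Proof.
move=> sr /andP[us /eqP <-]; apply: card_hset => //; exact: all_size.
Qed.

Lemma card_E8 : Phi_E8 R #= `I_240.
Proof.
rewrite Phi_E8E; apply: card_hset_roots => //.
by rewrite uniq_roots size_roots.
Qed.

Lemma card_triangles :
  [set x : oct R | exists i, triangle R i x] #= `I_12.
Proof.
by rewrite union_triangles; apply: card_hset_roots; first exact: flatten_roots.
Qed.

Lemma card_perp i : Phi_perp R i #= `I_72.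
Proof.
rewrite Phi_perpE; apply: card_hset_roots; first exact: perp_roots.
move: i; apply: (@ord4_ind (fun k => uniq (perp k) && (size (perp k) == 72%N))).
by rewrite /perp roots.unlock; vm_compute.
Qed.

Lemma card_ext i : Phi_ext R i #= `I_6.
Proof.
rewrite Phi_extE; apply: card_hset_roots; first exact: ext_roots.
by move: i; apply: (@ord4_ind (fun k => uniq (ext k) && (size (ext k) == 6%N))); vm_compute.
Qed.

Lemma card_others i : other_triangles R i #= `I_9.
Proof.
rewrite other_trianglesE; apply: card_hset_roots.
  by move=> v vi; apply: (@others_roots i); rewrite mem_cat vi.
by move: i; apply: (@ord4_ind (fun k => uniq (others k) && (size (others k) == 9%N)));
  vm_compute.
Qed.

Lemma card_antipodal_others i : antipodal (other_triangles R i) #= `I_18.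
Proof.
rewrite antipodal_others; apply: card_hset_roots; first exact: others_roots.
by move: i; apply: (@ord4_ind (fun k => uniq (antiz (others k)) &&
  (size (antiz (others k)) == 18%N))); vm_compute.
Qed.

Lemma others_perp i : {subset antiz (others i) <= perp i}.
Proof.
have H : forall i, all (fun v => v \in perp i) (antiz (others i)).
  apply: (@ord4_ind (fun k => all (fun v => v \in perp k) (antiz (others k)))).
  by rewrite /perp roots.unlock; vm_compute.
by move=> v; apply: (allP (H i)).
Qed.

End Triangles.

(** * The weights of sl_3 and the fibers over them *)

(* Three times the weight v_k = (t_k - t_(k+1)) / 3, in doubled coordinates. *)
Definition vz (i k : nat) : seq int :=
  vadd (nth [::] (tri i) k) (vopp (nth [::] (tri i) (k.+1 %% 3)%N)).

(* The differences v_k - v_0, by t_0 + t_1 + t_2 = 0. *)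
Definition dz (i : nat) : seq (seq int) :=
  [:: nseq 8 0; nth [::] (tri i) 1; vopp (nth [::] (tri i) 0)].

(* The roots with the same inner products as s v_k with the triangle. *)
Definition fiberz (i k : nat) (s : int) : seq (seq int) :=
  [seq y <- roots | all (fun t => 3 * dotz y t == s * dotz (vz i k) t) (tri i)].

Definition fibersz (i : nat) (s : int) : seq (seq int) :=
  flatten [seq fiberz i k s | k <- iota 0 3].

(* Functions, so that the lists are evaluated once in the checks below. *)
Definition disjointz (s t : seq (seq int)) := ~~ has (fun v => v \in t) s.
Definition subsetz (s t : seq (seq int)) := all (fun v => v \in t) s.

Lemma fiberz_roots i k s : {subset fiberz i k s <= roots}.
Proof. by move=> v; rewrite mem_filter => /andP[]. Qed.

Definition pairs3 : seq (nat * nat) := [seq (k, l) | k <- iota 0 3, l <- iota 0 3].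

Definition diffz (i : nat) : seq (seq int) :=
  [seq vadd (nth [::] (dz i) p.1) (vopp (nth [::] (dz i) p.2))
  | p <- pairs3 & p.1 != p.2].

Lemma diffz_ext i : perm_eq (diffz i) (ext i) || (4 <= i)%N.
Proof. by case: i => [|[|[|[|i]]]]; rewrite ?orbT //; vm_compute. Qed.

Lemma pairs3P (k l : 'I_3) : (k : nat, l : nat) \in pairs3.
Proof.
by apply/allpairsP; exists (k : nat, l : nat); rewrite !mem_iota !ltn_ord.
Qed.

Lemma pairs3_ord (k l : nat) : (k, l) \in pairs3 ->
  exists k' l' : 'I_3, k = k' /\ l = l'.
Proof.
case/allpairsP=> -[a b] [] /[!mem_iota] ka lb [-> ->].
by exists (Ordinal (ka : (a < 3)%N)), (Ordinal (lb : (b < 3)%N)).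
Qed.

Section TightFrame.
Variable K : fieldType.
Hypothesis two_neq0 : (2 : K) != 0.

Lemma sum_foldr (T : Type) (s : seq T) (F : T -> int) :
  \sum_(t <- s) ((F t)%:~R : K) = (foldr (fun t a => F t + a) 0 s)%:~R.
Proof.
elim: s => [|t s IH]; first by rewrite big_nil.
by rewrite big_cons IH rmorphD.
Qed.

(** The twelve idempotents form a tight frame: three times a vector is the sum
    of its twelve projections. *)
Lemma tight_frame (x : oct K) :
  \sum_(t <- flatten trianglez)
    oform x (2^-1 *: vec K t) *: (2^-1 *: vec K t) = 3 *: x.
Proof.
apply/rowP => j; rewrite summxE.
rewrite (eq_bigr (fun t => \sum_(k < 8) x 0 k * (2^-1 * (t`_k * t`_j)%:~R))).
  rewrite exchange_big /= (bigD1 j) //=.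
  have sumE (k : 'I_8) : \sum_(t <- flatten trianglez)
      x 0 k * (2^-1 * (t`_k * t`_j)%:~R) = 3 * (k == j)%:R * x 0 k.
    rewrite -mulr_sumr -mulr_sumr sum_foldr.
    have H : all (fun k => all (fun j => foldr (fun t a => t`_k * t`_j + a) 0
        (flatten trianglez) == 6 * (k == j)%:R) (iota 0 8)) (iota 0 8).
      by vm_compute.
    have I (l : 'I_8) : (l : nat) \in iota 0 8 by rewrite mem_iota ltn_ord.
    rewrite (eqP (allP (allP H _ (I k)) _ (I j))) val_eqE rmorphM /= rmorph_nat.
    have -> : 6 = 2 * 3 :> K by rewrite -natrM.
    by field.
  rewrite sumE eqxx mulr1 big1 ?addr0 => [|k kj]; first by rewrite mxE.
  by rewrite sumE (negPf kj) mulr0 mul0r.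
move=> t _; rewrite mxE oformE [X in _ * X]mxE mulr_sumr mulr_suml.
by apply: eq_bigr => k _; rewrite !mxE rmorphM /=; field.
Qed.

End TightFrame.

Section Fibers.
Variable R : realType.
Implicit Types (x y a b : oct R) (i : 'I_4).
Local Notation half := (@half R).
Local Notation hset := (@hset R).

Definition wt i (k : 'I_3) : oct R := 3^-1 *: half (vz i k).
Definition dwt i (k : 'I_3) : oct R := half (nth [::] (dz i) k).

Lemma half_sub v w : half (vadd v (vopp w)) = half v - half w.
Proof. by rewrite /half vecD vecN scalerDr scalerN. Qed.

Lemma half_add v w : half (vadd v w) = half v + half w.
Proof. by rewrite /half vecD scalerDr. Qed.

Lemma half_scale (c : int) v : half (vscale c v) = c%:~R *: half v.
Proof. by rewrite /half vecZ !scalerA mulrC. Qed.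

Lemma half_zero : half (nseq 8 0) = 0.
Proof. by rewrite /half vec0 scaler0. Qed.

Lemma dwt0 i : dwt i 0 = 0.
Proof. exact: half_zero. Qed.

Lemma wt_sub i k l : wt i k - wt i l = dwt i k - dwt i l.
Proof.
have H : forall j : 'I_4, all (fun p => vadd (vz j p.1) (vopp (vz j p.2)) ==
    vscale 3 (vadd (nth [::] (dz j) p.1) (vopp (nth [::] (dz j) p.2)))) pairs3.
  apply: (@ord4_ind (fun n => all (fun p => vadd (vz n p.1) (vopp (vz n p.2)) ==
    vscale 3 (vadd (nth [::] (dz n) p.1) (vopp (nth [::] (dz n) p.2)))) pairs3)).
  by vm_compute.
rewrite /wt -scalerBr -half_sub (eqP (allP (H i) _ (pairs3P k l))) half_scale.
by rewrite half_sub scalerA mulVf ?scale1r // pnatr_eq0.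
Qed.

Lemma wt_sum i : \sum_k wt i k = 0.
Proof.
have H : forall j : 'I_4, vadd (vz j 0) (vadd (vz j 1) (vz j 2)) == nseq 8 0.
  apply: (@ord4_ind (fun n => vadd (vz n 0) (vadd (vz n 1) (vz n 2)) == nseq 8 0)).
  by vm_compute.
rewrite /wt -scaler_sumr 3!big_ord_recl big_ord0 addr0 -!half_add.
by rewrite [vadd _ _](eqP (H i)) half_zero scaler0.
Qed.

Lemma ext_diff i a : a \in [seq half v | v <- ext i] <->
  exists k l, k != l /\ a = dwt i k - dwt i l.
Proof.
have /orP[pE|] := diffz_ext i; last by rewrite leqNgt ltn_ord.
split=> [/mapP[v]|[k [l [kl ->]]]].
  rewrite -(perm_mem pE) => /mapP[[k l]]; rewrite mem_filter /= => /andP[kl].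
  case/pairs3_ord=> k' [l' [E1 E2]] -> ->; subst k l.
  by exists k', l'; rewrite half_sub.
rewrite -half_sub; apply: map_f; rewrite -(perm_mem pE).
by apply/mapP; exists (k : nat, l : nat); rewrite // mem_filter /= pairs3P andbT.
Qed.

Lemma ext_frame i : sl3_frame (Phi_ext R i) (wt i).
Proof.
split; first exact: wt_sum.
rewrite Phi_extE; apply/seteqP; split=> a /=.
  case/ext_diff=> k [l [kl ->]]; exists k, l; split=> //.
  by rewrite wt_sub.
by case=> k [l [kl ->]]; apply/ext_diff; exists k, l; rewrite wt_sub.
Qed.

(** ** Projections *)

Lemma lspan_seq (s : seq (oct R)) x : lspan [set` s] x <-> x \in <<s>>%VS.
Proof.
split=> [[t ts xt]|xs]; last by exists s.
by apply: (subvP _ _ xt); apply/span_subvP => y /ts ys; apply: memv_span.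
Qed.

Lemma lspan_hset s x : lspan (hset s) x <-> x \in <<[seq half v | v <- s]>>%VS.
Proof. exact: lspan_seq. Qed.

Lemma oform_span (s : seq (oct R)) x y : (forall a, a \in s -> oform x a = 0) ->
  y \in <<s>>%VS -> oform x y = 0.
Proof.
move=> H; rewrite -{1}[s]in_tupleE => /coord_span ->.
rewrite oform_sumr big1 // => k _; rewrite oformZr H ?mulr0 //.
exact: mem_nth.
Qed.

Lemma wt_span i k : wt i k \in <<[seq half v | v <- ext i]>>%VS.
Proof.
rewrite /wt memvZ // /vz half_sub memvB //; apply/memv_span/map_f;
  rewrite mem_cat; apply/orP; left; apply: mem_nth.
  by case: i k => -[|[|[|[|]]]] // ? [[|[|[|]]]].
by case: i k => -[|[|[|[|]]]] // ? [[|[|[|]]]].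
Qed.

Lemma size_vz i k : size (vz i k) = 8%N.
Proof. by rewrite size_mkseq. Qed.

Lemma fiberE i (k : 'I_3) (s : int) :
  projection_fiber (Phi_ext R i) (s%:~R *: wt i k) = hset (fiberz i k s).
Proof.
have tS t : t \in tri i -> half t \in [seq half v | v <- ext i].
  by move=> ti; rewrite map_f // mem_cat ti.
have key v t : v \in roots -> t \in tri i ->
    (oform (half v - s%:~R *: wt i k) (half t) == 0) =
    (3 * dotz v t == s * dotz (vz i k) t).
  move=> vr ti; have tr := tri_roots ti.
  rewrite oformBl (oformZl s%:~R) (oformZl 3^-1).
  rewrite !oform_half ?size_vz ?roots_size //.
  rewrite -(eqr_int R) !rmorphM /=.
  by apply/eqP/eqP => E; lra.
apply/seteqP; split=> x.
  rewrite Phi_extE => -[]; rewrite Phi_E8E => /hsetP[v vr ->] _ ort.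
  apply/hsetP; exists v => //; rewrite mem_filter vr andbT; apply/allP => t ti.
  rewrite -key //; apply/eqP/ort; apply/lspan_hset; apply: memv_span; exact: tS.
case/hsetP=> v; rewrite mem_filter => /andP[/allP cl vr] ->; split.
- by rewrite Phi_E8E; apply/hsetP; exists v.
- by rewrite Phi_extE; apply/lspan_hset; rewrite memvZ // wt_span.
rewrite Phi_extE => y /lspan_hset; apply: oform_span => _ /mapP[t text ->].
have ortt t' : t' \in tri i -> oform (half v - s%:~R *: wt i k) (half t') = 0.
  by move=> ti; apply/eqP; rewrite key // cl.
move: text; rewrite mem_cat => /orP[/ortt //|/mapP[t' ti ->]].
rewrite halfN ?oformNr ?ortt ?oppr0 //; exact: roots_size (tri_roots ti).
Qed.

Lemma fiber_pos i k : projection_fiber (Phi_ext R i) (wt i k) =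
  hset (fiberz i k 1).
Proof. by rewrite -fiberE scale1r. Qed.

Lemma fiber_neg i k : projection_fiber (Phi_ext R i) (- wt i k) =
  hset (fiberz i k (-1)).
Proof. by rewrite -fiberE rmorphN scaleN1r. Qed.

Lemma weight_cases i w : (weights_3 (wt i) `|` weights_3bar (wt i)) w ->
  exists k : 'I_3, exists2 s : int, s \in [:: 1; -1] &
    projection_fiber (Phi_ext R i) w = hset (fiberz i k s).
Proof.
case=> [[k _ <-]|[k _ <-]]; exists k.
  by exists 1; rewrite ?fiber_pos.
by exists (-1); rewrite ?fiber_neg.
Qed.

Lemma hset_disjoint s t : {subset s <= roots} -> {subset t <= roots} ->
  disjointz s t -> hset s `&` hset t = set0.
Proof.
move=> sr tr /hasPn H; rewrite -subset0 => x [/hsetP[v vs ->] vt].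
have := hset_half (all_size tr) (roots_size (sr _ vs)) vt.
by apply/negP; apply: H.
Qed.

Lemma fiber_check i (k : 'I_3) (s : int) : s \in [:: 1; -1] ->
  [/\ uniq (fiberz i k s) && (size (fiberz i k s) == 27%N),
      disjointz (fiberz i k s) (ext i) &
      disjointz (fiberz i k s) (perp i)].
Proof.
pose P n := all (fun s => all (fun k =>
  [&& uniq (fiberz n k s) && (size (fiberz n k s) == 27%N),
      disjointz (fiberz n k s) (ext n) &
      disjointz (fiberz n k s) (perp n)]) (iota 0 3)) [:: 1; -1].
have H : forall j : 'I_4, P j.
  apply: ord4_ind; rewrite /P /fiberz /perp roots.unlock; vm_compute.
  by [].
move=> sS; have kI : (k : nat) \in iota 0 3 by rewrite mem_iota ltn_ord.
by have /and3P[] := allP (allP (H i) _ sS) _ kI.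
Qed.

Lemma fiber_card i w : (weights_3 (wt i) `|` weights_3bar (wt i)) w ->
  [/\ projection_fiber (Phi_ext R i) w #= `I_27,
      projection_fiber (Phi_ext R i) w `&` Phi_ext R i = set0 &
      projection_fiber (Phi_ext R i) w `&` Phi_perp R i = set0].
Proof.
case/weight_cases=> k [s sS ->]; have [H1 H2 H3] := fiber_check i k sS.
split; first by apply: card_hset_roots => //; apply: fiberz_roots.
  rewrite Phi_extE; apply: hset_disjoint => //.
    exact: fiberz_roots.
  exact: ext_roots.
rewrite Phi_perpE; apply: hset_disjoint => //.
  exact: fiberz_roots.
exact: perp_roots.
Qed.

Definition weightz (i : nat) : seq (seq int) :=
  [seq vz i k | k <- iota 0 3] ++ [seq vopp (vz i k) | k <- iota 0 3].

Lemma weights_card i : weights_3 (wt i) `|` weights_3bar (wt i) #= `I_6.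
Proof.
have -> : weights_3 (wt i) `|` weights_3bar (wt i) =
    [set` [seq 3^-1 *: half v | v <- weightz i]].
  apply/seteqP; split=> x.
    have kI (k : 'I_3) : (k : nat) \in iota 0 3 by rewrite mem_iota ltn_ord.
    case=> -[k _ <-].
      apply/mapP; exists (vz i k) => //.
      by rewrite mem_cat (map_f (vz i) (kI k)).
    apply/mapP; exists (vopp (vz i k)).
      by rewrite mem_cat orbC (map_f (fun n : nat => vopp (vz i n)) (kI k)).
    by rewrite halfN ?size_vz // scalerN.
  move=> /mapP[v]; rewrite mem_cat => /orP[]/mapP[k]; rewrite mem_iota => lt -> ->.
    by left; exists (Ordinal (lt : (k < 3)%N)).
  right; exists (Ordinal (lt : (k < 3)%N)) => //.
  by rewrite /wt halfN ?size_mkseq // scalerN.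
have sz : all (fun v => size v == 8%N) (weightz i).
  by apply/allP => v; rewrite mem_cat => /orP[]/mapP[k _ ->]; rewrite size_mkseq.
have uw : uniq (weightz i).
  by apply: (@ord4_ind (fun n => uniq (weightz n))); vm_compute.
have -> : [seq 3^-1 *: half v | v <- weightz i] =
    [seq 3^-1 *: a | a <- [seq half v | v <- weightz i]] by rewrite -map_comp.
have u : uniq [seq 3^-1 *: a | a <- [seq half v | v <- weightz i]].
  rewrite map_inj_uniq; last by apply: scalerI; rewrite invr_eq0 pnatr_eq0.
  rewrite map_inj_in_uniq // => v w /(allP sz)/eqP sv /(allP sz)/eqP sw.
  exact: half_inj.
have : size [seq 3^-1 *: a | a <- [seq half v | v <- weightz i]] = 6%N.
  by rewrite !size_map.
exact: card_seq.
Qed.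

Lemma partition_check i :
  subsetz roots (ext i ++ perp i ++ fibersz i 1 ++ fibersz i (-1)).
Proof.
move: i; apply: (@ord4_ind (fun n => subsetz roots
  (ext n ++ perp n ++ fibersz n 1 ++ fibersz n (-1)))).
by rewrite /perp /fibersz /fiberz roots.unlock; vm_compute.
Qed.

Lemma Phi_partition i : Phi_ext R i `&` Phi_perp R i = set0 /\
  Phi_E8 R = Phi_ext R i `|` Phi_perp R i `|`
    \bigcup_(w in weights_3 (wt i) `|` weights_3bar (wt i))
      projection_fiber (Phi_ext R i) w.
Proof.
split.
  rewrite -subset0 => x [xe [xP ort]].
  by have := ort _ xe; rewrite Phi_norm // => /eqP; rewrite pnatr_eq0.
apply/seteqP; split=> x.
  rewrite {1}Phi_E8E => /hsetP[v vr ->].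
  have : [|| v \in ext i, v \in perp i, v \in fibersz i 1 | v \in fibersz i (-1)].
    by rewrite -!mem_cat; exact: allP (partition_check i) _ vr.
  have fib (s : int) : v \in fibersz i s -> exists k : 'I_3, v \in fiberz i k s.
    case/flatten_mapP=> k; rewrite mem_iota => lt vk.
    by exists (Ordinal (lt : (k < 3)%N)).
  case/or4P=> [vE|vP|/fib[k vk]|/fib[k vk]].
  - by left; left; rewrite Phi_extE; apply/hsetP; exists v.
  - by left; right; rewrite Phi_perpE; apply/hsetP; exists v.
  - right; exists (wt i k); first by left; exists k.
    by rewrite fiber_pos; apply/hsetP; exists v.
  - right; exists (- wt i k); first by right; exists k.
    by rewrite fiber_neg; apply/hsetP; exists v.
case=> [[xe|[xP _]] //|[w _ [xP _ _]] //].
by move: xe; rewrite Phi_extE Phi_E8E; apply: hset_sub; apply: ext_roots.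
Qed.

(** The projections on the planes of the triangles add up to the identity, so
    that a root orthogonal to one plane lies in the span of the others. *)
Lemma span_others i :
  lspan (antipodal (other_triangles R i)) = lspan (Phi_perp R i).
Proof.
apply/seteqP; split=> x.
  rewrite antipodal_others Phi_perpE => /lspan_hset xs; apply/lspan_hset.
  apply: (subvP _ _ xs); apply: sub_span => _ /mapP[v vo ->].
  by rewrite map_f // others_perp.
rewrite antipodal_others Phi_perpE => /lspan_hset xs; apply/lspan_hset.
apply: (subvP _ _ xs); apply/span_subvP => _ /mapP[v vp ->].
have two : (2 : R) != 0 by rewrite pnatr_eq0.
have -> : half v = 3^-1 *: (3 *: half v).
  by rewrite scalerA mulVf ?scale1r // pnatr_eq0.
rewrite -(tight_frame two) memvZ // big_seq memv_suml // => t /flattenP[T].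
case/(nthP nil)=> j lt <- tj; have [ji|ji] := eqVneq j i.
  move: vp; rewrite ji in tj; rewrite mem_filter => /andP[/allP/(_ _ tj) E vr].
  move: E; rewrite -(@oform_half0 R) //; last exact: tri_roots tj.
  by move/eqP => E; rewrite -/(half t) [oform _ _]E scale0r mem0v.
rewrite memvZ // -/(half t) memv_span // map_f // mem_cat; apply/orP; left.
by apply/others_mem; exists (Ordinal (lt : (j < 4)%N)).
Qed.

End Fibers.

(** * Weights as vectors *)

Section Weights.
Variable R : realType.
Implicit Types (a b x y : oct R) (i : 'I_4) (k l m : 'I_3).
Local Notation half := (@half R).

Definition ext_list i : seq (oct R) := [seq half v | v <- ext i].
Definition perp_list i : seq (oct R) := [seq half v | v <- perp i].
Definition fiber_list i : seq (oct R) := [seq half v | v <- fiberz i 0 1].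

Lemma dwtE i k : dwt R i k = wt R i k - wt R i 0.
Proof. by rewrite wt_sub dwt0 subr0. Qed.

Lemma wt_gram i k l : oform (wt R i k) (wt R i l) = (k == l)%:R - 3^-1.
Proof.
have H : forall j : 'I_4, all (fun p => dotz (vz j p.1) (vz j p.2) ==
    18 * (p.1 == p.2)%:R - 6) pairs3.
  by apply: (@ord4_ind (fun n => all (fun p => dotz (vz n p.1) (vz n p.2) ==
    18 * (p.1 == p.2)%:R - 6) pairs3)); vm_compute.
rewrite /wt (oformZl 3^-1) (oformZr 3^-1) oform_half ?size_vz //.
rewrite (eqP (allP (H i) _ (pairs3P k l))) /= val_eqE rmorphB rmorphM /= !rmorph_nat.
by field.
Qed.

Lemma dwt_gram i k l : oform (dwt R i k) (dwt R i l) =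
  (k == l)%:R - (k == 0)%:R - (l == 0)%:R + 1.
Proof.
rewrite !dwtE oformBl !oformBr !wt_gram eqxx (eq_sym 0 l) /=; ring.
Qed.

Lemma ext_listP i a : a \in ext_list i <->
  exists k l, k != l /\ a = dwt R i k - dwt R i l.
Proof. exact: ext_diff. Qed.

Lemma ext_listE i a : a \in ext_list i <-> Phi_ext R i a.
Proof. by rewrite Phi_extE. Qed.

Lemma perp_listE i a : a \in perp_list i <-> Phi_perp R i a.
Proof. by rewrite Phi_perpE. Qed.

Lemma dwt_ext i k l : k != l -> dwt R i k - dwt R i l \in ext_list i.
Proof. by move=> kl; apply/ext_listP; exists k, l. Qed.

Lemma ext_root i a : a \in ext_list i -> Phi_E8 R a.
Proof. by rewrite Phi_E8E => /(hset_sub (@ext_roots i)). Qed.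

Lemma dwt_root i k l : k != l -> Phi_E8 R (dwt R i k - dwt R i l).
Proof. by move/(dwt_ext i)/ext_root. Qed.

Lemma perp_listP i a : a \in perp_list i <->
  Phi_E8 R a /\ forall k, oform a (dwt R i k) = 0.
Proof.
rewrite perp_listE; split=> -[aP ort]; split=> //; last first.
  move=> y /ext_listE/ext_listP[k [l [_ ->]]].
  by rewrite oformBr !ort subr0.
move=> k; have [->|k0] := eqVneq k 0; first by rewrite dwt0 oform0r.
apply: ort; apply/ext_listE.
by rewrite -[dwt R i k]subr0 -(dwt0 R i) dwt_ext.
Qed.

(** The projection of a root to the plane of the triangle is determined by the
    inner products with the differences v_l - v_0, which span the plane. *)
Definition in_fiber i k a : Prop :=
  Phi_E8 R a /\ forall l, oform a (dwt R i l) = (k == l)%:R - (k == 0)%:R.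

Lemma dwt_lspan i k : lspan (Phi_ext R i) (dwt R i k).
Proof.
rewrite dwtE Phi_extE; apply/lspan_hset; rewrite memvB //; exact: wt_span.
Qed.

Lemma in_fiberP i k a :
  projection_fiber (Phi_ext R i) (wt R i k) a <-> in_fiber i k a.
Proof.
have wd l : oform (wt R i k) (dwt R i l) = (k == l)%:R - (k == 0)%:R.
  by rewrite dwtE oformBr !wt_gram; ring.
split=> [[aP _ ort]|[aP ad]].
  split=> // l; rewrite -wd; apply/eqP; rewrite -subr_eq0 -oformBl.
  by apply/eqP/ort/dwt_lspan.
split=> //; first by rewrite Phi_extE; apply/lspan_hset; apply: wt_span.
rewrite Phi_extE => y /lspan_hset; apply: oform_span => _ /ext_listP[l [m [_ ->]]].
by rewrite oformBr !oformBl !ad !wd !subrr.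
Qed.

Lemma in_fiber_neg i k a :
  projection_fiber (Phi_ext R i) (- wt R i k) a <-> in_fiber i k (- a).
Proof.
rewrite -in_fiberP; split=> -[aP wS ort].
  split; [exact: Phi_opp | | move=> y yS].
    by rewrite Phi_extE; apply/lspan_hset; apply: wt_span.
  by rewrite -opprD oformNl -[wt R i k]opprK ort ?oppr0.
split.
- by rewrite -[a]opprK; apply: Phi_opp.
- rewrite Phi_extE in wS *; apply/lspan_hset; rewrite memvN.
  exact/lspan_hset.
- by move=> y yS; rewrite -[a]opprK -opprD oformNl ort ?oppr0.
Qed.

Lemma fiber_listP i a : a \in fiber_list i <-> in_fiber i 0 a.
Proof. by rewrite -in_fiberP fiber_pos. Qed.

Lemma in_fiber_root i k a : in_fiber i k a -> Phi_E8 R a.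
Proof. by case. Qed.

Lemma in_fiber_diff i k a l m : in_fiber i k a ->
  oform a (dwt R i l - dwt R i m) = (k == l)%:R - (k == m)%:R.
Proof. by case=> _ ad; rewrite oformBr !ad; ring. Qed.

Lemma in_fiber_uniq i k l a : in_fiber i k a -> in_fiber i l a -> k = l.
Proof.
move=> fk fl; apply/eqP; apply/negPn/negP => kl.
have := in_fiber_diff k l fk; rewrite (in_fiber_diff k l fl) !eqxx.
by rewrite (negPf kl) eq_sym (negPf kl) => /= E; lra.
Qed.

(** The inner product of v_k with v_l - v_k is -1, so that adding this root to a
    root over v_k gives a root. *)
Lemma in_fiber_shift i k l a : in_fiber i k a ->
  in_fiber i l (a + (dwt R i l - dwt R i k)).
Proof.
move=> fk; have [->|kl] := eqVneq l k; first by rewrite subrr addr0.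
have [aP ad] := fk; split=> [|m].
  apply/Phi_add => //; first exact: dwt_root.
  by rewrite (in_fiber_diff l k fk) eqxx eq_sym (negPf kl) sub0r.
by rewrite oformDl oformBl ad !dwt_gram; ring.
Qed.

Lemma in_fiber_perp i k a e : in_fiber i k a -> e \in perp_list i ->
  Phi_E8 R (a + e) -> in_fiber i k (a + e).
Proof.
case=> _ ad /perp_listP[_ ed] aeP; split=> // l.
by rewrite oformDl ad ed addr0.
Qed.

Lemma in_fiber_step i k a l m : in_fiber i k a -> l != m ->
  Phi_E8 R (a + (dwt R i l - dwt R i m)) -> m = k.
Proof.
move=> fk lm aP; have aE := in_fiber_root fk.
have := (Phi_add aE (dwt_root i lm)).2 aP.
rewrite (in_fiber_diff l m fk); case: (eqVneq k m) => [-> //|_].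
by rewrite subr0 => E; exfalso; case: (k == l) E => /= E; lra.
Qed.

Lemma in_fiber_not_ext i k a l m : in_fiber i k a -> a != dwt R i l - dwt R i m.
Proof.
move=> fk; apply/eqP => E; have := Phi_norm (in_fiber_root fk).
rewrite {2}E (in_fiber_diff l m fk) {E}.
by case: (k == l); case: (k == m) => /= F; lra.
Qed.

Lemma in_fiber_not_perp i k a : in_fiber i k a -> a \notin perp_list i.
Proof.
move=> fk; apply/negP => /perp_listP[_ ad].
have [l lk] : exists l, l != k.
  by case: (eqVneq k 0) => [->|k0]; [exists 1 | exists 0; rewrite eq_sym].
have := in_fiber_diff k l fk; rewrite oformBr !ad eqxx (eq_sym k l) (negPf lk).
by move=> /= E; lra.
Qed.

Lemma in_fiber_sub i k a b : in_fiber i k a -> in_fiber i k b ->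
  1 <= oform a b -> a - b \in 0 :: perp_list i.
Proof.
move=> fa fb ab; have [aP bP] := (in_fiber_root fa, in_fiber_root fb).
have [E|E|[E|E|E]] := Phi_pair bP aP.
- by rewrite E subrr mem_head.
- by move: ab; rewrite E oformNl Phi_norm // {E} => ?; lra.
- by move: ab; rewrite oformC E => ?; lra.
- by move: ab; rewrite oformC E => ?; lra.
rewrite inE; apply/orP; right; apply/perp_listP; split=> [|l].
  apply/Phi_add => //; first exact: Phi_opp.
  by rewrite oformNr oformC E.
by case: fa fb => _ ad [_ bd]; rewrite oformBl ad bd subrr.
Qed.

(** Two of the 27 roots of a fiber that are orthogonal have a common
    neighbour among them, as two disjoint lines among the 27 have a common
    transversal. *)
Lemma fiber_link i a b : a \in fiber_list i -> b = nth 0 (fiber_list i) 0 ->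
  exists e, [/\ e \in fiber_list i, e - a \in 0 :: perp_list i &
                b - e \in 0 :: perp_list i].
Proof.
pose P (s : seq (seq int)) := all (fun v => has (fun w =>
  (2 <= dotz w v) && (2 <= dotz (head [::] s) w)) s) s.
have H : forall j : 'I_4, P (fiberz j 0 1) && (0 < size (fiberz j 0 1))%N.
  apply: (@ord4_ind (fun n => P (fiberz n 0 1) && (0 < size (fiberz n 0 1))%N)).
  by rewrite /fiberz roots.unlock; vm_compute.
have /andP[Hi s0] := H i => /[dup] af /mapP[v vf ->].
rewrite (nth_map [::]) // nth0 => ->.
have hf : head [::] (fiberz i 0 1) \in fiberz i 0 1.
  by case: (fiberz i 0 1) s0 => // w s _; apply: mem_head.
have [w wf /andP[wv hw]] := hasP (allP Hi _ vf).
have inf u : u \in fiberz i 0 1 -> in_fiber i 0 (half u).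
  by move=> uf; apply/fiber_listP/map_f.
have ge u u' : u \in fiberz i 0 1 -> u' \in fiberz i 0 1 -> 2 <= dotz u u' ->
    1 <= oform (half u) (half u').
  move=> /fiberz_roots ur /fiberz_roots ur' le.
  rewrite oform_half ?roots_size //.
  have : 2 <= (dotz u u')%:~R :> R by rewrite (ler_int R 2).
  by move=> ?; lra.
exists (half w); split; first exact: map_f.
  by apply: in_fiber_sub (inf _ wf) (inf _ vf) (ge _ _ _ _ _).
by apply: in_fiber_sub (inf _ hf) (inf _ wf) (ge _ _ _ _ _).
Qed.

(** Irreducibility of the system of type E_6: every root and a fixed one have a
    third root to which neither is orthogonal. *)
Lemma perp_connected i : exists2 b, b \in perp_list i &
  forall a, a \in perp_list i ->
    exists e, [/\ e \in perp_list i, oform e a != 0 & oform e b != 0].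
Proof.
pose P (s : seq (seq int)) := all (fun v => has (fun w =>
  (dotz w v != 0) && (dotz w (head [::] s) != 0)) s) s.
have H : forall j : 'I_4, P (perp j) && (0 < size (perp j))%N.
  apply: (@ord4_ind (fun n => P (perp n) && (0 < size (perp n))%N)).
  by rewrite /perp roots.unlock; vm_compute.
have /andP[Hi s0] := H i.
have hf : head [::] (perp i) \in perp i.
  by case: (perp i) s0 => // w s _; apply: mem_head.
exists (half (head [::] (perp i))); first exact: map_f.
move=> _ /mapP[v vf ->]; have [w wf /andP[wv hw]] := hasP (allP Hi _ vf).
have pr := @perp_roots i.
by exists (half w); rewrite map_f // !oform_half0 ?pr.
Qed.

Lemma perp_orth_ext i a b : a \in perp_list i -> b \in ext_list i -> oform a b = 0.
Proof.
by case/perp_listP=> _ ad /ext_listP[k [l [_ ->]]]; rewrite oformBr !ad subr0.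
Qed.

Lemma ext_other i j a : j != i -> a \in ext_list j -> a \in perp_list i.
Proof.
move=> ji /mapP[v ve ->]; apply: map_f; apply: others_perp.
have tm w : w \in tri j -> w \in others i by move=> wt; apply/others_mem; exists j.
move: ve; rewrite !mem_cat => /orP[/tm -> //|/mapP[w /tm wt ->]].
by rewrite map_f ?orbT.
Qed.

Lemma ext_orth i j a b : i != j -> a \in ext_list i -> b \in ext_list j ->
  oform a b = 0.
Proof. by move=> ij ae; apply: perp_orth_ext; apply: ext_other ae. Qed.

Lemma dwt_orth i j k l : i != j -> oform (dwt R i k) (dwt R j l) = 0.
Proof.
move=> ij; have [->|k0] := eqVneq k 0; first by rewrite dwt0 oform0l.
have : dwt R i k - dwt R i 0 \in ext_list i by apply: dwt_ext.
rewrite dwt0 subr0 => ke; have /perp_listP[_] := ext_other ij ke.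
exact.
Qed.

(** ** Glue vectors *)

(** The lattice arises from the root lattice of type A_2^4 by gluing along the
    tetracode.  Its words that vanish at i and nowhere else give the signs with
    which the weights of the three other triangles add up to a root. *)
Definition glue_sign (i j : nat) : int :=
  nth 1 (nth [::] [:: [:: 1; 1; 1]; [:: 1; -1; 1]; [:: 1; 1; -1];
    [:: 1; -1; 1]] i) j.

(* The sum of the signed weights v_0, in doubled coordinates. *)
Definition gluez (i : nat) : seq int := nth [::]
  [:: [:: 0; -1; -1; -1; 1; 0; 0; 0]; [:: 1; 0; 1; 0; 1; 0; 0; -1];
      [:: 1; -1; 0; 0; -1; 0; -1; 0]; [:: 1; 1; -1; 0; 0; 1; 0; 0]] i.

Definition glue i : oct R := half (gluez i).

(* The differences v_k - v_0 or their opposites: with the sign -1, the copy of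
   sl_3 is identified through the dual of its standard representation. *)
Definition gdwt i (j k : 'I_3) : oct R :=
  (glue_sign i j)%:~R *: dwt R (lift i j) k.

Lemma glue_sign_sq i (j : 'I_3) : (glue_sign i j)%:~R ^+ 2 = 1 :> R.
Proof.
rewrite -rmorphXn -(rmorph1 (intmul (1 : R))); congr (_%:~R); apply/eqP.
have H : forall n : 'I_4, all (fun l : nat => glue_sign n l ^+ 2 == 1) (iota 0 3).
  by apply: (@ord4_ind (fun n => all (fun l : nat => glue_sign n l ^+ 2 == 1)
    (iota 0 3))); vm_compute.
by apply: (allP (H i)); rewrite mem_iota ltn_ord.
Qed.

Lemma glueE i : glue i = \sum_(j < 3) (glue_sign i j)%:~R *: wt R (lift i j) 0.
Proof.
pose S n := foldr (fun j s => vadd (vscale (glue_sign n j) (vz (bump n j) 0)) s)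
  (nseq 8 0) (iota 0 3).
have H : forall j : 'I_4, vscale 3 (gluez j) == S j.
  by apply: (@ord4_ind (fun n => vscale 3 (gluez n) == S n)); vm_compute.
apply: (@scalerI _ _ (3 : R)); first by rewrite pnatr_eq0.
rewrite -[3]/(3%:~R) -half_scale (eqP (H i)) !half_add half_zero !half_scale.
rewrite scaler_sumr 3!big_ord_recl big_ord0 /wt !scalerA; congr (_ *: _ + (_ *: _ + (_ *: _ + _)));
  by rewrite [3%:~R * _]mulrC mulfK // pnatr_eq0.
Qed.

End Weights.

Section Glue.
Variable R : realType.
Implicit Types (a b x y : oct R) (i : 'I_4) (j k l : 'I_3) (f : 'I_3 -> 'I_3).
Local Notation glue := (@glue R).
Local Notation gdwt := (@gdwt R).
Local Notation perp_list := (@perp_list R).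
Local Notation ext_list := (@ext_list R).

Lemma glue_perp i : glue i \in perp_list i.
Proof.
apply: map_f; move: i; apply: (@ord4_ind (fun n => gluez n \in perp n)).
by rewrite /perp roots.unlock; vm_compute.
Qed.

Lemma gdwt0 i j : gdwt i j 0 = 0.
Proof. by rewrite /gdwt dwt0 scaler0. Qed.

Lemma sign_cases i j :
  (glue_sign i j)%:~R = 1 :> R \/ (glue_sign i j)%:~R = -1 :> R.
Proof.
by have /eqP := glue_sign_sq R i j; rewrite sqrf_eq1 => /orP[]/eqP; [left|right].
Qed.

Lemma gdwt_ext i j a : a \in ext_list (lift i j) <->
  exists k l, k != l /\ a = gdwt i j k - gdwt i j l.
Proof.
rewrite ext_listP /gdwt; have [->|->] := sign_cases i j.
  by split=> -[k [l [kl ->]]]; exists k, l; rewrite ?scale1r.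
split=> -[k [l [kl ->]]]; exists l, k; rewrite eq_sym kl;
  by rewrite !scaleN1r opprK addrC.
Qed.

Lemma gdwt_gram i j k l : oform (gdwt i j k) (gdwt i j l) =
  (k == l)%:R - (k == 0)%:R - (l == 0)%:R + 1.
Proof.
by rewrite /gdwt oformZl oformZr mulrA -expr2 glue_sign_sq mul1r dwt_gram.
Qed.

Lemma gdwt_orth i j j' k l : j != j' -> oform (gdwt i j k) (gdwt i j' l) = 0.
Proof.
move=> jj; rewrite /gdwt oformZl oformZr dwt_orth ?mulr0 //.
by rewrite (inj_eq (@lift_inj _ i)).
Qed.

Lemma gdwt_orth_dwt i j k l : oform (gdwt i j k) (dwt R i l) = 0.
Proof. by rewrite /gdwt oformZl dwt_orth ?mulr0 // eq_sym neq_lift. Qed.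

Lemma glue_oform i j l : oform (glue i) (gdwt i j l) = (0 == l)%:R - 1.
Proof.
rewrite glueE oform_suml (bigD1 j) //= big1 ?addr0 => [|j' jj].
  rewrite /gdwt oformZl oformZr mulrA -expr2 glue_sign_sq mul1r dwtE.
  by rewrite oformBr !wt_gram eqxx /=; ring.
rewrite oformZl oformC (@oform_span _ (ext_list (lift i j'))) ?mulr0 //.
  move=> a /(@gdwt_ext i j')[k [m [_ ->]]].
  by rewrite oformBr !gdwt_orth ?subr0 // eq_sym.
exact: wt_span.
Qed.

(** The 27 roots whose projections to the three planes are weights of the
    standard representations, the weight in the j-th plane being given by f j. *)
Definition trini_root i f : oct R := glue i + \sum_j gdwt i j (f j).

Lemma trini_oform i f j l : oform (trini_root i f) (gdwt i j l) =
  (f j == l)%:R - (f j == 0)%:R.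
Proof.
rewrite oformDl glue_oform oform_suml (bigD1 j) //= big1 ?addr0 => [|j' jj].
  by rewrite gdwt_gram (eq_sym l 0); ring.
by rewrite gdwt_orth.
Qed.

Lemma add_gdwt_root i j k x : Phi_E8 R x -> oform x (gdwt i j k) = (0 == k)%:R - 1 ->
  Phi_E8 R (x + gdwt i j k).
Proof.
have [->|k0] := eqVneq k 0; first by rewrite gdwt0 addr0.
have : gdwt i j k - gdwt i j 0 \in ext_list (lift i j) by apply/gdwt_ext; exists k, 0.
rewrite gdwt0 subr0 => /ext_root dP xP E; apply/(Phi_add xP dP).
by rewrite E sub0r.
Qed.

Lemma trini_root3 i f : trini_root i f =
  glue i + gdwt i 2 (f 2) + gdwt i 1 (f 1) + gdwt i 0 (f 0).
Proof.
rewrite /trini_root 3!big_ord_recl big_ord0 addr0.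
have -> : lift ord0 (lift ord0 ord0) = 2 :> 'I_3 by apply: val_inj.
have -> : lift ord0 ord0 = 1 :> 'I_3 by apply: val_inj.
by rewrite (addrC (gdwt i ord0 _)) (addrC (gdwt i 1 _)) !addrA.
Qed.

Lemma trini_perp i f : trini_root i f \in perp_list i.
Proof.
have gp := glue_perp i; apply/perp_listP; split; last first.
  move=> l; rewrite oformDl oform_suml big1 => [|j _]; last exact: gdwt_orth_dwt.
  by rewrite addr0; have /perp_listP[] := gp.
rewrite trini_root3; apply: add_gdwt_root; [apply: add_gdwt_root; [apply: add_gdwt_root|]|].
- by have /perp_listP[] := gp.
- exact: glue_oform.
- by rewrite oformDl glue_oform gdwt_orth ?addr0.
- by rewrite !oformDl glue_oform !gdwt_orth ?addr0.
Qed.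

Lemma trini_root_inj i f f' : trini_root i f = trini_root i f' -> f =1 f'.
Proof.
move=> E j; apply/eqP; apply/negPn/negP => ff.
have H l : (f j == l)%:R - (f j == 0)%:R = (f' j == l)%:R - (f' j == 0)%:R :> R.
  by rewrite -(trini_oform i f) -(trini_oform i f') E.
have := H (f j); have := H (f' j); rewrite !eqxx [f' j == f j]eq_sym (negPf ff) /=.
by move: (_ == 0) (_ == 0) => {E H} b b' E1 E2; lra.
Qed.

Lemma trini_root_not_ext i f j a : a \in ext_list (lift i j) ->
  trini_root i f != a.
Proof.
case/gdwt_ext=> k [l [_ E]]; apply/eqP => F.
have tP : Phi_E8 R (trini_root i f) by have /perp_listP[] := trini_perp i f.
have := Phi_norm tP; rewrite {2}F E oformBr !trini_oform {E F}.
by case: (f j == k); case: (f j == l) => /= E; lra.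
Qed.

(** By norms, adding the root d_k - d_l of the j-th plane gives a root only if
    the weight in that plane is the l-th; it becomes the k-th. *)
Lemma trini_root_step i f j k l : k != l ->
  Phi_E8 R (trini_root i f + (gdwt i j k - gdwt i j l)) ->
  exists f', trini_root i f' = trini_root i f + (gdwt i j k - gdwt i j l).
Proof.
move=> kl aP; have tP : Phi_E8 R (trini_root i f).
  by have /perp_listP[] := trini_perp i f.
have eP : Phi_E8 R (gdwt i j k - gdwt i j l).
  by apply: (@ext_root _ (lift i j)); apply/gdwt_ext; exists k, l.
have fl : f j = l.
  have := (Phi_add tP eP).2 aP; rewrite oformBr !trini_oform.
  case: (eqVneq (f j) l) => // _ E; exfalso.
  by case: (f j == k) E => /= E; lra.
exists (fun j' => if j' == j then k else f j').
rewrite /trini_root (bigD1 j) // [in RHS](bigD1 j) //= eqxx fl.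
rewrite (eq_bigr (fun j' => gdwt i j' (f j'))) => [|j' /negPf -> //].
rewrite -!addrA; congr (_ + _).
by rewrite [RHS]addrCA [gdwt i j l + _]addrC subrK addrC.
Qed.

(** ** The grading *)

(** The sum of the d_k is minus three times the weight v_0 of the first of the
    three planes, up to the sign in [gdwt].  Its inner products are divisible
    by 3 with the roots of the triangles, and 1 or -2 with the 27 roots above. *)
Definition grading_vector i : oct R := \sum_k gdwt i 0 k.

Definition grade i a : 'Z_3 := (Num.floor (oform a (grading_vector i)))%:~R.

Lemma grade_int i a (z : int) : oform a (grading_vector i) = z%:~R ->
  grade i a = z%:~R.
Proof. by move=> E; rewrite /grade E intrKfloor. Qed.

Lemma Phi_grade i a : Phi_E8 R a ->
  exists z : int, oform a (grading_vector i) = z%:~R.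
Proof.
move=> aP; rewrite oform_sumr; 
apply: (big_ind (fun c : R => exists z : int, c = z%:~R)).
- by exists 0.
- by move=> _ _ [z ->] [t ->]; exists (z + t); rewrite rmorphD.
move=> k _; have [->|k0] := eqVneq k 0; first by exists 0; rewrite gdwt0 oform0r.
have ke : gdwt i 0 k \in ext_list (lift i 0).
  by apply/gdwt_ext; exists k, 0; rewrite gdwt0 subr0.
by have [z -> _] := Phi_int aP (ext_root ke); exists z.
Qed.

Lemma gradeD i a b : Phi_E8 R a -> Phi_E8 R b ->
  grade i (a + b) = grade i a + grade i b.
Proof.
move=> /(Phi_grade i)[z za] /(Phi_grade i)[t tb].
by rewrite (grade_int za) (grade_int tb) -rmorphD; apply: grade_int;
  rewrite oformDl za tb rmorphD.
Qed.

Lemma gradeN i a : Phi_E8 R a -> grade i (- a) = - grade i a.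
Proof.
move=> /(Phi_grade i)[z za]; rewrite (grade_int za) -rmorphN; apply: grade_int.
by rewrite oformNl za rmorphN.
Qed.

Lemma sum_eq3 (n : 'I_3) : \sum_(k < 3) (n == k)%:R = 1 :> R.
Proof. by rewrite (bigD1 n) //= eqxx big1 ?addr0 // => k /negPf; rewrite eq_sym => ->. Qed.

Lemma grade_ext i j a : a \in ext_list (lift i j) -> grade i a = 0.
Proof.
case/gdwt_ext=> k [l [_ ->]].
have [z E] : exists z : int, oform (gdwt i j k - gdwt i j l) (grading_vector i) =
    (3 * z)%:~R.
  rewrite oform_sumr; have [->|j0] := eqVneq j 0; last first.
    exists 0; rewrite big1 // => m _.
    by rewrite oformBl !gdwt_orth ?subr0.
  exists ((l == 0)%:R - (k == 0)%:R).
  under eq_bigr => m _ do rewrite oformBl !gdwt_gram.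
  rewrite sumrB !(big_split, sumrB) /= !sum_eq3 !sumr_const !card_ord.
  by rewrite rmorphM rmorphB /= !rmorph_nat; ring.
by rewrite (grade_int E) rmorphM /= (_ : 3%:~R = 0) ?mul0r //; apply: val_inj.
Qed.

Lemma grade_trini i f : grade i (trini_root i f) = 1.
Proof.
have E : oform (trini_root i f) (grading_vector i) = (1 - 3 * (f 0 == 0)%:R)%:~R.
  rewrite oform_sumr; under eq_bigr => m _ do rewrite trini_oform.
  rewrite sumrB sum_eq3 sumr_const card_ord rmorphB rmorphM /= rmorph_nat.
  by ring.
rewrite (grade_int E) rmorphB rmorphM /= (_ : 3%:~R = 0) ?mul0r ?subr0 //.
exact: val_inj.
Qed.

End Glue.

(** * Lie algebras with a simply laced root system *)

Section LieBasics.
Variables (K : fieldType) (L : lieAlgType K).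
Implicit Types (x y z : L) (U V : {vspace L}).

HB.instance Definition _ x := GRing.isLinear.Build K L L _ (lie x)
  (fun a y z => lieDr a y z x).

Lemma lieDl1 x y z : lie (x + y) z = lie x z + lie y z.
Proof. by have := lieDl 1 x y z; rewrite !scale1r. Qed.

Lemma lie_skew x y : lie x y = - lie y x.
Proof.
have := liexx (x + y).
rewrite linearD /= !lieDl1 !liexx addr0 add0r => /eqP.
by rewrite addrC addr_eq0 => /eqP.
Qed.

Lemma lie0l z : lie 0 z = 0.
Proof. by rewrite lie_skew linear0 oppr0. Qed.

Lemma lieZl a x z : lie (a *: x) z = a *: lie x z.
Proof. by have := lieDl a x 0 z; rewrite !addr0 lie0l addr0. Qed.

Lemma lieNl x z : lie (- x) z = - lie x z.
Proof. by rewrite -scaleN1r lieZl scaleN1r. Qed.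

Lemma lie_suml (I : Type) (r : seq I) (F : I -> L) z :
  lie (\sum_(i <- r) F i) z = \sum_(i <- r) lie (F i) z.
Proof.
elim: r => [|i r IH]; first by rewrite !big_nil lie0l.
by rewrite !big_cons lieDl1 IH.
Qed.

Lemma lieBl x y z : lie (x - y) z = lie x z - lie y z.
Proof. by rewrite lieDl1 lieNl. Qed.

Lemma lieDr1 x y z : lie z (x + y) = lie z x + lie z y.
Proof. exact: linearD. Qed.

Lemma lie0r z : lie z 0 = 0.
Proof. exact: linear0. Qed.

Lemma lieNr x z : lie z (- x) = - lie z x.
Proof. exact: linearN. Qed.

Lemma lieZr a x z : lie z (a *: x) = a *: lie z x.
Proof. exact: linearZ. Qed.

Lemma lie_sumr (I : Type) (r : seq I) (F : I -> L) z :
  lie z (\sum_(i <- r) F i) = \sum_(i <- r) lie z (F i).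
Proof. exact: linear_sum. Qed.

Lemma lie_deriv x y z : lie x (lie y z) = lie (lie x y) z + lie y (lie x z).
Proof.
have := lie_jacobi x y z; rewrite (lie_skew z (lie x y)) (lie_skew z x) linearN /=.
by move/eqP; rewrite subr_eq0 subr_eq addrC => /eqP -> ; rewrite addrC.
Qed.

Lemma lie_lie x y z : lie (lie x y) z = lie x (lie y z) - lie y (lie x z).
Proof. by rewrite lie_deriv addrK. Qed.

Lemma memv_sum_seqP (I : eqType) (s : seq I) (V : I -> {vspace L}) x : uniq s ->
  x \in (\sum_(i <- s) V i)%VS ->
  exists2 X : I -> L, forall i, X i \in V i & x = \sum_(i <- s) X i.
Proof.
elim: s x => [|i s IH] x /=.
  rewrite big_nil memv0 => _ /eqP->; exists (fun=> 0); first by move=> i; rewrite mem0v.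
  by rewrite big_nil.
case/andP=> nis us; rewrite big_cons => /memv_addP[u uV [w /(IH _ us)[X XV ->] ->]].
exists (fun j => if j == i then u else X j).
  by move=> j; case: eqP => [->|].
rewrite big_cons eqxx; congr (_ + _); apply: eq_big_seq => j js.
by case: eqP js nis => // -> ->.
Qed.

Lemma sumv_seq_sup (I : eqType) (s : seq I) (V : I -> {vspace L}) i :
  i \in s -> (V i <= \sum_(j <- s) V j)%VS.
Proof.
elim: s => // j s IH; rewrite inE big_cons => /orP[/eqP->|/IH H].
  exact: addvSl.
exact: subv_trans H (addvSr _ _).
Qed.

Lemma subv_sum_seq (I : eqType) (s : seq I) (V : I -> {vspace L}) U :
  (forall i, i \in s -> (V i <= U)%VS) -> (\sum_(j <- s) V j <= U)%VS.
Proof.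
elim: s => [|j s IH] H; first by rewrite big_nil sub0v.
rewrite big_cons subv_add H ?mem_head ?IH // => i ini.
by rewrite H // inE ini orbT.
Qed.

End LieBasics.

(** ** Matrices of the adjoint action on a linearly independent family *)

Section BasisMatrix.
Variables (K : fieldType) (L : lieAlgType K).
Implicit Types (x y z : L) (g : {vspace L}).

Definition independent n (w : 'I_n -> L) : Prop :=
  forall k : 'I_n -> K, \sum_i k i *: w i = 0 -> forall i, k i = 0.

Definition acts n (w : 'I_n -> L) x (M : 'M[K]_n) : Prop :=
  forall j, lie x (w j) = \sum_i M i j *: w i.

Definition lincomb n (w : 'I_n -> L) (u : 'cV[K]_n) : L := \sum_i u i 0 *: w i.

Lemma lincomb_is_linear n (w : 'I_n -> L) : linear (lincomb w).
Proof.
move=> a u v; rewrite /lincomb scaler_sumr -big_split; apply: eq_bigr => i _ /=.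
by rewrite !mxE scalerDl scalerA.
Qed.

HB.instance Definition _ n (w : 'I_n -> L) := GRing.isLinear.Build K 'cV[K]_n L _
  (lincomb w) (lincomb_is_linear w).

Variables (n : nat) (w : 'I_n -> L).

Definition lincombf : 'Hom('cV[K]_n, L) := linfun (lincomb w).

Lemma lincomb_delta j : lincomb w (delta_mx j 0) = w j.
Proof.
rewrite /lincomb (bigD1 j) //= big1 => [|i ij]; last first.
  by rewrite mxE (negPf ij) scale0r.
by rewrite mxE !eqxx scale1r addr0.
Qed.

Lemma lincombf_img : limg lincombf = (\sum_i <[w i]>)%VS.
Proof.
apply/eqP; rewrite eqEsubv; apply/andP; split.
  apply/subvP => _ /memv_imgP[u _ ->]; rewrite lfunE /= memv_suml // => i _.
  rewrite memvZ //; apply: (subvP _ _ (memv_line _)); exact: (sumv_sup i).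
apply/subv_sumP => i _; rewrite -memvE -lincomb_delta.
by have := memv_img lincombf (memvf (delta_mx i 0)); rewrite lfunE.
Qed.

Lemma acts_lincomb x M u : acts w x M ->
  lie x (lincombf u) = lincombf (M *m u).
Proof.
move=> xM; rewrite !lfunE /= /lincomb lie_sumr.
rewrite (eq_bigr (fun j => \sum_i (u j 0 * M i j) *: w i)); last first.
  by move=> j _; rewrite lieZr xM scaler_sumr; apply: eq_bigr => i _; rewrite scalerA.
rewrite exchange_big; apply: eq_bigr => i _ /=; rewrite -scaler_suml mxE.
by congr (_ *: _); apply: eq_bigr => j _; rewrite mulrC.
Qed.

Lemma acts_comb a x y M N : acts w x M -> acts w y N ->
  acts w (a *: x + y) (a *: M + N).
Proof.
move=> xM yN j; rewrite lieDl xM yN scaler_sumr -big_split.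
by apply: eq_bigr => i _ /=; rewrite !mxE scalerDl scalerA.
Qed.

Lemma acts_bracket x y M N : acts w x M -> acts w y N ->
  acts w (lie x y) (M *m N - N *m M).
Proof.
have comp x1 y1 M1 N1 j : acts w x1 M1 -> acts w y1 N1 ->
    lie x1 (lie y1 (w j)) = \sum_i (M1 *m N1) i j *: w i.
  move=> xM yN; rewrite yN lie_sumr.
  rewrite (eq_bigr (fun k => \sum_i (M1 i k * N1 k j) *: w i)); last first.
    by move=> k _; rewrite lieZr xM scaler_sumr; apply: eq_bigr => i _;
      rewrite scalerA mulrC.
  by rewrite exchange_big; apply: eq_bigr => i _ /=; rewrite -scaler_suml mxE.
move=> xM yN j; rewrite lie_lie (comp _ _ _ _ _ xM yN) (comp _ _ _ _ _ yN xM).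
by rewrite -sumrB; apply: eq_bigr => i _; rewrite !mxE scalerBl.
Qed.

(* Only meaningful if the span of w is stable under ad x. *)
Definition adm x : 'M[K]_n :=
  \matrix_(i, j) coord [tuple w i | i < n] i (lie x (w j)).

Lemma adm_acts x : (forall j, lie x (w j) \in (\sum_i <[w i]>)%VS) ->
  acts w x (adm x).
Proof.
move=> st j; have {st} : lie x (w j) \in <<[tuple w i | i < n]>>%VS.
  apply: (subvP _ _ (st j)); apply/subv_sumP => i _; rewrite -memvE memv_span //.
  by apply/mapP; exists i; rewrite ?mem_enum.
move/coord_span => {1}->; apply: eq_bigr => i _.
by rewrite mxE nth_mktuple.
Qed.

Hypothesis wfree : independent w.

Lemma lincombf_inj : lker lincombf = 0%VS.
Proof.
apply/eqP; rewrite -subv0; apply/subvP => u; rewrite memv_ker lfunE memv0 /=.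
move/eqP/wfree => u0; apply/eqP/colP => i; by rewrite u0 mxE.
Qed.

Lemma acts_uniq x M N : acts w x M -> acts w x N -> M = N.
Proof.
move=> xM xN; apply/matrixP => i j; apply/eqP; rewrite -subr_eq0; apply/eqP.
apply: (@wfree (fun i => M i j - N i j)).
rewrite (eq_bigr (fun i => M i j *: w i - N i j *: w i)).
  by rewrite sumrB -xM -xN subrr.
by move=> k _; rewrite scalerBl.
Qed.

Lemma acts_representation g (rho : L -> 'M[K]_n) : subalgebra g ->
  (forall x, x \in g -> acts w x (rho x)) -> representation g rho.
Proof.
move=> sg act; split=> [a x y|x y] xg yg.
  apply: (acts_uniq (x := a *: x + y)); first by apply: act; rewrite memvD ?memvZ.
  by apply: acts_comb; apply: act.
apply: (acts_uniq (x := lie x y)); first by apply: act; apply: sg.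
by apply: acts_bracket; apply: act.
Qed.

End BasisMatrix.

Section TensorBasis.
Variables (K : fieldType) (L : lieAlgType K).
Implicit Types (x y z : L) (g : {vspace L}).

Lemma tens_left n1 n2 (W : 'I_(n1 * n2) -> L) (A : 'M[K]_n1) p k :
  \sum_i (A *t (1%:M : 'M_n2)) i (mxtens_index (p, k)) *: W i =
  \sum_q A q p *: W (mxtens_index (q, k)).
Proof.
rewrite (reindex (@mxtens_index n1 n2)) /=; last first.
  by exists (@mxtens_unindex n1 n2) => i _; rewrite ?mxtens_indexK ?mxtens_unindexK.
transitivity (\sum_q \sum_l (A *t (1%:M : 'M_n2)) (mxtens_index (q, l))
    (mxtens_index (p, k)) *: W (mxtens_index (q, l))).
  by rewrite pair_bigA; apply: eq_bigr => -[q l].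
apply: eq_bigr => q _; rewrite (bigD1 k) //= big1 => [|l lk].
  by rewrite tensmxE mxE eqxx mulr1 addr0.
by rewrite tensmxE mxE (negPf lk) mulr0 scale0r.
Qed.

Lemma tens_right n1 n2 (W : 'I_(n1 * n2) -> L) (B : 'M[K]_n2) p k :
  \sum_i ((1%:M : 'M_n1) *t B) i (mxtens_index (p, k)) *: W i =
  \sum_l B l k *: W (mxtens_index (p, l)).
Proof.
rewrite (reindex (@mxtens_index n1 n2)) /=; last first.
  by exists (@mxtens_unindex n1 n2) => i _; rewrite ?mxtens_indexK ?mxtens_unindexK.
transitivity (\sum_q \sum_l ((1%:M : 'M_n1) *t B) (mxtens_index (q, l))
    (mxtens_index (p, k)) *: W (mxtens_index (q, l))).
  by rewrite pair_bigA; apply: eq_bigr => -[q l].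
rewrite (bigD1 p) //= [X in _ + X]big1 ?addr0 => [|q qp].
  by apply: eq_bigr => l _; rewrite tensmxE mxE eqxx mul1r.
by rewrite big1 // => l _; rewrite tensmxE mxE (negPf qp) mul0r scale0r.
Qed.

Lemma acts_add n (w : 'I_n -> L) x y M N : acts w x M -> acts w y N ->
  acts w (x + y) (M + N).
Proof. by move=> xM yN; have := acts_comb 1 xM yN; rewrite !scale1r. Qed.

Lemma tensor2_of_acts g1 g2 (V : {vspace L}) n1 n2
    (rho1 : L -> 'M[K]_n1) (rho2 : L -> 'M[K]_n2) (W : 'I_(n1 * n2) -> L) :
  independent W -> (\sum_i <[W i]>)%VS = V ->
  (forall x, x \in g1 -> acts W x (rho1 x *t 1%:M)) ->
  (forall x, x \in g2 -> acts W x (1%:M *t rho2 x)) ->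
  tensor_module2 g1 g2 V rho1 rho2.
Proof.
move=> Wf WV act1 act2; exists (lincombf W); split; first exact: lincombf_inj.
  by rewrite lincombf_img.
by move=> x1 x2 u x1g x2g; apply/acts_lincomb/acts_add; [apply: act1|apply: act2].
Qed.

Lemma tensor3_of_acts g1 g2 g3 (V : {vspace L}) n1 n2 n3
    (rho1 : L -> 'M[K]_n1) (rho2 : L -> 'M[K]_n2) (rho3 : L -> 'M[K]_n3)
    (W : 'I_(n1 * n2 * n3) -> L) :
  independent W -> (\sum_i <[W i]>)%VS = V ->
  (forall x, x \in g1 -> acts W x ((rho1 x *t 1%:M) *t 1%:M)) ->
  (forall x, x \in g2 -> acts W x ((1%:M *t rho2 x) *t 1%:M)) ->
  (forall x, x \in g3 -> acts W x ((1%:M *t 1%:M) *t rho3 x)) ->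
  tensor_module3 g1 g2 g3 V rho1 rho2 rho3.
Proof.
move=> Wf WV act1 act2 act3; exists (lincombf W); split.
- exact: lincombf_inj.
- by rewrite lincombf_img.
move=> x1 x2 x3 u x1g x2g x3g; apply/acts_lincomb/acts_add; last exact: act3.
by apply: acts_add; [apply: act1|apply: act2].
Qed.

End TensorBasis.

(** ** Root spaces *)

Section SimplyLaced.
Variables (K : fieldType) (Q : zmodType) (V : vectType K) (L : lieAlgType K).
Variables (chi : Q -> 'Hom(V, K^o)) (cx : Q -> V) (theta : 'Hom(V, L)).
Variable Phi : seq Q.
Implicit Types (a b : Q) (c d : V) (x y z : L).
Local Notation "<< a , c >>" := (chi a c : K) : ring_scope.

(** A simply laced root system, in the form in which it acts on a Lie
    algebra: chi turns a root into a functional on V, and cx embeds the roots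
    into V. *)
Record simply_laced : Prop := SimplyLaced {
  char0 : [pchar K] =i pred0;
  chiD : forall a b c, <<a + b, c>> = <<a, c>> + <<b, c>>;
  cxD : forall a b, cx (a + b) = cx a + cx b;
  chiC : forall a b, <<a, cx b>> = <<b, cx a>>;
  chi_def : forall a, <<a, cx a>> = 0 -> a = 0;
  Phi_uniq : uniq Phi;
  Phi_oppr : forall a, a \in Phi -> - a \in Phi;
  Phi_norm2 : forall a, a \in Phi -> <<a, cx a>> = 2;
  Phi_pairs : forall a b, a \in Phi -> b \in Phi ->
    [\/ b = a, b = - a |
        [\/ <<a, cx b>> = -1, <<a, cx b>> = 0 | <<a, cx b>> = 1]];
  Phi_addr : forall a b, a \in Phi -> b \in Phi -> <<a, cx b>> = -1 ->
    a + b \in Phi;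
  Phi_spans : forall c, (forall a, a \in Phi -> <<a, c>> = 0) -> c = 0 }.

(* The joint eigenspace, as a finite intersection over a basis of V. *)
Definition wsp a : {vspace L} :=
  (\bigcap_(k < \dim {:V}) lker (linfun (lie (theta (vbasis {:V})`_k) : L -> L)
     - <<a, (vbasis {:V})`_k>> *: \1%VF))%VS.

Lemma wspP a x : x \in wsp a <-> forall c, lie (theta c) x = <<a, c>> *: x.
Proof.
split=> [xa c|H]; last first.
  rewrite memvE; apply/subv_bigcapP => k _; rewrite -memvE memv_ker.
  by rewrite add_lfunE opp_lfunE scale_lfunE id_lfunE lfunE /= H subrr.
have E (k : 'I_(\dim {:V})) :
    lie (theta (vbasis {:V})`_k) x = <<a, (vbasis {:V})`_k>> *: x.
  move: xa; rewrite memvE => /subv_bigcapP/(_ k isT); rewrite -memvE memv_ker.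
  rewrite add_lfunE opp_lfunE scale_lfunE id_lfunE lfunE /= subr_eq0.
  by move/eqP.
rewrite (coord_vbasis (memvf c)) !linear_sum lie_suml scaler_suml.
apply: eq_bigr => k _; rewrite !linearZ /= lieZl E scalerA.
by [].
Qed.

(** By induction on the number of weights: ad(theta c) - <b, c> kills the
    component of weight b and multiplies the one of weight a by <a - b, c>. *)
Lemma weight_split (S : {vspace V}) (J : {vspace L}) (s : seq Q)
    (X : Q -> L) :
  (forall c x, c \in S -> x \in J -> lie (theta c) x \in J) ->
  uniq s ->
  (forall a b, a \in s -> b \in s -> a != b ->
     exists2 c, c \in S & <<a, c>> != <<b, c>>) ->
  (forall a, a \in s -> X a \in wsp a) ->
  \sum_(a <- s) X a \in J -> forall a, a \in s -> X a \in J.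
Proof.
move=> stab; elim: s X => // b s IH X /= /andP[nbs us] sep Xw sJ.
have XJ a : a \in s -> X a \in J.
  move=> ais; have ab : a != b by apply: contraNneq nbs => <-.
  have ain : a \in b :: s by rewrite inE ais orbT.
  have [c cS ne] := sep _ _ ain (mem_head _ _) ab.
  rewrite -subr_eq0 in ne.
  have : (<<a, c>> - <<b, c>>) *: X a \in J.
    apply: (IH (fun a => (<<a, c>> - <<b, c>>) *: X a)) => //.
    - by move=> a1 b1 H1 H2; apply: sep; rewrite inE ?H1 ?H2 orbT.
    - by move=> a1 H1; rewrite memvZ // Xw // inE H1 orbT.
    have <- : lie (theta c) (\sum_(a <- b :: s) X a)
              - <<b, c>> *: (\sum_(a <- b :: s) X a) =
              \sum_(a <- s) (<<a, c>> - <<b, c>>) *: X a.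
      rewrite lie_sumr scaler_sumr -sumrB big_cons.
      have /wspP -> := Xw _ (mem_head _ _); rewrite subrr add0r.
      apply: eq_big_seq => a1 H1; have /wspP -> : X a1 \in wsp a1.
        by rewrite Xw // inE H1 orbT.
      by rewrite scalerBl.
    by rewrite memvB ?memvZ // stab.
  by move/(memvZ (<<a, c>> - <<b, c>>)^-1); rewrite scalerA mulVf // scale1r.
move=> a; rewrite inE => /orP[/eqP->|/XJ //].
move: sJ; rewrite big_cons => sJ.
have <- : X b + \sum_(j <- s) X j - \sum_(j <- s) X j = X b by rewrite addrK.
rewrite memvB // big_seq; apply: (big_ind (fun v => v \in J)) => //.
  exact: mem0v.
by move=> u v; apply: memvD.
Qed.

(** The Lie algebra L has root system Phi, and is simple; theta identifies V
    with its Cartan subalgebra. *)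
Record root_decomposition : Prop := RootDecomposition {
  theta_inj : forall c, theta c = 0 -> c = 0;
  theta_abelian : forall c d, lie (theta c) (theta d) = 0;
  theta_self : forall x, (forall c, lie (theta c) x = 0) ->
    exists c, x = theta c;
  wsp_root : forall a, a \in Phi -> wsp a != 0%VS;
  wsp_nonroot : forall a, a \notin 0 :: Phi -> wsp a = 0%VS;
  wsp_full : (\sum_(a <- 0%R :: Phi) wsp a = fullv)%VS;
  ideals : forall J : {vspace L},
    (forall x y, y \in J -> lie x y \in J) -> J = 0%VS \/ J = fullv }.

Hypotheses (SL : simply_laced) (RD : root_decomposition).

Lemma natK0 n : (n%:R == 0 :> K) = (n == 0%N).
Proof. by have /pcharf0P := char0 SL. Qed.

Lemma natK_eq m n : (m%:R == n%:R :> K) = (m == n).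
Proof.
wlog mn : m n / (m <= n)%N => [H|].
  by have [/H//|/ltnW/H H'] := leqP m n; rewrite eq_sym H' eq_sym.
by rewrite eq_sym -subr_eq0 -natrB // natK0 subn_eq0 eqn_leq mn.
Qed.

Lemma chi0 c : <<0, c>> = 0.
Proof. by apply: (addrI <<0, c>>); rewrite -(chiD SL) !addr0. Qed.

Lemma chiN a c : <<- a, c>> = - <<a, c>>.
Proof. by apply/eqP; rewrite -addr_eq0 -(chiD SL) addNr chi0. Qed.

Lemma chiB a b c : <<a - b, c>> = <<a, c>> - <<b, c>>.
Proof. by rewrite (chiD SL) chiN. Qed.

Lemma cx0 : cx 0 = 0.
Proof. by apply: (addrI (cx 0)); rewrite -(cxD SL) !addr0. Qed.

Lemma cxN a : cx (- a) = - cx a.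
Proof. by apply/eqP; rewrite -addr_eq0 -(cxD SL) addNr cx0. Qed.

Lemma cxB a b : cx (a - b) = cx a - cx b.
Proof. by rewrite (cxD SL) cxN. Qed.

Lemma chi_cxN a b : <<a, cx (- b)>> = - <<a, cx b>>.
Proof. by rewrite !(chiC SL a) chiN. Qed.

Lemma chi_cxD a b e : <<a, cx (b + e)>> = <<a, cx b>> + <<a, cx e>>.
Proof. by rewrite !(chiC SL a) (chiD SL). Qed.

Lemma Phi_nz a : a \in Phi -> a != 0.
Proof.
move/(Phi_norm2 SL) => E; apply/eqP => a0; move: E; rewrite a0 chi0 => /eqP.
by rewrite eq_sym natK0.
Qed.

Lemma uniq_weights : uniq (0 :: Phi).
Proof.
by rewrite /= (Phi_uniq SL) andbT; apply/negP => /Phi_nz; rewrite eqxx.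
Qed.

Lemma weights_sep a b : a != b -> exists c, <<a, c>> != <<b, c>>.
Proof.
move=> ab; exists (cx (a - b)); rewrite -subr_eq0 -chiB.
by apply: contra_neq ab => /(chi_def SL)/eqP; rewrite subr_eq0 => /eqP.
Qed.

Lemma normD a b : <<a + b, cx (a + b)>> =
  <<a, cx a>> + <<b, cx b>> + 2 * <<a, cx b>>.
Proof. by rewrite (chiD SL) !chi_cxD (chiC SL b a); ring. Qed.

Lemma Phi_addE a b : a \in Phi -> b \in Phi -> a + b \in 0 :: Phi ->
  b = - a \/ <<a, cx b>> = -1.
Proof.
move=> aP bP; rewrite inE => /orP[|/(Phi_norm2 SL)].
  by rewrite addrC addr_eq0 => /eqP; left.
rewrite normD !(Phi_norm2 SL) // => E; right.
have : 2 * (<<a, cx b>> + 1) = 0.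
  by rewrite -[RHS](subrr (2 : K)) -{2}E; ring.
by move/eqP; rewrite mulf_eq0 natK0 /= addr_eq0 => /eqP.
Qed.

Lemma wsp0E x : x \in wsp 0 -> exists c, x = theta c.
Proof.
move/wspP=> H; apply: (theta_self RD) => c.
by rewrite H chi0 scale0r.
Qed.

Lemma theta_wsp0 c : theta c \in wsp 0.
Proof. by apply/wspP => d; rewrite (theta_abelian RD) chi0 scale0r. Qed.

Lemma lie_theta_r a c x : x \in wsp a -> lie x (theta c) = - <<a, c>> *: x.
Proof. by move/wspP => E; rewrite lie_skew E scaleNr. Qed.

Lemma lie_wsp a b x y : x \in wsp a -> y \in wsp b -> lie x y \in wsp (a + b).
Proof.
move=> /wspP xa /wspP yb; apply/wspP => c.
by rewrite lie_deriv xa yb lieZl lieZr -scalerDl (chiD SL).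
Qed.

Lemma wsp_sum0 (s : seq Q) (X : Q -> L) : uniq s ->
  (forall a, a \in s -> X a \in wsp a) -> \sum_(a <- s) X a = 0 ->
  forall a, a \in s -> X a = 0.
Proof.
move=> us Xw E a ais; apply/eqP; rewrite -memv0.
apply: (@weight_split fullv 0%VS s X) => //; last by rewrite E mem0v.
  by move=> c x _; rewrite !memv0 => /eqP->; rewrite lie0r.
by move=> a1 b1 _ _ /weights_sep[c]; exists c; rewrite ?memvf.
Qed.

Lemma lie_nonroot a b x y : a \in Phi -> b \in Phi -> x \in wsp a ->
  y \in wsp b -> b != - a -> <<a, cx b>> != -1 -> lie x y = 0.
Proof.
move=> aP bP xa yb ba ab; apply/eqP; rewrite -memv0 -(@wsp_nonroot RD (a + b)).
  exact: lie_wsp.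
by apply/negP => /(Phi_addE aP bP) [/eqP|/eqP]; [exact/negP | exact/negP].
Qed.

(** Write [x, y] = theta c.  When <a, b> = -1, ad x and ad y only connect the
    root spaces of b and a + b, and comparing their two composites there gives
    2 <b, c> = - <a, c>.  Hence c and (<a, c> / 2) a have the same inner product
    with every root. *)
Lemma lie_opposite a x y : a \in Phi -> x \in wsp a -> y \in wsp (- a) ->
  exists k, lie x y = k *: theta (cx a).
Proof.
move=> aP xa ya.
have [c tE] : exists c, lie x y = theta c.
  by apply: wsp0E; rewrite -(addrN a); apply: lie_wsp.
exists (<<a, c>> / 2); rewrite tE -linearZ /=; congr (theta _).
have n2 : (2 : K) != 0 by rewrite natK0.
have nz e : e \in Phi -> exists2 u, u \in wsp e & u != 0.
  by move=> /(wsp_root RD); rewrite -vpick0; exists (vpick (wsp e));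
    rewrite ?memv_pick.
have string b : b \in Phi -> <<a, cx b>> = -1 -> 2 * <<b, c>> = - <<a, c>>.
  move=> bP ab; have abP := Phi_addr SL aP bP ab; have naP := Phi_oppr SL aP.
  have yu u : u \in wsp b -> lie y u = 0.
    move=> ub; apply: (@lie_nonroot (- a) b) => //.
      rewrite opprK; apply: contra_eq_neq ab => ->; rewrite (Phi_norm2 SL) //.
      by rewrite -subr_eq0 opprK -(natrD _ 2 1) natK0.
    by rewrite chiN ab opprK -subr_eq0 opprK -(natrD _ 1 1) natK0.
  have xz z : z \in wsp (a + b) -> lie x z = 0.
    move=> zb; apply: (@lie_nonroot a (a + b)) => //.
      apply: contra_eq_neq ab => E.
      have -> : b = - a - a by rewrite -{1}E addrC addKr.
      rewrite chi_cxD !chi_cxN (Phi_norm2 SL) // -subr_eq0.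
      have -> : - 2 - 2 - -1 = - 3 :> K by ring.
      by rewrite oppr_eq0 natK0.
    rewrite chi_cxD ab (Phi_norm2 SL) // -subr_eq0 opprK.
    by rewrite subrK natK0.
  have actu u : u \in wsp b -> <<b, c>> *: u = - lie y (lie x u).
    move=> ub; move/wspP: (ub) => /(_ c) <-.
    by rewrite -tE lie_lie (yu _ ub) lie0r sub0r.
  have actz z : z \in wsp (a + b) ->
      (<<a, c>> + <<b, c>>) *: z = lie x (lie y z).
    move=> zb; move/wspP: (zb) => /(_ c); rewrite (chiD SL) => <-.
    by rewrite -tE lie_lie (xz _ zb) lie0r subr0.
  have [bc0|bc] := eqVneq <<b, c>> 0.
    have [z zab z0] := nz _ abP.
    have y'b : lie y z \in wsp b.
      by rewrite -[b](addKr a); apply: lie_wsp.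
    have := actu _ y'b; rewrite bc0 scale0r -actz // lieZr.
    move/eqP; rewrite eq_sym oppr_eq0 scaler_eq0 bc0 addr0.
    case/orP=> [/eqP->|/eqP yz0]; first by rewrite mulr0 oppr0.
    move/eqP: (actz _ zab); rewrite yz0 lie0r scaler_eq0 (negPf z0) orbF.
    by rewrite bc0 addr0 => /eqP->; rewrite mulr0 oppr0.
  have [u ub u0] := nz _ bP.
  have xu0 : lie x u != 0.
    apply: contraNneq bc => xu; move/eqP: (actu _ ub).
    by rewrite xu lie0r oppr0 scaler_eq0 (negPf u0) orbF.
  have /eqP := actz _ (lie_wsp xa ub).
  rewrite -[lie y _]opprK -actu // lieNr lieZr -scaleNr -subr_eq0 -scalerBl.
  rewrite scaler_eq0 (negPf xu0) orbF opprK => /eqP E.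
  by apply/eqP; rewrite -addr_eq0 -E; apply/eqP; ring.
apply/eqP; rewrite -subr_eq0; apply/eqP; apply: (Phi_spans SL) => b bP.
suff: <<b, c>> - <<a, c>> / 2 * <<a, cx b>> = 0 :> K.
  by rewrite linearB linearZ /= (chiC SL).
have half2 : <<a, c>> / 2 * 2 = <<a, c>> by rewrite divfK.
have [->|->|[ab|ab|ab]] := Phi_pairs SL aP bP.
- by rewrite (Phi_norm2 SL) // half2 subrr.
- by rewrite chi_cxN (Phi_norm2 SL) // chiN mulrN half2 opprK addNr.
- rewrite ab mulrN1 opprK; apply: (mulfI n2).
  by rewrite mulrDr (string _ bP ab) mulrC divfK // mulr0 addNr.
- rewrite ab mulr0 subr0; have [u ub u0] := nz _ bP.
  have anb : b != a /\ b != - a.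
    split; apply: contra_eq_neq ab => /= ->; rewrite ?chi_cxN (Phi_norm2 SL) //;
    by rewrite ?oppr_eq0 natK0.
  move/wspP: (ub) => /(_ c); rewrite -tE lie_lie.
  rewrite (@lie_nonroot a b x u) //; first last.
  + by rewrite ab eq_sym oppr_eq0 oner_eq0.
  + by case: anb.
  rewrite (@lie_nonroot (- a) b y u) //; first last.
  + by rewrite chiN ab oppr0 eq_sym oppr_eq0 oner_eq0.
  + by rewrite opprK; case: anb.
  + exact: Phi_oppr.
  rewrite !lie0r subr0 => /esym/eqP.
  by rewrite scaler_eq0 (negPf u0) orbF => /eqP.
- have := string _ (Phi_oppr SL bP); rewrite chi_cxN ab => /(_ erefl).
  rewrite chiN mulrN => /oppr_inj E; rewrite mulr1 -E.
  by rewrite mulrC mulKf // subrr.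
Qed.

Lemma wsp_nz a : a \in Phi -> exists2 x, x \in wsp a & x != 0.
Proof.
move=> /(wsp_root RD); rewrite -vpick0.
by exists (vpick (wsp a)); rewrite ?memv_pick.
Qed.

Lemma theta_eq0 c : (theta c == 0) = (c == 0).
Proof.
by apply/eqP/eqP => [/(theta_inj RD) //|->]; rewrite linear0.
Qed.

Lemma cx_eq0 a : a \in Phi -> (cx a == 0) = false.
Proof.
move=> aP; apply/eqP => E; have := Phi_norm2 SL aP; rewrite E linear0 => /eqP.
by rewrite eq_sym natK0.
Qed.

Lemma chiZr a (k : K) c : <<a, k *: c>> = k * <<a, c>>.
Proof. by rewrite linearZ. Qed.

Lemma theta_cx_indep a b (k l : K) : a \in Phi -> b \in Phi ->
  b != a -> b != - a -> k *: theta (cx a) = l *: theta (cx b) -> k = 0.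
Proof.
move=> aP bP ba bna /eqP; rewrite -!linearZ -subr_eq0 -linearB /= theta_eq0.
rewrite subr_eq0 => /eqP E.
have Ea : 2 * k = l * <<a, cx b>>.
  have /(congr1 (chi a)) := E; rewrite !chiZr => <-.
  by rewrite mulrC (Phi_norm2 SL).
have Eb : k * <<a, cx b>> = 2 * l.
  have /(congr1 (chi b)) := E; rewrite !chiZr (chiC SL b a) => ->.
  by rewrite mulrC (Phi_norm2 SL).
have E4 : (4 - <<a, cx b>> ^+ 2) * k = 0.
  have -> : 4 = 2 * 2 :> K by rewrite -natrM.
  by rewrite mulrBl -mulrA Ea mulrA -Eb; ring.
have [/eqP|/eqP|ab] := Phi_pairs SL aP bP; rewrite ?(negPf ba) ?(negPf bna) //.
move/eqP: E4; rewrite mulf_eq0 => /orP[|/eqP//]; rewrite subr_eq0.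
case: ab => ->; rewrite ?sqrrN ?expr1n ?expr0n ?natK0 //.
  by rewrite -subr_eq0 -(natrB _ (isT : 1 <= 4)%N) natK0.
by rewrite -subr_eq0 -(natrB _ (isT : 1 <= 4)%N) natK0.
Qed.

(** By [lie_opposite], z can be corrected by a multiple of x so as to commute
    with y; it commutes with x as well, hence with theta(a), which acts on it
    by 2. *)
Lemma wsp_line_of a x y z : a \in Phi -> x \in wsp a -> y \in wsp (- a) ->
  lie x y = theta (cx a) -> z \in wsp a -> exists k, z = k *: x.
Proof.
move=> aP xa ya xy za.
have [k zy] := lie_opposite aP za ya; exists k; apply/eqP; rewrite -subr_eq0.
have wa : z - k *: x \in wsp a by rewrite memvB // memvZ.
have wy : lie y (z - k *: x) = 0.
  by rewrite lie_skew lieBl lieZl zy xy subrr oppr0.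
have xw : lie x (z - k *: x) = 0.
  apply: (@lie_nonroot a a) => //.
    apply: contra_eq_neq (Phi_norm2 SL aP) => E.
    rewrite {1}E chiN (Phi_norm2 SL) // eq_sym -subr_eq0 opprK.
    by rewrite -natrD natK0.
  by rewrite (Phi_norm2 SL) // -subr_eq0 opprK -(natrD _ 2 1) natK0.
have /wspP/(_ (cx a)) := wa; rewrite -xy lie_lie wy xw !lie0r subrr.
by rewrite (Phi_norm2 SL) // => /esym/eqP; rewrite scaler_eq0 natK0.
Qed.

Definition nondeg a : Prop :=
  exists x y, [/\ x \in wsp a, y \in wsp (- a) & lie x y = theta (cx a)].

Lemma degenerate a x y : a \in Phi -> ~ nondeg a -> x \in wsp a ->
  y \in wsp (- a) -> lie x y = 0.
Proof.
move=> aP na xa ya; have [k E] := lie_opposite aP xa ya.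
have [k0|k0] := eqVneq k 0; first by rewrite E k0 scale0r.
case: na; exists (k^-1 *: x), y; split=> //; first exact: memvZ.
by rewrite lieZl E scalerA mulVf // scale1r.
Qed.

Lemma memv_full_ind (P : L -> Prop) : P 0 -> (forall x y, P x -> P y -> P (x + y)) ->
  (forall c, P (theta c)) -> (forall a x, a \in Phi -> x \in wsp a -> P x) ->
  forall x, P x.
Proof.
move=> P0 PD Pt Pw x; have := memvf x; rewrite -(wsp_full RD).
case/(memv_sum_seqP uniq_weights) => X Xw ->; rewrite big_cons; apply: (PD).
  by have [c ->] := wsp0E (Xw 0).
rewrite big_seq; apply: (big_ind P) => // a aP; exact: (Pw a _ aP (Xw a)).
Qed.

(** The degenerate root spaces, those with [L_b, L_-b] = 0, span an ideal: if
    [x, y] is a nonzero vector of a nondegenerate L_(g+b), with y in a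
    degenerate L_b and x in L_g, choose f such that [[x, y], f] is a nonzero
    multiple of theta(g + b); expanding it, one term lies in [L_b, L_-b] = 0 and
    the other in the line of theta(g), which does not contain theta(g + b).  As
    L is simple and this ideal misses the Cartan subalgebra, no root is
    degenerate. *)
Lemma all_nondeg a : a \in Phi -> nondeg a.
Proof.
move=> aP; apply: contrapT => na.
pose D := [seq b <- Phi | ~~ `[< nondeg b >]].
have DP b : b \in D <-> b \in Phi /\ ~ nondeg b.
  by rewrite mem_filter; split=> [/andP[/asboolPn]|[bP /asboolPn ->]].
pose J := (\sum_(b <- D) wsp b)%VS.
have JD b x : b \in Phi -> ~ nondeg b -> x \in wsp b -> x \in J.
  move=> bP nb xb; have bD : b \in D by apply/DP.
  by apply: (subvP (sumv_seq_sup _ bD)).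
have uD : uniq D by rewrite filter_uniq // (Phi_uniq SL).
have idl x y : y \in J -> lie x y \in J.
  case/(memv_sum_seqP uD) => Y Yw ->; rewrite lie_sumr big_seq.
  apply: (big_ind (fun v => v \in J)) => [|u v|b /DP[bP nb]].
  - exact: mem0v.
  - exact: memvD.
  move: (Y b) (Yw b) => {Y Yw}y yb.
  move: x; apply: memv_full_ind => [|u v uJ vJ|c|g x gP xg].
  - by rewrite lie0l mem0v.
  - by rewrite lieDl1 memvD.
  - by have /wspP -> := yb; rewrite memvZ // (JD b).
  have [E|gb] := eqVneq g (- b).
    by rewrite lie_skew (degenerate bP nb yb) ?oppr0 ?mem0v // -E.
  have zw := lie_wsp xg yb; have [->|z0] := eqVneq (lie x y) 0; first exact: mem0v.
  have sP : g + b \in Phi.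
    have : g + b \in 0 :: Phi.
      by apply: contraNT z0 => /(wsp_nonroot RD) E; move: zw; rewrite E memv0.
    by rewrite inE addr_eq0 (negPf gb).
  case: (pselect (nondeg (g + b))) => [|ns]; last exact: JD zw.
  case=> e [f [eg fg ef]]; exfalso.
  have [k zE] := wsp_line_of sP eg fg ef zw.
  have k0 : k != 0 by apply: contraNneq z0 => k0; rewrite zE k0 scale0r.
  have xf : lie y (lie x f) = 0.
    apply: (degenerate bP nb yb).
    by have := lie_wsp xg fg; rewrite opprD addNKr.
  have [l E] : exists l, lie x (lie y f) = l *: theta (cx g).
    apply: lie_opposite => //.
    by have := lie_wsp yb fg; rewrite opprD addrCA subrr addr0.
  have := lie_lie x y f; rewrite xf subr0 E zE lieZl ef => H.
  move/eqP: k0; apply; apply: (theta_cx_indep sP gP _ _ H).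
    by rewrite eq_sym -subr_eq0 addrC addKr Phi_nz.
  apply/eqP => E1; have := Phi_norm2 SL bP.
  have -> : b = - (g + g).
    by apply/eqP; rewrite -addr_eq0 addrA (addrC b) {2}E1 subrr.
  rewrite chi_cxN chiN opprK normD (Phi_norm2 SL) // => /eqP.
  by rewrite -subr_eq0 -!natrD -natrM -natrD -natrB // natK0.
have [J0|Jf] := ideals RD idl.
  have := wsp_root RD aP; apply/negP; rewrite negbK -subv0 -J0.
  by apply: sumv_seq_sup; apply/DP.
have : theta (cx a) \in J by rewrite Jf memvf.
case/(memv_sum_seqP uD) => Y Yw E.
pose X b := if b == 0 then theta (cx a) else - Y b.
have uD0 : uniq (0 :: D).
  by rewrite /= uD andbT; apply/negP => /DP[/Phi_nz]; rewrite eqxx.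
have Xw b : b \in 0 :: D -> X b \in wsp b.
  move=> _; rewrite /X; case: eqP => [->|_]; first exact: theta_wsp0.
  by rewrite memvN.
have X0 : \sum_(b <- 0 :: D) X b = 0.
  rewrite big_cons {1}/X eqxx E -big_split big1_seq //= => b /DP[/Phi_nz bn _].
  by rewrite /X (negPf bn) subrr.
have := wsp_sum0 uD0 Xw X0 (mem_head _ _).
by rewrite /X eqxx => /(theta_inj RD)/eqP; rewrite cx_eq0.
Qed.

Lemma coroot a x : a \in Phi -> x \in wsp a -> x != 0 ->
  exists2 y, y \in wsp (- a) & lie x y = theta (cx a).
Proof.
move=> aP xa x0; have [e [f [ea fa ef]]] := all_nondeg aP.
have [k xE] := wsp_line_of aP ea fa ef xa.
have k0 : k != 0 by apply: contraNneq x0 => k0; rewrite xE k0 scale0r.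
exists (k^-1 *: f); first exact: memvZ.
by rewrite xE lieZl lieZr scalerA mulfV // scale1r.
Qed.

Lemma wsp_mult a x z : a \in Phi -> x \in wsp a -> x != 0 -> z \in wsp a ->
  exists k, z = k *: x.
Proof.
move=> aP xa x0 za; have [y ya xy] := coroot aP xa x0.
exact: wsp_line_of aP xa ya xy za.
Qed.

Lemma lie_root_neq0 a b x y : a \in Phi -> b \in Phi -> <<a, cx b>> = -1 ->
  x \in wsp a -> x != 0 -> y \in wsp b -> y != 0 -> lie x y != 0.
Proof.
move=> aP bP ab xa x0 yb y0; have [f fa xf] := coroot aP xa x0.
apply: contraNneq y0 => xy.
have : lie f (lie x y) = y.
  rewrite lie_deriv (lie_skew f x) xf lieNl; move/wspP: (yb) => ->.
  rewrite (chiC SL) ab (@lie_nonroot (- a) b f y) ?lie0r ?addr0 //.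
  - by rewrite scaleN1r opprK.
  - exact: (Phi_oppr SL).
  - rewrite opprK; apply: contra_eq_neq ab => ->; rewrite (Phi_norm2 SL) //.
    by rewrite -subr_eq0 opprK -(natrD _ 2 1) natK0.
  - by rewrite chiN ab opprK -subr_eq0 opprK -(natrD _ 1 1) natK0.
by rewrite xy lie0r => ->.
Qed.

(** ** Subspaces spanned by part of the Cartan subalgebra and root spaces *)

Implicit Types (S T : {vspace V}) (A B : seq Q).

Definition gr (S : {vspace V}) (A : seq Q) : {vspace L} :=
  (theta @: S + \sum_(a <- A) wsp a)%VS.

Lemma theta_gr S A c : c \in S -> theta c \in gr S A.
Proof. by move=> cS; rewrite (subvP (addvSl _ _)) // memv_img. Qed.

Lemma wsp_gr S A a : a \in A -> (wsp a <= gr S A)%VS.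
Proof.
by move=> aA; apply: subv_trans (addvSr _ _); apply: sumv_seq_sup.
Qed.

Lemma gr_subP S A (U : {vspace L}) : (forall c, c \in S -> theta c \in U) ->
  (forall a, a \in A -> (wsp a <= U)%VS) -> (gr S A <= U)%VS.
Proof.
move=> SU AU; rewrite subv_add subv_sum_seq // andbT.
by apply/subvP => x /memv_imgP[c cS ->]; apply: SU.
Qed.

Lemma grP S A x : uniq A -> x \in gr S A ->
  exists c (X : Q -> L), [/\ c \in S, forall a, X a \in wsp a &
    x = theta c + \sum_(a <- A) X a].
Proof.
move=> uA /memv_addP[t /memv_imgP[c cS ->] [y /(memv_sum_seqP uA)[X Xw ->] ->]].
by exists c, X.
Qed.

Lemma gr_ind (P : L -> Prop) S A : uniq A -> P 0 ->
  (forall x y, P x -> P y -> P (x + y)) ->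
  (forall c, c \in S -> P (theta c)) ->
  (forall a x, a \in A -> x \in wsp a -> P x) ->
  forall x, x \in gr S A -> P x.
Proof.
move=> uA P0 PD Pt Pw x /(grP uA)[c [X [cS Xw ->]]]; apply: (PD).
  exact: (Pt).
rewrite big_seq; apply: (big_ind P) => // a aP; exact: (Pw a _ aP (Xw a)).
Qed.

Lemma gr_full : gr fullv Phi = fullv.
Proof.
apply/eqP; rewrite eqEsubv subvf /=; apply/subvP => x _.
move: x; apply: memv_full_ind => [|x y|c|a x aP xa].
- exact: mem0v.
- exact: memvD.
- by rewrite theta_gr ?memvf.
- exact: (subvP (wsp_gr _ aP)).
Qed.

Lemma gr_add S T A B : (gr S A + gr T B = gr (S + T) (A ++ B))%VS.
Proof.
rewrite /gr limgD big_cat /= -!addvA; congr (_ + _)%VS.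
by rewrite addvA [(_ + theta @: T)%VS]addvC -addvA.
Qed.

Lemma gr_perm S A B : perm_eq A B -> gr S A = gr S B.
Proof. by move=> AB; rewrite /gr (perm_big _ AB). Qed.

(* Elements of different weights are independent. *)
Lemma gr_cap S T A B : uniq (A ++ B) -> {subset A ++ B <= Phi} ->
  (S :&: T = 0)%VS -> (gr S A :&: gr T B = 0)%VS.
Proof.
rewrite cat_uniq => /and3P[uA dAB uB] ABP ST; apply/eqP; rewrite -subv0.
have AP a : a \in A -> a \in Phi by move=> aA; rewrite ABP // mem_cat aA.
have BP a : a \in B -> a \in Phi by move=> aB; rewrite ABP // mem_cat aB orbT.
apply/subvP => x /memv_capP[/(grP uA)[c [X [cS Xw xE]]]].
move=> /(grP uB)[d [Y [dT Yw xF]]].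
pose Z a := if a == 0 then theta (c - d) else if a \in A then X a else - Y a.
have nz a : a \in A ++ B -> (a == 0) = false.
  by move/ABP/Phi_nz/negPf.
have uZ : uniq (0 :: A ++ B).
  rewrite /= cat_uniq uA dAB uB !andbT; apply/negP => /nz; by rewrite eqxx.
have Zw a : a \in 0 :: A ++ B -> Z a \in wsp a.
  move=> _; rewrite /Z; case: eqP => [->|_]; first exact: theta_wsp0.
  by case: ifP; rewrite ?memvN.
have Z0 : \sum_(a <- 0 :: A ++ B) Z a = 0.
  rewrite big_cons {1}/Z eqxx big_cat /=.
  have -> : \sum_(a <- A) Z a = \sum_(a <- A) X a.
    by apply: eq_big_seq => a aA; rewrite /Z nz ?mem_cat ?aA.
  have -> : \sum_(a <- B) Z a = - \sum_(a <- B) Y a.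
    rewrite -sumrN; apply: eq_big_seq => a aB; rewrite /Z nz ?mem_cat ?aB ?orbT //.
    by rewrite (negPf (hasPn dAB _ aB)).
  by rewrite linearB addrACA -xE -opprD -xF subrr.
have cd : c = d.
  have := wsp_sum0 uZ Zw Z0 (mem_head _ _); rewrite /Z eqxx => /(theta_inj RD).
  by move/eqP; rewrite subr_eq0 => /eqP.
have c0 : c = 0.
  by apply/eqP; rewrite -memv0 -ST; apply/memv_capP; rewrite {2}cd.
rewrite xE c0 linear0 add0r big1_seq ?mem0v // => a /andP[_ aA].
have aAB : a \in 0 :: A ++ B by rewrite inE mem_cat aA orbT.
by have := wsp_sum0 uZ Zw Z0 aAB; rewrite /Z nz ?mem_cat ?aA.
Qed.

Definition spn (P : seq Q) : {vspace V} := <<[seq cx a | a <- P]>>%VS.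

Lemma spn_mem (P : seq Q) a : a \in P -> cx a \in spn P.
Proof. by move=> aP; rewrite memv_span // map_f. Qed.

Record closed_subsystem (P : seq Q) : Prop := ClosedSubsystem {
  cl_uniq : uniq P;
  cl_sub : {subset P <= Phi};
  cl_opp : forall a, a \in P -> - a \in P;
  cl_add : forall a b, a \in P -> b \in P -> a + b \in Phi -> a + b \in P }.

Lemma lie_nonroot2 a b x y : a \in Phi -> b \in Phi -> x \in wsp a ->
  y \in wsp b -> b != - a -> a + b \notin Phi -> lie x y = 0.
Proof.
move=> aP bP xa yb ba abP; apply/eqP; rewrite -memv0 -(@wsp_nonroot RD (a + b)).
  exact: lie_wsp.
by rewrite inE negb_or abP andbT addrC addr_eq0.
Qed.

(** ** Families of root vectors *)

Lemma weight_split_fam (I : finType) (S : {vspace V}) (J : {vspace L})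
    (m : I -> Q) (X : I -> L) :
  (forall c x, c \in S -> x \in J -> lie (theta c) x \in J) ->
  injective m ->
  (forall i j, i != j -> exists2 c, c \in S & <<m i, c>> != <<m j, c>>) ->
  (forall i, X i \in wsp (m i)) -> \sum_i X i \in J -> forall i, X i \in J.
Proof.
move=> stab minj sep Xw XJ i.
pose Y a := \sum_(j | m j == a) X j.
have YE j : Y (m j) = X j.
  rewrite /Y (eq_bigl (pred1 j)) ?big_pred1_eq // => k.
  exact: inj_eq.
have sumE : \sum_(a <- [seq m j | j <- index_enum I]) Y a = \sum_j X j.
  by rewrite big_map; apply: eq_bigr => j _; rewrite YE.
rewrite -YE; apply: (@weight_split S J [seq m j | j <- index_enum I] Y) => //.
- by rewrite map_inj_uniq // index_enum_uniq.
- move=> _ _ /mapP[j _ ->] /mapP[k _ ->] jk; apply: sep.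
  by apply: contraNneq jk => ->.
- by move=> _ /mapP[j _ ->]; rewrite YE.
- by rewrite sumE.
- by rewrite map_f // mem_index_enum.
Qed.

Definition root_family n (m : 'I_n -> Q) (w : 'I_n -> L) : Prop :=
  [/\ injective m, forall i, m i \in Phi, forall i, w i \in wsp (m i) &
      forall i, w i != 0].

Lemma family_indep n (m : 'I_n -> Q) w : root_family m w -> independent w.
Proof.
case=> minj mP wm w0 k E i.
have /eqP : k i *: w i = 0.
  apply/eqP; rewrite -memv0.
  apply: (@weight_split_fam _ fullv 0%VS m (fun i => k i *: w i)) => //.
  - by move=> c x _; rewrite !memv0 => /eqP->; rewrite lie0r.
  - by move=> a b ab; have [|c] := @weights_sep (m a) (m b);
      [rewrite (inj_eq minj) | exists c; rewrite ?memvf].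
  - by move=> j; rewrite memvZ.
  - by rewrite E mem0v.
by rewrite scaler_eq0 (negPf (w0 i)) orbF => /eqP.
Qed.

Lemma family_span n (m : 'I_n -> Q) w A : root_family m w ->
  (forall a, a \in A <-> exists i, a = m i) ->
  (\sum_i <[w i]>)%VS = gr 0%VS A.
Proof.
case=> minj mP wm w0 AE; apply/eqP; rewrite eqEsubv; apply/andP; split.
  apply/subv_sumP => i _; rewrite -memvE; apply: (subvP (wsp_gr _ _)) (wm i).
  by apply/AE; exists i.
apply: gr_subP => [c|a /AE[i ->]].
  by rewrite memv0 => /eqP->; rewrite linear0 mem0v.
apply/subvP => x xm; have [k ->] := wsp_mult (mP i) (wm i) (w0 i) xm.
by rewrite memvZ // memvE (sumv_sup i).
Qed.

Lemma acts_theta n (m : 'I_n -> Q) w c : root_family m w ->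
  acts w (theta c) (diag_mx (\row_i <<m i, c>>)).
Proof.
case=> minj mP wm w0 j; have /wspP -> := wm j.
rewrite (bigD1 j) //= big1 ?addr0 => [|i ij]; first by rewrite !mxE eqxx mulr1n.
by rewrite !mxE (negPf ij) mulr0n scale0r.
Qed.

(** The roots m_i are the weights of a module spanned by root spaces for the
    subalgebra with roots P: adding a root of P to a weight never gives 0, and
    gives another weight whenever it gives a root. *)
Definition module_family (P : seq Q) n (m : 'I_n -> Q) : Prop :=
  (forall e i, e \in P -> m i != - e) /\
  (forall e i, e \in P -> m i + e \in Phi -> exists k, m k = m i + e).

Lemma lie_family P n (m : 'I_n -> Q) w e x i : {subset P <= Phi} ->
  root_family m w -> module_family P m -> e \in P -> x \in wsp e ->
  (exists k t, m k = m i + e /\ lie x (w i) = t *: w k) \/ lie x (w i) = 0.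
Proof.
move=> PP [minj mP wm w0] [mo ma] eP xe.
have [mieP|nm] := boolP (m i + e \in Phi); last first.
  right; apply: (@lie_nonroot2 e (m i)) => //; [exact: PP|exact: mo|].
  by rewrite addrC.
have [k mk] := ma _ _ eP mieP; left; exists k.
have xw : lie x (w i) \in wsp (m k) by rewrite mk addrC lie_wsp.
by have [t ->] := wsp_mult (mP k) (wm k) (w0 k) xw; exists t.
Qed.

Lemma family_acts P S n (m : 'I_n -> Q) w x : uniq P -> {subset P <= Phi} ->
  root_family m w -> module_family P m -> x \in gr S P -> acts w x (adm w x).
Proof.
move=> uP PP wf mf xg; apply: adm_acts => j; move: x xg.
apply: (gr_ind uP) => [|x y xw yw|c cS|e x eP xe].
- by rewrite lie0l mem0v.
- by rewrite lieDl1 memvD.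
- by case: wf => _ _ wm _; have /wspP -> := wm j; rewrite memvZ // memvE (sumv_sup j).
- have [[k [t [_ ->]]]|->] := lie_family j PP wf mf eP xe; last exact: mem0v.
  by rewrite memvZ // memvE (sumv_sup k).
Qed.

Lemma acts_entry P n (m : 'I_n -> Q) w e x M k i : {subset P <= Phi} ->
  root_family m w -> module_family P m -> e \in P -> x \in wsp e ->
  acts w x M -> m k != m i + e -> M k i = 0.
Proof.
move=> PP wf mf eP xe xM mk; have := lie_family i PP wf mf eP xe; rewrite xM.
case=> [[l [t [ml E]]]|/(family_indep wf)/(_ k) //].
have kl : k != l by apply: contraNneq mk => ->; rewrite ml.
have : \sum_j (M j i - (if j == l then t else 0)) *: w j = 0.
  rewrite (eq_bigr (fun j => M j i *: w j - (if j == l then t else 0) *: w j)).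
    rewrite sumrB E (bigD1 l) //= eqxx big1 ?addr0 ?subrr // => j jl.
    by rewrite (negPf jl) scale0r.
  by move=> j _; rewrite scalerBl.
by move/(family_indep wf)/(_ k); rewrite (negPf kl) subr0.
Qed.

(** The dual family: root vectors for the opposite roots, normalized by
    [w_i, w'_i] = theta(m_i). *)
Definition dual_family n (m : 'I_n -> Q) (w w' : 'I_n -> L) : Prop :=
  root_family (fun i => - m i) w' /\
  forall i, lie (w i) (w' i) = theta (cx (m i)).

Lemma dual_family_exists n (m : 'I_n -> Q) w : root_family m w ->
  exists w', dual_family m w w'.
Proof.
case=> minj mP wm w0.
have /choice[w' w'P] : forall i, exists y, y \in wsp (- m i) /\
    lie (w i) y = theta (cx (m i)).
  by move=> i; have [y ya yE] := coroot (mP i) (wm i) (w0 i); exists y.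
exists w'; split; last by move=> i; case: (w'P i).
split=> [i j /oppr_inj/minj //|i|i|i].
- exact: (Phi_oppr SL).
- by case: (w'P i).
- apply/eqP => E; case: (w'P i) => _; rewrite E lie0r => /esym/eqP.
  by rewrite theta_eq0 cx_eq0.
Qed.

(** Expanding [x, [w_i, w'_k]] by the Jacobi identity gives
    s theta(m_k) + s' theta(m_i); but [w_i, w'_k] is a root vector for
    m_i - m_k = - e, so that the result is a multiple of
    theta(e) = theta(m_k) - theta(m_i).  Hence s' = - s. *)
Lemma dual_coef n (m : 'I_n -> Q) w w' e x i k s : e \in Phi ->
  root_family m w -> dual_family m w w' -> x \in wsp e -> m k = m i + e ->
  lie x (w i) = s *: w k -> lie x (w' k) = - s *: w' i.
Proof.
move=> eP [minj mP wm w0] [[_ mP' wm' w0'] ww'] xe mk xi.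
have xk : lie x (w' k) \in wsp (- m i).
  by have := lie_wsp xe (wm' k); rewrite mk opprD addrCA addrN addr0.
have [s' xkE] := wsp_mult (mP' i) (wm' i) (w0' i) xk.
have ike : lie (w i) (w' k) \in wsp (- e).
  by have := lie_wsp (wm i) (wm' k); rewrite mk opprD addNKr.
have [l lE] := lie_opposite eP xe ike.
have := lie_deriv x (w i) (w' k).
rewrite xi xkE lE lieZl lieZr !ww' mk (cxD SL) linearD /= scalerDr.
move=> E.
have eqE : (l - s) *: theta (cx e) = (s + s') *: theta (cx (m i)).
  by rewrite scalerBl E addrAC addrK scalerDl.
have emi : <<e, cx (m i)>> = -1.
  have [|H|//] := @Phi_addE e (m i) eP (mP i).
    by rewrite addrC -mk inE mP orbT.
  by have := Phi_nz (mP k); rewrite mk H addNr eqxx.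
have ls : l - s = 0.
  apply: (theta_cx_indep eP (mP i) _ _ eqE); apply: contra_eq_neq emi => ->;
    rewrite ?chi_cxN (Phi_norm2 SL) //.
    by rewrite -subr_eq0 opprK -(natrD _ 2 1) natK0.
  by rewrite eqr_opp -subr_eq0 -[2]/(1 + 1) addrK oner_eq0.
have ss' : s + s' = 0.
  move/esym/eqP: eqE; rewrite ls scale0r scaler_eq0 theta_eq0 cx_eq0 // orbF.
  by move/eqP.
by congr (_ *: _); apply/eqP; rewrite -addr_eq0 addrC ss'.
Qed.

Lemma dual_acts P S n (m : 'I_n -> Q) w w' x M : uniq P -> {subset P <= Phi} ->
  (forall a, a \in P -> - a \in P) ->
  root_family m w -> dual_family m w w' -> module_family P m ->
  x \in gr S P -> acts w x M -> acts w' x (- M^T).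
Proof.
move=> uP PP oP wf wd mf xg; have wfree := family_indep wf.
suff [N [xN xN']] : exists N, acts w x N /\ acts w' x (- N^T).
  by move=> xM; rewrite (acts_uniq wfree xM xN).
move: x xg; apply: (gr_ind uP) => [|x y [N [xN xN']] [N1 [yN yN']]|c cS|e x eP xe].
- exists 0; split=> j; rewrite lie0l big1 // => i _; rewrite !mxE ?oppr0;
    by rewrite scale0r.
- exists (N + N1); split; first exact: acts_add.
  by rewrite raddfD /= opprD; apply: acts_add.
- exists (diag_mx (\row_i <<m i, c>>)); split; first exact: acts_theta.
  have := acts_theta c wd.1; rewrite tr_diag_mx.
  suff -> : diag_mx (\row_i <<- m i, c>>) = - diag_mx (\row_i <<m i, c>>) by [].
  by apply/matrixP => i j; rewrite !mxE chiN mulNrn.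
exists (adm w x).
have xM : acts w x (adm w x).
  exact: family_acts uP PP wf mf (subvP (wsp_gr fullv eP) _ xe).
split=> // k.
have entry i : m k != m i + e -> adm w x k i = 0.
  exact: acts_entry PP wf mf eP xe xM.
have zero i : m k != m i + e -> (- (adm w x)^T) i k *: w' i = 0.
  by move/entry => E; rewrite !mxE in E *; rewrite E oppr0 scale0r.
have [[i mk]|nk] := pselect (exists i, m k = m i + e); last first.
  rewrite big1 => [|i _]; last by apply: zero; apply/eqP => E; case: nk; exists i.
  case: wd => -[_ mP' wm' _] _; case: wf => _ mP _ _; case: mf => mo ma.
  apply: (@lie_nonroot2 e (- m k)) => //; first exact: PP.
    by rewrite eqr_opp; have := mo _ k (oP _ eP); rewrite opprK.
  apply/negP => /(Phi_oppr SL); rewrite opprD opprK addrC => H.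
  have [i mi] := ma _ _ (oP _ eP) H; case: nk; exists i.
  by rewrite mi subrK.
have minj : injective m by case: wf.
rewrite (bigD1 i) //= big1 ?addr0 => [|j ji]; last first.
  apply: zero; rewrite mk; apply: contraNneq ji => /addIr/minj ->; exact: eqxx.
have xi : lie x (w i) = adm w x k i *: w k.
  rewrite xM (bigD1 k) //= big1 ?addr0 // => j jk.
  rewrite (acts_entry PP wf mf eP xe xM) ?scale0r // -mk.
  by apply: contraNneq jk => /minj ->.
rewrite (dual_coef (PP _ eP) wf wd xe mk xi); congr (_ *: _).
by rewrite [RHS]mxE [in RHS]mxE.
Qed.

(** ** The subalgebra of a closed subsystem *)

Section ClosedSubsystem.
Variable P : seq Q.
Hypothesis CP : closed_subsystem P.
Local Notation g := (gr (spn P) P).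
Local Notation h := (theta @: spn P)%VS.

Let PP a : a \in P -> a \in Phi. Proof. exact: cl_sub CP a. Qed.

Lemma theta_g a : a \in P -> theta (cx a) \in g.
Proof. by move=> aP; rewrite theta_gr ?spn_mem. Qed.

Lemma gr_subalgebra : subalgebra g.
Proof.
have uP := cl_uniq CP.
move=> x y xg yg; move: x xg y yg.
apply: (gr_ind uP) => [y yg|x1 x2 H1 H2 y yg|c cS|a x aP xa].
- by rewrite lie0l mem0v.
- by rewrite lieDl1 memvD ?H1 ?H2.
- apply: (gr_ind uP) => [|y1 y2 H1 H2|d|b y bP yb].
  + by rewrite lie0r mem0v.
  + by rewrite lieDr1 memvD.
  + by rewrite (theta_abelian RD) mem0v.
  + by move/wspP: (yb) => ->; rewrite memvZ // (subvP (wsp_gr _ bP)).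
- apply: (gr_ind uP) => [|y1 y2 H1 H2|d dS|b y bP yb].
  + by rewrite lie0r mem0v.
  + by rewrite lieDr1 memvD.
  + by rewrite (lie_theta_r _ xa) memvZ // (subvP (wsp_gr _ aP)).
  + have [E|ba] := eqVneq b (- a).
      have [k ->] : exists k, lie x y = k *: theta (cx a).
        by apply: lie_opposite; rewrite ?PP // -E.
      by rewrite memvZ // theta_g.
    have [abP|abP] := boolP (a + b \in Phi).
      by rewrite (subvP (wsp_gr _ (cl_add CP aP bP abP))) // lie_wsp.
    by rewrite (@lie_nonroot2 a b x y) ?mem0v //; exact: PP.
Qed.

(** The coroots are brackets of opposite root vectors. *)
Lemma gr_generated :
  generated_subalgebra [set x | exists2 a, a \in P & x \in wsp a] g.
Proof.
split=> [|x [a aP xa]|g' sg' g'P]; first exact: gr_subalgebra.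
  exact: (subvP (wsp_gr _ aP)).
apply: gr_subP => [|a aP]; last by apply/subvP => x xa; apply: g'P; exists a.
suff sub : (spn P <= theta @^-1: g')%VS.
  by move=> c /(subvP sub); rewrite memv_preim.
apply/span_subvP => _ /mapP[a aP ->]; rewrite -memv_preim.
have [x xa x0] := wsp_nz (PP aP); have [y ya <-] := coroot (PP aP) xa x0.
by apply: sg'; apply: g'P; [exists a | exists (- a) => //; apply: cl_opp].
Qed.

Definition lam_of a : 'Hom(L, K^o) := (chi a \o theta^-1)%VF.

Lemma theta_lker : lker theta == 0%VS.
Proof.
by rewrite -subv0; apply/subvP => c; rewrite memv_ker theta_eq0 memv0.
Qed.

Lemma lam_ofE a c : lam_of a (theta c) = <<a, c>>.
Proof. by rewrite comp_lfunE lker0_lfunK // theta_lker. Qed.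

Lemma root_space_lam a x : x \in wsp a -> x \in g -> root_space g h (lam_of a) x.
Proof.
move=> /wspP xa xg; split=> // _ /memv_imgP[c _ ->].
by rewrite lam_ofE xa.
Qed.

Lemma weights_sep_in a b : a \in 0 :: P -> b \in 0 :: P -> a != b ->
  exists2 c, c \in spn P & <<a, c>> != <<b, c>>.
Proof.
have mem e : e \in 0 :: P -> cx e \in spn P.
  by rewrite inE => /orP[/eqP->|/spn_mem //]; rewrite cx0 mem0v.
move=> aP bP ab; exists (cx (a - b)); first by rewrite cxB memvB ?mem.
rewrite -subr_eq0 -chiB.
by apply: contra_neq ab => /(chi_def SL)/eqP; rewrite subr_eq0 => /eqP.
Qed.

Lemma uniq_0P : uniq (0 :: P).
Proof.
by rewrite /= (cl_uniq CP) andbT; apply/negP => /PP/Phi_nz; rewrite eqxx.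
Qed.

Lemma gr_components x : x \in g -> exists c (X : Q -> L),
  [/\ c \in spn P, X 0 = theta c, forall a, a \in 0 :: P -> X a \in wsp a &
      x = \sum_(a <- 0 :: P) X a].
Proof.
case/(grP (cl_uniq CP)) => c [X [cS Xw ->]].
exists c, (fun a => if a == 0 then theta c else X a); split=> //.
- by rewrite eqxx.
- by move=> a _; case: eqP => [->|_]; rewrite ?theta_wsp0.
rewrite big_cons eqxx; congr (_ + _); apply: eq_big_seq => a /PP/Phi_nz.
by move/negPf->.
Qed.

Lemma root_space_component lam x : root_space g h lam x -> x != 0 ->
  exists2 a, a \in 0 :: P & forall c, c \in spn P -> (lam (theta c) : K) = <<a, c>>.
Proof.
case=> xg xl x0; have [c [X [cS X0 Xw xE]]] := gr_components xg.
have [a aP Xa] : exists2 a, a \in 0 :: P & X a != 0.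
  apply/hasP; rewrite -[has _ _]negbK -all_predC; apply: contraNN x0 => /allP H.
  by rewrite xE big1_seq // => a /andP[_ /H/negPn/eqP].
exists a => // d dS; have := xl _ (memv_img theta dS).
rewrite xE lie_sumr => /eqP; rewrite scaler_sumr -subr_eq0 -sumrB => /eqP E.
have Yw b : b \in 0 :: P -> lie (theta d) (X b) - (lam (theta d) : K) *: X b \in wsp b.
  by move=> bP; have /wspP -> := Xw _ bP; rewrite memvB // memvZ // Xw.
have := wsp_sum0 uniq_0P Yw E aP; have /wspP -> := Xw _ aP.
move/eqP; rewrite -scalerBl scaler_eq0 (negPf Xa) orbF subr_eq0.
by move/eqP.
Qed.

Lemma is_rootP (lam : 'Hom(L, K^o)) : is_root g h lam <->
  exists2 a, a \in P & forall c, c \in spn P -> (lam (theta c) : K) = <<a, c>>.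
Proof.
split=> [[[_ /memv_imgP[d dS ->] ld] [x x0 xl]]|[a aP lamE]].
  have [a aP aE] := root_space_component xl x0; exists a => //.
  move: aP; rewrite inE => /orP[/eqP a0|//]; move: ld.
  by rewrite aE // a0 chi0 eqxx.
split.
  exists (theta (cx a)); first by rewrite memv_img ?spn_mem.
  by rewrite lamE ?spn_mem // (Phi_norm2 SL) ?PP // natK0.
have [x xa x0] := wsp_nz (PP aP); exists x => //; split.
  exact: (subvP (wsp_gr _ aP)).
by move=> _ /memv_imgP[c cS ->]; rewrite lamE //; move/wspP: xa => ->.
Qed.

Lemma gr_cartan : cartan_subalgebra g h.
Proof.
split=> [|_ _ /memv_imgP[c _ ->] /memv_imgP[d _ ->]|x xg xh|x xg].
- exact: addvSl.
- exact: (theta_abelian RD).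
- have [c [X [cS X0 Xw xE]]] := gr_components xg.
  have XP a : a \in P -> X a = 0.
    move=> aP; have a0P : a \in 0 :: P by rewrite inE aP orbT.
    have := xh _ (memv_img theta (spn_mem aP)); rewrite xE lie_sumr => E.
    have Yw b : b \in 0 :: P -> lie (theta (cx a)) (X b) \in wsp b.
      by move=> bP; have /wspP -> := Xw _ bP; rewrite memvZ // Xw.
    have := wsp_sum0 uniq_0P Yw E a0P; have /wspP -> := Xw _ a0P.
    by rewrite (Phi_norm2 SL) ?PP // => /eqP; rewrite scaler_eq0 natK0 => /eqP.
  by rewrite xE big_cons X0 big1_seq ?addr0 ?memv_img // => a /andP[_ /XP].
- have [c [X [cS X0 Xw xE]]] := gr_components xg.
  exists [seq X a | a <- 0 :: P].
    move=> _ /mapP[a aP ->]; exists (lam_of a); apply: root_space_lam.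
      exact: Xw.
    move: aP; rewrite inE => /orP[/eqP->|aP].
      by rewrite X0 theta_gr.
    by rewrite (subvP (wsp_gr _ aP)) // Xw // inE aP orbT.
  rewrite xE big_seq memv_suml // => a aP; apply: memv_span; exact: map_f.
Qed.

(** Root vectors for b - a map the line of weight a onto the line of weight b. *)
Lemma wsp_step (Z : L -> Prop) a b :
  (forall k x, Z x -> Z (k *: x)) ->
  (forall e y x, e \in P -> y \in wsp e -> Z x -> Z (lie y x)) ->
  a \in Phi -> b \in Phi -> b - a \in 0 :: P ->
  (forall x, x \in wsp a -> Z x) -> forall x, x \in wsp b -> Z x.
Proof.
move=> Zs Zl aP bP; rewrite inE subr_eq0 => /orP[/eqP-> //|eP] Za x xb.
have [u ua u0] := wsp_nz aP; have [y ye y0] := wsp_nz (PP eP).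
have bE : b = (b - a) + a by rewrite subrK.
have yub : lie y u \in wsp b by rewrite bE lie_wsp.
have yu0 : lie y u != 0.
  apply: (@lie_root_neq0 (b - a) a) => //; first exact: PP.
  have [|E|//] := @Phi_addE (b - a) a (PP eP) aP.
    by rewrite subrK inE bP orbT.
  by have := Phi_nz bP; rewrite bE {2}E addrN eqxx.
have [k ->] := wsp_mult bP yub yu0 xb.
by apply: Zs; apply: (Zl (b - a)) => //; apply: Za.
Qed.

(** Joined by at most two steps along roots of P, through a member of A. *)
Definition linked (A : seq Q) (a b : Q) : Prop :=
  exists e, [/\ e \in A, e - a \in 0 :: P & b - e \in 0 :: P].

Lemma linkedC A a b : linked A a b -> linked A b a.
Proof.
have opp e : e \in 0 :: P -> - e \in 0 :: P.
  rewrite !inE oppr_eq0 => /orP[->//|/(cl_opp CP)->]; exact: orbT.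
by case=> e [eA H1 H2]; exists e; split; rewrite // -opprB opp.
Qed.

Lemma wsp_linked (Z : L -> Prop) A a b : {subset A <= Phi} ->
  (forall k x, Z x -> Z (k *: x)) ->
  (forall e y x, e \in P -> y \in wsp e -> Z x -> Z (lie y x)) ->
  a \in Phi -> b \in Phi -> linked A a b ->
  (forall x, x \in wsp a -> Z x) -> forall x, x \in wsp b -> Z x.
Proof.
move=> AP Zs Zl aP bP [e [/AP eP ae eb]] Za.
by apply: (wsp_step Zs Zl eP bP eb); apply: (wsp_step Zs Zl aP eP ae).
Qed.

(** g is simple when P is irreducible: an ideal J contains a root space,
    hence theta(a) for a root a, hence every root space not orthogonal to a,
    and so on. *)
Lemma gr_simple p0 : p0 \in P ->
  (forall a, a \in P -> exists e, [/\ e \in P, <<e, cx a>> != 0 & <<e, cx p0>> != 0]) ->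
  (forall c, c \in spn P -> (forall a, a \in P -> <<a, c>> = 0) -> c = 0) ->
  simple_lie g.
Proof.
move=> p0P conn nondg; split; first exact: gr_subalgebra.
  have [x xa x0] := wsp_nz (PP p0P).
  exists (theta (cx p0)), x; split; first exact: theta_g.
    exact: (subvP (wsp_gr _ p0P)).
  move/wspP: xa => ->.
  by rewrite (Phi_norm2 SL) ?PP // scaler_eq0 natK0.
move=> J Jg Ji; have [J0|/eqP J0] := eqVneq J 0%VS; [by left|right].
have tJ a : a \in P -> (wsp a <= J)%VS -> theta (cx a) \in J.
  move=> aP aJ; have [x xa x0] := wsp_nz (PP aP).
  have [y ya <-] := coroot (PP aP) xa x0.
  rewrite lie_skew memvN; apply: Ji; last exact: (subvP aJ).
  exact: (subvP (wsp_gr _ (cl_opp CP aP))).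
have spread c e : theta c \in J -> e \in P -> <<e, c>> != 0 -> (wsp e <= J)%VS.
  move=> cJ eP ec; apply/subvP => x xe.
  have := Ji _ _ (subvP (wsp_gr (spn P) eP) _ xe) cJ.
  rewrite (lie_theta_r _ xe) => /(memvZ (- <<e, c>>)^-1).
  by rewrite scalerA mulVf ?scale1r // oppr_eq0.
have [a aP aJ] : exists2 a, a \in P & (wsp a <= J)%VS.
  have x0 : vpick J != 0 by rewrite vpick0; apply/eqP.
  have xJ := memv_pick J; have xg := subvP Jg _ xJ.
  have [c [X [cS X0 Xw xE]]] := gr_components xg.
  have XJ a : a \in 0 :: P -> X a \in J.
    apply: (@weight_split (spn P) J _ X) => //; last by rewrite -xE.
    - move=> d y dS yJ; apply: Ji => //; exact: theta_gr.
    - exact: uniq_0P.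
    - exact: weights_sep_in.
  have [/hasP[a aP Xa]|/hasPn Xn] := boolP (has (fun a => X a != 0) P).
    have a0P : a \in 0 :: P by rewrite inE aP orbT.
    exists a => //; apply/subvP => y ya.
    by have [k ->] := wsp_mult (PP aP) (Xw _ a0P) Xa ya; rewrite memvZ ?XJ.
  have cJ : theta c \in J by rewrite -X0 XJ // mem_head.
  have c0 : c != 0.
    apply: contraNneq x0 => c0; rewrite xE big_cons X0 c0 linear0 add0r.
    by rewrite big1_seq // => a /andP[_ /Xn/negPn/eqP].
  have [a aP ac] : exists2 a, a \in P & <<a, c>> != 0.
    apply/hasP; rewrite -[has _ _]negbK -all_predC; apply: contraNN c0 => /allP H.
    by apply/eqP/nondg => // a /H/negPn/eqP.
  by exists a => //; apply: (spread c).
have p0J : (wsp p0 <= J)%VS.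
  have [e [eP ea ep]] := conn a aP.
  have eJ := spread _ _ (tJ _ aP aJ) eP ea.
  by apply: (spread _ _ (tJ _ eP eJ) p0P); rewrite (chiC SL).
have allJ b : b \in P -> (wsp b <= J)%VS.
  move=> bP; have [e [eP eb ep]] := conn b bP.
  have eJ := spread _ _ (tJ _ p0P p0J) eP ep.
  by apply: (spread _ _ (tJ _ eP eJ) bP); rewrite (chiC SL).
apply/eqP; rewrite eqEsubv Jg /=; apply: gr_subP => // c.
suff sub : (spn P <= theta @^-1: J)%VS.
  by move/(subvP sub); rewrite memv_preim.
apply/span_subvP => _ /mapP[b bP ->]; rewrite -memv_preim.
exact: tJ (allJ _ bP).
Qed.

(** ** Minuscule modules *)

Section Minuscule.
Variables (n : nat) (m : 'I_n -> Q) (w : 'I_n -> L) (rho : L -> 'M[K]_n).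
Hypotheses (wf : root_family m w) (mf : module_family P m).
Hypothesis rhoP : forall x, x \in g -> acts w x (rho x).
Hypothesis sep : forall i j, i != j ->
  exists2 c, c \in spn P & <<m i, c>> != <<m j, c>>.
Variable i0 : 'I_n.
Hypothesis link0 : forall i, linked [seq m i | i <- enum 'I_n] (m i) (m i0).

Lemma module_representation : representation g rho.
Proof. by apply: (acts_representation (family_indep wf)) => //; apply: gr_subalgebra. Qed.

(** A nonzero submodule contains a weight vector, as the weights are separated
    by the Cartan subalgebra; from it, root vectors of g lead to all others. *)
Lemma module_irreducible : irreducible_rep g rho.
Proof.
have [minj mP wm w0] := wf; have wfree := family_indep wf.
split; [exact: module_representation | exact: leq_ltn_trans (ltn_ord i0) | ].
move=> U st; have [U0|U0] := eqVneq U 0%VS; [by left|right].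
pose J := (lincombf w @: U)%VS.
have Jst x y : x \in g -> y \in J -> lie x y \in J.
  move=> xg /memv_imgP[u uU ->]; rewrite (acts_lincomb _ (rhoP xg)).
  by rewrite memv_img // st.
have uU := memv_pick U; set u := vpick U in uU.
have [i ui] : exists i, u i 0 != 0.
  apply/existsP; rewrite -[[exists _, _]]negbK negb_exists.
  apply: contraNN U0 => /forallP H; rewrite -vpick0; apply/eqP/colP => i.
  by rewrite mxE; have := H i; rewrite negbK => /eqP.
have splitJ : forall j, u j 0 *: w j \in J.
  apply: (@weight_split_fam _ (spn P) J m (fun j => u j 0 *: w j)) => //.
  - by move=> c x cS xJ; apply: Jst => //; apply: theta_gr.
  - by move=> j; rewrite memvZ.
  - by have := memv_img (lincombf w) uU; rewrite lfunE.
have iJ x : x \in wsp (m i) -> x \in J.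
  move=> xm; have := splitJ i => /(memvZ (u i 0)^-1).
  rewrite scalerA mulVf // scale1r => wJ.
  by have [k ->] := wsp_mult (mP i) (wm i) (w0 i) xm; rewrite memvZ.
have mem j : m j \in [seq m i | i <- enum 'I_n] by rewrite map_f ?mem_enum.
have sub : {subset [seq m i | i <- enum 'I_n] <= Phi}.
  by move=> _ /mapP[j _ ->].
have lin a b x : a \in Phi -> b \in Phi ->
    linked [seq m i | i <- enum 'I_n] a b ->
    (forall y, y \in wsp a -> y \in J) -> x \in wsp b -> x \in J.
  move=> aP bP ab aJ xb.
  apply: (@wsp_linked (fun x => x \in J) _ a b sub) => //.
  - by move=> k y yJ; rewrite memvZ.
  - by move=> e y z eP ye zJ; apply: Jst => //; exact: (subvP (wsp_gr _ eP)).
have jJ j : w j \in J.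
  apply: (lin (m i0) (m j)) => //; first exact/linkedC.
  by move=> x; apply: (lin (m i)).
apply/eqP; rewrite eqEsubv subvf /=; apply/subvP => v _.
have -> : v = \sum_j v j 0 *: delta_mx j 0.
  apply/colP => j; rewrite summxE (bigD1 j) //= big1 => [|k kj].
    by rewrite !mxE !eqxx mulr1 addr0.
  by rewrite !mxE eq_sym (negPf kj) mulr0.
rewrite memv_suml // => j _; rewrite memvZ //.
have /memv_imgP[u' u'U] := jJ j; rewrite -(lincomb_delta w) -(lfunE (lincomb w)).
have /eqP/lker0P inj : lker (lincombf w) = 0%VS by exact: lincombf_inj.
by move/inj => ->.
Qed.

Lemma module_weight lam : is_weight h rho lam ->
  exists i, forall c, c \in spn P -> (lam (theta c) : K) = <<m i, c>>.
Proof.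
have wfree := family_indep wf.
case=> u u0 ul; have [i ui] : exists i, u i 0 != 0.
  apply/existsP; rewrite -[[exists _, _]]negbK negb_exists.
  apply: contraNN u0 => /forallP H; apply/eqP/colP => i.
  by rewrite mxE; have := H i; rewrite negbK => /eqP.
exists i => c cS; have := ul _ (memv_img theta cS).
rewrite (acts_uniq wfree (rhoP (theta_gr _ cS)) (acts_theta c wf)).
move/colP/(_ i); rewrite mul_diag_mx !mxE => /(mulIf ui) ->.
by [].
Qed.

(** As <a, b - a> = -1, the reflection in b - a takes a to b. *)
Lemma weyl_reflected_root a b : a \in Phi -> b \in Phi -> b - a \in P ->
  weyl_reflected g h (lam_of a) (lam_of b).
Proof.
move=> aP bP eP; set e := b - a in eP *; have ePhi := PP eP.
have [x xe x0] := wsp_nz ePhi; have [y ye xy] := coroot ePhi xe x0.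
have neP := cl_opp CP eP.
exists (lam_of e), x, y; split.
- by apply/is_rootP; exists e => // c _; rewrite lam_ofE.
- by apply: root_space_lam => //; exact: (subvP (wsp_gr _ eP)).
- split; first exact: (subvP (wsp_gr _ neP)).
  move=> _ /memv_imgP[c _ ->]; rewrite opp_lfunE lam_ofE.
  by move/wspP: ye => ->; rewrite chiN.
- by rewrite xy lam_ofE (Phi_norm2 SL).
move=> _ /memv_imgP[c _ ->]; rewrite xy !lam_ofE.
have ea : <<a, cx e>> = -1.
  rewrite (chiC SL); have [|E|//] := @Phi_addE e a ePhi aP.
    by rewrite subrK inE bP orbT.
  by have := Phi_nz bP; rewrite -(subrK a b) -/e E addrN eqxx.
by rewrite ea mulN1r opprK -(chiD SL) addrC subrK.
Qed.

Lemma weyl_conjugate_ext lam (mu mu' : 'Hom(L, K^o)) : weyl_conjugate g h lam mu ->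
  {in h, mu =1 mu'} -> weyl_conjugate g h lam mu'.
Proof.
case=> [mu1 E|mu1 mu2 H [al [e [f [H1 H2 H3 H4 H5]]]]] E'.
  by apply: WeylRefl => t th; rewrite E // E'.
apply: (WeylStep H); exists al, e, f; split=> // t th.
by rewrite -E' // H5.
Qed.

Lemma weyl_conjugate_step lam a b : a \in Phi -> b \in Phi ->
  b - a \in 0 :: P -> weyl_conjugate g h lam (lam_of a) ->
  weyl_conjugate g h lam (lam_of b).
Proof.
move=> aP bP; rewrite inE subr_eq0 => /orP[/eqP-> //|eP] H.
exact: WeylStep H (weyl_reflected_root aP bP eP).
Qed.

Lemma module_minuscule : minuscule_rep g h rho.
Proof.
have [minj mP wm w0] := wf.
split; first exact: module_irreducible.
have sub : {subset [seq m i | i <- enum 'I_n] <= Phi}.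
  by move=> _ /mapP[j _ ->].
move=> lam mu /module_weight[i lE] /module_weight[j mE].
have conj a b : a \in Phi -> b \in Phi ->
    linked [seq m i | i <- enum 'I_n] a b ->
    weyl_conjugate g h lam (lam_of a) -> weyl_conjugate g h lam (lam_of b).
  move=> aP bP [e [/sub eP ae eb]] H.
  exact: (weyl_conjugate_step eP bP eb (weyl_conjugate_step aP eP ae H)).
apply: (@weyl_conjugate_ext _ (lam_of (m j))); last first.
  by move=> _ /memv_imgP[c cS ->]; rewrite lam_ofE mE.
apply: (conj (m i0) (m j)) => //; first exact/linkedC.
apply: (conj (m i) (m i0)) => //.
by apply: WeylRefl => _ /memv_imgP[c cS ->]; rewrite lam_ofE lE.
Qed.

End Minuscule.

End ClosedSubsystem.

(** ** Orthogonal subsystems and subalgebras of type A_2 *)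

Lemma spn_orth A a c : (forall b, b \in A -> <<a, cx b>> = 0) ->
  c \in spn A -> <<a, c>> = 0.
Proof.
move=> ort cA; have : (spn A <= lker (chi a))%VS.
  by apply/span_subvP => _ /mapP[b bA ->]; rewrite memv_ker; apply/eqP/ort.
by move/subvP/(_ _ cA); rewrite memv_ker => /eqP.
Qed.

(** A sum of two orthogonal roots has norm 4, hence is not a root. *)
Lemma gr_commute A B : uniq A -> uniq B -> {subset A <= Phi} ->
  {subset B <= Phi} -> (forall a b, a \in A -> b \in B -> <<a, cx b>> = 0) ->
  commuting (gr (spn A) A) (gr (spn B) B).
Proof.
move=> uA uB AP BP ort x y xg yg; move: x xg y yg.
apply: (gr_ind uA) => [y yg|x1 x2 H1 H2 y yg|c cA|a x aA xa].
- by rewrite lie0l.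
- by rewrite lieDl1 H1 // H2 // addr0.
- apply: (gr_ind uB) => [|y1 y2 H1 H2|d dB|b y bB yb].
  + by rewrite lie0r.
  + by rewrite lieDr1 H1 H2 addr0.
  + exact: (theta_abelian RD).
  + have /wspP -> := yb; rewrite (spn_orth _ cA) ?scale0r // => a aA.
    by rewrite (chiC SL) ort.
- apply: (gr_ind uB) => [|y1 y2 H1 H2|d dB|b y bB yb].
  + by rewrite lie0r.
  + by rewrite lieDr1 H1 H2 addr0.
  + rewrite (lie_theta_r _ xa) (spn_orth _ dB) ?oppr0 ?scale0r // => b bB.
    exact: ort.
  + have ab := ort _ _ aA bB; apply: (lie_nonroot (AP _ aA) (BP _ bB) xa yb).
      apply: contra_eq_neq ab => ->; rewrite chi_cxN (Phi_norm2 SL) ?AP //.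
      by rewrite oppr_eq0 natK0.
    by rewrite ab eq_sym oppr_eq0 oner_eq0.
Qed.

Lemma chi_suml (I : Type) (s : seq I) (F : I -> Q) c :
  <<\sum_(i <- s) F i, c>> = \sum_(i <- s) <<F i, c>>.
Proof.
elim: s => [|i s IH]; first by rewrite !big_nil chi0.
by rewrite !big_cons (chiD SL) IH.
Qed.

Lemma chi_sumr (I : Type) (s : seq I) (F : I -> V) a :
  <<a, \sum_(i <- s) F i>> = \sum_(i <- s) <<a, F i>>.
Proof. by rewrite linear_sum. Qed.

Definition root_vector a : L := vpick (wsp a).

Lemma root_vectorP a : a \in Phi -> root_vector a \in wsp a /\ root_vector a != 0.
Proof. by move/(wsp_root RD) => w0; rewrite memv_pick vpick0. Qed.

Section TypeA2.
Variables (E : seq Q) (d : 'I_3 -> Q).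
Hypothesis CE : closed_subsystem E.
Hypothesis EE : forall a, a \in E <-> exists k l, k != l /\ a = d k - d l.
Hypothesis d0 : d 0 = 0.
Hypothesis Edef : forall c, c \in spn E -> (forall a, a \in E -> <<a, c>> = 0) -> c = 0.
Local Notation gE := (gr (spn E) E).

(** Raises the weight by d k; there is no root vector for d 0 = 0. *)
Definition shift (k : 'I_3) (u : L) : L :=
  if k == 0 then u else lie (root_vector (d k)) u.

Lemma d_root k : k != 0 -> d k \in E.
Proof. by move=> k0; apply/EE; exists k, 0; rewrite d0 subr0. Qed.

Lemma d_vector k : k != 0 -> root_vector (d k) \in gE.
Proof.
move=> k0; have dE := d_root k0.
by apply: (subvP (wsp_gr _ dE)); case: (root_vectorP (cl_sub CE dE)).
Qed.

Lemma shift_wsp a u k : u \in wsp a -> shift k u \in wsp (a + d k).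
Proof.
rewrite /shift; case: (eqVneq k 0) => [->|k0] ua; first by rewrite d0 addr0.
by rewrite addrC lie_wsp //; case: (root_vectorP (cl_sub CE (d_root k0))).
Qed.

Lemma shift_neq0 a u k : a \in Phi -> a + d k \in Phi -> u \in wsp a ->
  u != 0 -> shift k u != 0.
Proof.
rewrite /shift; case: (eqVneq k 0) => // k0 aP adP ua u0.
have dP := cl_sub CE (d_root k0); have [rw r0] := root_vectorP dP.
apply: (lie_root_neq0 dP aP) => //.
have [|E1|//] := @Phi_addE (d k) a dP aP; first by rewrite addrC inE adP orbT.
by have := Phi_nz adP; rewrite E1 addNr eqxx.
Qed.

Lemma shift_lie k y u : (forall x, x \in gE -> lie y x = 0) ->
  shift k (lie y u) = lie y (shift k u).
Proof.
rewrite /shift; case: (eqVneq k 0) => // k0 yE.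
by rewrite [RHS]lie_deriv (yE _ (d_vector k0)) lie0l add0r.
Qed.

Lemma shift_sum k (I : finType) (c : I -> K) (u : I -> L) :
  shift k (\sum_i c i *: u i) = \sum_i c i *: shift k (u i).
Proof.
rewrite /shift; case: eqP => // _; rewrite lie_sumr.
by apply: eq_bigr => i _; rewrite lieZr.
Qed.

Lemma shiftZ k (c : K) u : shift k (c *: u) = c *: shift k u.
Proof. by rewrite /shift; case: eqP => // _; rewrite lieZr. Qed.

Variable r : Q.
Hypothesis rd : forall k, r + d k \in Phi.
Hypothesis rp : forall k i j,
  <<r + d k, cx (d i - d j)>> = (i == k)%:R - (j == k)%:R.

Lemma A2_nat k i j : <<r + d k, cx (d i - d j)>> + (j == k)%:R = (i == k)%:R.
Proof. by rewrite rp subrK. Qed.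

Lemma A2_in i j : i != j -> d i - d j \in E.
Proof. by move=> ij; apply/EE; exists i, j. Qed.

(* Adding d_i - d_j gives another of the three weights only from r + d_j. *)
Lemma A2_step i j k l : i != j ->
  (r + d k == r + d l + (d i - d j)) = (k == i) && (l == j).
Proof.
move=> ij; apply/eqP/andP => [E1|[/eqP-> /eqP->]]; last first.
  by rewrite -addrA [d j + _]addrC subrK.
have := A2_nat k i j.
rewrite {1}E1 (chiD SL) (Phi_norm2 SL); last exact: (cl_sub CE (A2_in ij)).
move=> H; have {H} : ((i == l) + 2 + (j == k))%:R = ((i == k) + (j == l))%:R :> K.
  by rewrite [RHS]natrD -H !natrD -(A2_nat l i j); ring.
move/eqP; rewrite natK_eq [k == i]eq_sym [l == j]eq_sym.
by case: (i == l); case: (j == k); case: (i == k); case: (j == l).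
Qed.

Lemma A2_weights_inj : injective (fun k => r + d k).
Proof.
move=> k l /= E1; apply/eqP; apply: contraT => kl.
have := rp k k l; rewrite E1 rp !eqxx [l == k]eq_sym (negPf kl) /=.
rewrite sub0r subr0 => /eqP; rewrite eq_sym -subr_eq0 opprK -natrD.
by rewrite natK0.
Qed.

Lemma A2_module : module_family E (fun k => r + d k).
Proof.
split=> [_ k /EE[i [j [ij ->]]]|_ k /EE[i [j [ij ->]]] kP]; have eE := A2_in ij.
  apply/eqP => E1; have := A2_nat k i j; rewrite E1 chiN.
  rewrite (Phi_norm2 SL); last exact: (cl_sub CE eE).
  move=> H; have /eqP : (j == k)%:R = ((i == k) + 2)%:R :> K.
    by rewrite natrD -H; ring.
  by rewrite natK_eq; case: (i == k); case: (j == k).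
have [|E1|E1] := @Phi_addE (r + d k) (d i - d j) (rd k) (cl_sub CE eE).
- by rewrite inE kP orbT.
- by have := Phi_nz kP; rewrite E1 addrN eqxx.
have := A2_nat k i j; rewrite E1 => H.
have /eqP : (j == k)%:R = ((i == k) + 1)%:R :> K by rewrite natrD -H; ring.
rewrite natK_eq => H'; have /eqP-> : j == k.
  by move: H'; case: (i == k); case: (j == k).
by exists i; rewrite -addrA [d k + _]addrC subrK.
Qed.

Definition A2_basis (k : 'I_3) : L := shift k (root_vector r).

Lemma A2_r : r \in Phi.
Proof. by have := rd 0; rewrite d0 addr0. Qed.

Lemma A2_family : root_family (fun k => r + d k) A2_basis.
Proof.
have [ur u0] := root_vectorP A2_r.
split; [exact: A2_weights_inj | exact: rd | move=> k; exact: shift_wsp |].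
by move=> k; apply: (shift_neq0 A2_r (rd k)).
Qed.

Definition A2_rep x : 'M[K]_3 := adm A2_basis x.

Lemma A2_rep_acts x : x \in gE -> acts A2_basis x (A2_rep x).
Proof.
exact: family_acts (cl_uniq CE) (cl_sub CE) A2_family A2_module.
Qed.

Lemma A2_rep_theta c : c \in spn E ->
  A2_rep (theta c) = diag_mx (\row_k <<r + d k, c>>).
Proof.
move=> cE; apply: (acts_uniq (family_indep A2_family)).
  by apply: A2_rep_acts; apply: theta_gr.
exact: acts_theta A2_family.
Qed.

Lemma delta3E (s : K) (i j k l : 'I_3) :
  (s *: (delta_mx i j : 'M_3)) k l = s * ((k == i) && (l == j))%:R.
Proof. by rewrite !mxE. Qed.

Lemma A2_rep_root i j x : i != j -> x \in wsp (d i - d j) ->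
  A2_rep x = A2_rep x i j *: delta_mx i j.
Proof.
move=> ij xe; have eE := A2_in ij.
have xA := A2_rep_acts (subvP (wsp_gr (spn E) eE) _ xe).
apply/matrixP => k l; rewrite delta3E.
have [/andP[/eqP-> /eqP->]|kl] := boolP ((k == i) && (l == j)).
  by rewrite mulr1.
rewrite mulr0 (acts_entry (cl_sub CE) A2_family A2_module eE xe xA) //.
by rewrite A2_step.
Qed.

Lemma A2_rep_root_neq0 i j x : i != j -> x \in wsp (d i - d j) -> x != 0 ->
  A2_rep x i j != 0.
Proof.
move=> ij xe x0; have eE := A2_in ij.
have [_ _ bw b0] := A2_family.
have xA := A2_rep_acts (subvP (wsp_gr (spn E) eE) _ xe).
have : lie x (A2_basis j) != 0.
  apply: (lie_root_neq0 (cl_sub CE eE) (rd j)) => //.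
  rewrite (chiC SL) rp eqxx (negPf ij) sub0r; by [].
rewrite xA (bigD1 i) //= big1 ?addr0 => [|k ki].
  by rewrite scaler_eq0 negb_or => /andP[].
by rewrite (A2_rep_root ij xe) delta3E (negPf ki) mulr0 scale0r.
Qed.

Lemma sum_delta3 (i : 'I_3) : \sum_k (i == k)%:R = 1 :> K.
Proof.
rewrite (bigD1 i) //= eqxx big1 ?addr0 // => k ki.
by rewrite eq_sym (negPf ki).
Qed.

Lemma A2_weights_sum c : c \in spn E -> \sum_k <<r + d k, c>> = 0.
Proof.
move=> cE; rewrite -chi_suml; apply: (spn_orth _ cE) => _ /EE[i [j [ij ->]]].
rewrite chi_suml (eq_bigr _ (fun k _ => rp k i j)) sumrB !sum_delta3.
exact: subrr.
Qed.

Lemma A2_trace x : x \in gE -> \tr (A2_rep x) = 0.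
Proof.
move=> xE; suff [M [xM trM]] : exists M, acts A2_basis x M /\ \tr M = 0.
  by rewrite (acts_uniq (family_indep A2_family) (A2_rep_acts xE) xM).
move: x xE.
apply: (gr_ind (cl_uniq CE)) => [|x y [M [xM M0]] [N [yN N0]]|c cE|e x eE xe].
- exists 0; rewrite mxtrace0; split=> // j.
  by rewrite lie0l big1 // => i _; rewrite mxE scale0r.
- by exists (M + N); rewrite mxtraceD M0 N0 addr0; split=> //; apply: acts_add.
- exists (A2_rep (theta c)); split; first by apply: A2_rep_acts; apply: theta_gr.
  rewrite A2_rep_theta // mxtrace_diag -[RHS](A2_weights_sum cE).
  by apply: eq_bigr => k _; rewrite mxE.
- exists (A2_rep x); split.
    by apply: A2_rep_acts; apply: (subvP (wsp_gr _ eE)).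
  have /EE[i [j [ij eij]]] := eE; rewrite eij in xe.
  rewrite (A2_rep_root ij xe) mxtraceZ /mxtrace big1 ?mulr0 // => k _.
  rewrite mxE; have [->|_] := eqVneq k i; last by rewrite mulr0n.
  by rewrite (negPf ij).
Qed.

(** The vector of span E on which the weights r + d k take the values a k up
    to their mean. *)
Definition A2_coweight (a : 'I_3 -> K) : V :=
  \sum_i (a i / 3) *: \sum_j cx (d i - d j).

Lemma A2_coweight_mem (a : 'I_3 -> K) : A2_coweight a \in spn E.
Proof.
rewrite memv_suml // => i _; rewrite memvZ // memv_suml // => j _.
have [->|ij] := eqVneq i j; first by rewrite subrr cx0 mem0v.
exact: spn_mem (A2_in ij).
Qed.

Lemma A2_coweightE (a : 'I_3 -> K) k : \sum_i a i = 0 -> <<r + d k, A2_coweight a>> = a k.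
Proof.
move=> a0; have E1 i : <<r + d k, \sum_j cx (d i - d j)>> = 3 * (i == k)%:R - 1.
  have -> : <<r + d k, \sum_j cx (d i - d j)>> =
      \sum_j ((i == k)%:R - (j == k)%:R) by rewrite chi_sumr; apply: eq_bigr => j _; rewrite rp.
  rewrite sumrB sumr_const card_ord mulr_natl; congr (_ - _).
  by rewrite -[RHS](sum_delta3 k); apply: eq_bigr => j _; rewrite eq_sym.
have -> : <<r + d k, A2_coweight a>> = \sum_i (a i * (i == k)%:R - a i / 3).
  rewrite chi_sumr; apply: eq_bigr => i _; rewrite chiZr E1.
  by rewrite mulrBr mulr1 mulrA divfK // natK0.
rewrite sumrB -mulr_suml a0 mul0r subr0 (bigD1 k) //= eqxx mulr1.
by rewrite big1 ?addr0 // => i ik; rewrite (negPf ik) mulr0.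
Qed.

(** The action on the three vectors of the basis identifies g(E) with sl_3: it is
    diagonal on the Cartan subalgebra, with the three weights summing to 0,
    and it sends root vectors to multiples of elementary matrices. *)
Lemma A2_iso_sl : iso_sl gE A2_rep.
Proof.
have wfree := family_indep A2_family.
split; first exact: gr_subalgebra.
- by apply: (acts_representation wfree (gr_subalgebra CE)) => x; apply: A2_rep_acts.
- move=> x xE x0; have [c [X [cE X0 Xw xX]]] := gr_components CE xE.
  have xb j : lie x (A2_basis j) = 0.
    by rewrite (A2_rep_acts xE) x0 big1 // => i _; rewrite mxE scale0r.
  have [_ _ bw b0] := A2_family.
  have Z j a : a \in 0 :: E -> lie (X a) (A2_basis j) = 0.
    pose Y b := lie (X (b - (r + d j))) (A2_basis j).
    have YE e : Y (e + (r + d j)) = lie (X e) (A2_basis j) by rewrite /Y addrK.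
    move=> aE; rewrite -YE.
    apply: (@wsp_sum0 [seq e + (r + d j) | e <- 0 :: E] Y).
    + by rewrite map_inj_uniq ?uniq_0P //; apply: addIr.
    + by move=> _ /mapP[e eE ->]; rewrite YE; apply: lie_wsp; rewrite ?Xw.
    + rewrite big_map (eq_bigr _ (fun e _ => YE e)) -lie_suml -xX; exact: xb.
    + by apply/mapP; exists a.
  have XE a : a \in E -> X a = 0.
    move=> aE; have [i [j [ij aij]]] := (EE a).1 aE.
    have a0E : a \in 0 :: E by rewrite inE aE orbT.
    apply/eqP; apply: contraT => Xa; have /eqP := Z j a a0E; apply: contraTT => _.
    apply: (lie_root_neq0 (cl_sub CE aE) (rd j)) => //; last exact: Xw.
    by rewrite (chiC SL) aij rp eqxx (negPf ij) sub0r.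
  have mc j : <<r + d j, c>> = 0.
    have := Z j 0 (mem_head _ _); rewrite X0; have /wspP -> := bw j.
    by move/eqP; rewrite scaler_eq0 (negPf (b0 j)) orbF => /eqP.
  rewrite xX big_cons X0 (Edef cE) ?linear0 ?add0r => [|_ /EE[i [j [_ ->]]]].
    by rewrite big1_seq // => a /andP[_ /XE].
  have -> : d i - d j = (r + d i) - (r + d j) by rewrite opprD addrACA subrr add0r.
  by rewrite chiB !mc subrr.
move=> A; split=> [trA|[x xE <-]]; last exact: A2_trace.
pose good (M : 'M[K]_3) := exists2 x, x \in gE & acts A2_basis x M.
have good0 : good 0.
  exists 0; first exact: mem0v.
  by move=> j; rewrite lie0l big1 // => i _; rewrite mxE scale0r.
have goodD M N : good M -> good N -> good (M + N).
  move=> [x xE xM] [y yE yN].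
  by exists (x + y); [rewrite memvD | apply: acts_add].
have goodZ k M : good M -> good (k *: M).
  move=> [x xE xM]; exists (k *: x); first exact: memvZ.
  move=> j; rewrite lieZl xM scaler_sumr; apply: eq_bigr => i _.
  by rewrite mxE scalerA.
suff [x xE xA] : good A.
  by exists x => //; apply: (acts_uniq wfree (A2_rep_acts xE) xA).
have -> : A = diag_mx (\row_k A k k) +
    \sum_i \sum_j (if i == j then 0 else A i j) *: delta_mx i j.
  apply/matrixP => i j; rewrite !mxE summxE (bigD1 i) //= summxE (bigD1 j) //=.
  rewrite !mxE !eqxx mulr1 big1 ?addr0 => [|k kj]; last first.
    by rewrite !mxE [j == k]eq_sym (negPf kj) andbF mulr0.
  rewrite big1 ?addr0 => [|k ki]; last first.
    rewrite summxE big1 // => l _.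
    by rewrite !mxE [i == k]eq_sym (negPf ki) mulr0.
  by have [->|ij] := eqVneq i j; rewrite ?mulr1n ?addr0 // mulr0n add0r.
apply: (goodD).
  have c0 := A2_coweight_mem (fun k => A k k).
  exists (theta (A2_coweight (fun k => A k k))); first exact: theta_gr.
  have := A2_rep_acts (theta_gr _ c0); rewrite A2_rep_theta //.
  have trA' : \sum_i A i i = 0 by rewrite -[RHS]trA.
  by under eq_mx do rewrite (A2_coweightE _ trA').
apply: (big_ind good) => // i _; apply: (big_ind good) => // j _.
have [_|ij] := eqVneq i j; first by rewrite scale0r.
have eE := A2_in ij; have [xe xe0] := root_vectorP (cl_sub CE eE).
have s0 := A2_rep_root_neq0 ij xe xe0.
have xg : root_vector (d i - d j) \in gE by exact: (subvP (wsp_gr _ eE)).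
apply: (goodZ); rewrite -[delta_mx i j]scale1r -(mulVf s0) -scalerA.
apply: (goodZ); exists (root_vector (d i - d j)) => //.
by rewrite -(A2_rep_root ij xe); apply: A2_rep_acts.
Qed.

(** The vectors on which g(E) acts through shift as on the model module. *)
Definition A2_typical u : Prop := forall x k, x \in gE ->
  lie x (shift k u) = \sum_l A2_rep x l k *: shift l u.

Lemma A2_typical_r : A2_typical (root_vector r).
Proof. by move=> x k xE; apply: A2_rep_acts. Qed.

Lemma A2_typicalZ (c : K) u : A2_typical u -> A2_typical (c *: u).
Proof.
move=> tu x k xE; rewrite shiftZ lieZr tu // scaler_sumr.
by apply: eq_bigr => l _; rewrite shiftZ !scalerA mulrC.
Qed.

Lemma A2_typical_lie y u : (forall x, x \in gE -> lie y x = 0) ->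
  A2_typical u -> A2_typical (lie y u).
Proof.
move=> yE tu x k xE; have xy : lie x y = 0 by rewrite lie_skew yE ?oppr0.
rewrite shift_lie // lie_deriv xy lie0l add0r tu // lie_sumr.
by apply: eq_bigr => l _; rewrite lieZr shift_lie.
Qed.

End TypeA2.

(** ** Modules that are external tensor products *)

Lemma dual_tens_l n1 n2 (A : 'M[K]_n1) :
  - (A *t (1%:M : 'M_n2))^T = (- A^T) *t 1%:M.
Proof. by rewrite trmx_tens trmx1; apply/matrixP => i j; rewrite !mxE mulNr. Qed.

Lemma dual_tens_r n1 n2 (B : 'M[K]_n2) :
  - ((1%:M : 'M_n1) *t B)^T = 1%:M *t (- B^T).
Proof. by rewrite trmx_tens trmx1; apply/matrixP => i j; rewrite !mxE mulrN. Qed.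

Lemma tens11 n1 n2 : (1%:M : 'M[K]_n1) *t (1%:M : 'M_n2) = 1%:M.
Proof.
apply/matrixP => i j; case: (mxtens_indexP i) => p k.
case: (mxtens_indexP j) => q l; rewrite tensmxE !mxE.
by rewrite (can_eq (@mxtens_indexK n1 n2)) xpair_eqE -natrM mulnb.
Qed.

(** Being typical is preserved by g(P), which commutes with g(E), and the root
    vectors of g(P) lead from the root space of r to that of a. *)
Lemma link_typical (P E A : seq Q) (d : 'I_3 -> Q) r a u : closed_subsystem P ->
  (forall x y, x \in gr (spn P) P -> y \in gr (spn E) E -> lie x y = 0) ->
  closed_subsystem E ->
  (forall a, a \in E <-> exists k l, k != l /\ a = d k - d l) -> d 0 = 0 ->
  (forall k, r + d k \in Phi) ->
  (forall k i j, <<r + d k, cx (d i - d j)>> = (i == k)%:R - (j == k)%:R) ->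
  {subset A <= Phi} -> a \in Phi -> linked P A r a -> u \in wsp a ->
  A2_typical E d r u.
Proof.
move=> CP comm CE EE d0 rd rp AP aP ra ua.
have rP : r \in Phi by have := rd 0; rewrite d0 addr0.
apply: (wsp_linked CP AP _ _ rP aP ra _ ua) => [k x|e y x eP ye|x xr].
- exact: A2_typicalZ.
- apply: A2_typical_lie => // z zE; apply: comm => //.
  exact: (subvP (wsp_gr _ eP)).
have [rw r0] := root_vectorP rP.
have [k ->] := wsp_mult rP rw r0 xr; apply: A2_typicalZ.
exact: A2_typical_r.
Qed.

Section TensorDecomposition.
Variables (P E : seq Q) (d : 'I_3 -> Q) (n : nat) (F : 'I_n -> Q) (i0 : 'I_n).
Hypotheses (CP : closed_subsystem P) (CE : closed_subsystem E).
Hypothesis PE : forall a b, a \in P -> b \in E -> <<a, cx b>> = 0.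
Hypothesis EE : forall a, a \in E <-> exists k l, k != l /\ a = d k - d l.
Hypothesis d0 : d 0 = 0.
Hypothesis Froot : forall p k, F p + d k \in Phi.
Hypothesis rp : forall k i j,
  <<F i0 + d k, cx (d i - d j)>> = (i == k)%:R - (j == k)%:R.
Let m (j : 'I_(n * 3)) : Q :=
  F (mxtens_unindex j).1 + d (mxtens_unindex j).2.
Hypothesis minj : injective m.
Hypotheses (modF : module_family P F) (modP : module_family P m)
  (modE : module_family E m).
Hypothesis link0 : forall p, linked P [seq F q | q <- enum 'I_n] (F p) (F i0).
Hypothesis sep : forall p q, p != q ->
  exists2 c, c \in spn P & <<F p, c>> != <<F q, c>>.
Local Notation gP := (gr (spn P) P).
Local Notation gE := (gr (spn E) E).

Definition fiber_basis (p : 'I_n) : L := root_vector (F p).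

Lemma F_root p : F p \in Phi.
Proof. by have := Froot p 0; rewrite d0 addr0. Qed.

Lemma fiber_family : root_family F fiber_basis.
Proof.
split=> [p q E1|||]; try by move=> p; case: (root_vectorP (F_root p)).
  have : mxtens_index (p, 0) = mxtens_index (q, 0) :> 'I_(n * 3).
    by apply: minj; rewrite /m !mxtens_indexK /= E1.
  by move/(can_inj (@mxtens_indexK n 3)) => [].
exact: F_root.
Qed.

Definition fiber_rep (x : L) : 'M[K]_n := adm fiber_basis x.
Definition A2_fiber_rep (x : L) : 'M[K]_3 := A2_rep d (F i0) x.

Lemma fiber_acts x : x \in gP -> acts fiber_basis x (fiber_rep x).
Proof. exact: family_acts (cl_uniq CP) (cl_sub CP) fiber_family modF. Qed.

Definition tensor_basis (j : 'I_(n * 3)) : L :=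
  shift d (mxtens_unindex j).2 (fiber_basis (mxtens_unindex j).1).

Lemma tensor_basisE p k :
  tensor_basis (mxtens_index (p, k)) = shift d k (fiber_basis p).
Proof. by rewrite /tensor_basis mxtens_indexK. Qed.

Lemma tensor_family : root_family m tensor_basis.
Proof.
have [_ FP Fw F0] := fiber_family; split=> // j.
- exact: Froot.
- by apply: (shift_wsp CE EE d0); apply: Fw.
- by apply: (shift_neq0 CE EE d0 (FP _)) => //; apply: Froot.
Qed.

Lemma gP_gE_commute : commuting gP gE.
Proof.
exact: gr_commute (cl_uniq CP) (cl_uniq CE) (cl_sub CP) (cl_sub CE) PE.
Qed.

Lemma tensor_acts_left x : x \in gP -> acts tensor_basis x (fiber_rep x *t 1%:M).
Proof.
move=> xP j; case: (mxtens_indexP j) => p k; rewrite tens_left tensor_basisE.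
rewrite -(shift_lie CE EE d0); last by move=> y; apply: gP_gE_commute.
rewrite fiber_acts // shift_sum; apply: eq_bigr => q _.
by rewrite tensor_basisE.
Qed.

Lemma tensor_acts_right x : x \in gE ->
  acts tensor_basis x (1%:M *t A2_fiber_rep x).
Proof.
move=> xE j; case: (mxtens_indexP j) => p k; rewrite tens_right tensor_basisE.
have [_ FP Fw F0] := fiber_family.
have sub : {subset [seq F i | i <- enum 'I_n] <= Phi}.
  by move=> _ /mapP[q _ ->].
have tp : A2_typical E d (F i0) (fiber_basis p).
  apply: (link_typical CP gP_gE_commute CE EE d0 _ rp sub (FP p)) => //.
  exact: linkedC.
by rewrite tp //; apply: eq_bigr => l _; rewrite tensor_basisE.
Qed.

Variables A B : seq Q.
Hypothesis AE : forall a, a \in A <-> exists j, a = m j.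
Hypothesis BE : forall a, a \in B <-> exists j, a = - m j.

Lemma tensor_V : tensor_module2 gP gE (gr 0%VS A) fiber_rep A2_fiber_rep.
Proof.
apply: (tensor2_of_acts (family_indep tensor_family)).
- exact: family_span tensor_family AE.
- exact: tensor_acts_left.
- exact: tensor_acts_right.
Qed.

Lemma tensor_W : tensor_module2 gP gE (gr 0%VS B)
  (dual_rep fiber_rep) (dual_rep A2_fiber_rep).
Proof.
have [w' dw] := dual_family_exists tensor_family.
apply: (tensor2_of_acts (family_indep dw.1)).
- exact: family_span dw.1 BE.
- move=> x xP; rewrite -dual_tens_l.
  exact: dual_acts (cl_uniq CP) (cl_sub CP) (cl_opp CP) tensor_family dw modP xP
    (tensor_acts_left xP).
- move=> x xE; rewrite -dual_tens_r.
  exact: dual_acts (cl_uniq CE) (cl_sub CE) (cl_opp CE) tensor_family dw modE xE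
    (tensor_acts_right xE).
Qed.

Lemma fiber_minuscule : minuscule_rep gP (theta @: spn P)%VS fiber_rep.
Proof.
exact: (@module_minuscule P CP n F fiber_basis fiber_rep fiber_family
  (@fiber_acts) sep i0 link0).
Qed.

Lemma dual_fiber : exists2 w' : 'I_n -> L, root_family (fun p => - F p) w' &
  forall x, x \in gP -> acts w' x (dual_rep fiber_rep x).
Proof.
have [w' dw] := dual_family_exists fiber_family; exists w'; first exact: dw.1.
move=> x xP; exact: dual_acts (cl_uniq CP) (cl_sub CP) (cl_opp CP) fiber_family
  dw modF xP (fiber_acts xP).
Qed.

Lemma dual_fiber_minuscule :
  minuscule_rep gP (theta @: spn P)%VS (dual_rep fiber_rep).
Proof.
have [w' w'f w'a] := dual_fiber.
apply: (@module_minuscule P CP n (fun p => - F p) w' (dual_rep fiber_rep)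
  w'f w'a _ i0).
- move=> p q /sep[c cP ne]; exists c => //.
  by rewrite !chiN eqr_opp.
- move=> p; have [e [/mapP[q _ ->] H1 H2]] := link0 p.
  have opp a : a \in 0 :: P -> - a \in 0 :: P.
    by rewrite !inE oppr_eq0 => /orP[->//|/(cl_opp CP)->]; exact: orbT.
  exists (- F q); split.
  + by apply/mapP; exists q; rewrite ?mem_enum.
  + by rewrite -opprD opp.
  + by rewrite -opprD opp.
Qed.

(** An isomorphism takes a vector of weight F_i0 to one of the same weight in
    the dual, whose weights are the - F_q. *)
Lemma fiber_not_selfdual :
  (forall p q, exists2 c, c \in spn P & <<F p, c>> != <<- F q, c>>) ->
  ~ isomorphic_rep gP fiber_rep (dual_rep fiber_rep).
Proof.
move=> ns [T uT TE]; have [w' w'f w'a] := dual_fiber.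
pose u : 'cV[K]_n := T *m delta_mx i0 0.
have u0 : u != 0.
  apply/eqP => /(congr1 (mulmx (invmx T))); rewrite mulmxA mulVmx // mul1mx mulmx0.
  move/colP/(_ i0); rewrite !mxE !eqxx => /eqP; by rewrite oner_eq0.
have [q qE] : exists q, forall c, c \in spn P ->
    (lam_of (F i0) (theta c) : K) = <<- F q, c>>.
  apply: (@module_weight P n (fun p => - F p) w' (dual_rep fiber_rep)
    w'f w'a (lam_of (F i0))).
  exists u => // _ /memv_imgP[c cP ->].
  rewrite /u mulmxA -TE ?theta_gr // -mulmxA lam_ofE.
  have -> : fiber_rep (theta c) = diag_mx (\row_p <<F p, c>>).
    apply: (acts_uniq (family_indep fiber_family) (fiber_acts (theta_gr _ cP))).
    exact: acts_theta fiber_family.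
  rewrite scalemxAr; congr (T *m _); apply/colP => p; rewrite mul_diag_mx !mxE.
  by have [->|_] := eqVneq p i0; rewrite ?mulr1 ?mulr0.
have [c cP] := ns i0 q; rewrite -qE // lam_ofE.
by rewrite eqxx.
Qed.

End TensorDecomposition.

(** ** Direct sum decompositions *)

Lemma spn_cat A B : (spn (A ++ B) = spn A + spn B)%VS.
Proof. by rewrite /spn map_cat span_cat. Qed.

Lemma spn_disjoint A B :
  (forall a b, a \in A -> b \in B -> <<a, cx b>> = 0) ->
  (forall c, c \in spn A -> (forall a, a \in A -> <<a, c>> = 0) -> c = 0) ->
  (spn A :&: spn B = 0)%VS.
Proof.
move=> ort ndg; apply/eqP; rewrite -subv0; apply/subvP => c /memv_capP[cA cB].
rewrite memv0; apply/eqP/ndg => // a aA; apply: (spn_orth _ cB) => b bB.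
exact: ort.
Qed.

Lemma directv3 (U1 U2 U3 : {vspace L}) : (U1 :&: U2 = 0)%VS ->
  ((U1 + U2) :&: U3 = 0)%VS -> directv (U1 + U2 + U3).
Proof.
by move=> c2 c3; rewrite !directv_addE /= !directv_trivial /= c2 c3 !eqxx.
Qed.

Lemma directv4 (U1 U2 U3 U4 : {vspace L}) : (U1 :&: U2 = 0)%VS ->
  ((U1 + U2) :&: U3 = 0)%VS -> ((U1 + U2 + U3) :&: U4 = 0)%VS ->
  directv (U1 + U2 + U3 + U4).
Proof.
move=> c2 c3 c4; rewrite !directv_addE /= !directv_trivial /= c2 c3 c4.
by rewrite !eqxx.
Qed.

Lemma directv_sum3 (U : 'I_3 -> {vspace L}) : (U 0%R :&: (U 1%R + U 2%R) = 0)%VS ->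
  (U 1%R :&: U 2%R = 0)%VS -> directv (\sum_(j < 3) U j).
Proof.
move=> c0 c1; apply/directv_sum_independent => u us.
rewrite 3!big_ord_recl big_ord0 addr0.
have -> : lift ord0 ord0 = 1 :> 'I_3 by exact: val_inj.
have -> : lift ord0 (lift ord0 ord0) = 2 :> 'I_3 by exact: val_inj.
move=> sum0; have u0 : u 0 = 0.
  apply/eqP; rewrite -memv0 -c0; apply/memv_capP; split; first exact: us.
  by move/eqP: sum0; rewrite addr_eq0 => /eqP->; rewrite memvN memv_add // us.
have u1 : u 1 = 0.
  apply/eqP; rewrite -memv0 -c1; apply/memv_capP; split; first exact: us.
  move: sum0; rewrite u0 add0r => /eqP; rewrite addr_eq0 => /eqP->.
  by rewrite memvN us.
have u2 : u 2 = 0 by move: sum0; rewrite u0 u1 !add0r.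
move=> [[|[|[|//]]] lt] _.
- by rewrite -[RHS]u0; congr u; apply: val_inj.
- by rewrite -[RHS]u1; congr u; apply: val_inj.
- by rewrite -[RHS]u2; congr u; apply: val_inj.
Qed.

Lemma gr_decomposition P E A B (U1 U2 U3 U4 : {vspace L}) :
  perm_eq (P ++ E ++ A ++ B) Phi ->
  (spn P + spn E = fullv)%VS -> (spn P :&: spn E = 0)%VS ->
  U1 = gr (spn P) P -> U2 = gr (spn E) E -> U3 = gr 0%VS A ->
  U4 = gr 0%VS B -> (U1 + U2 + U3 + U4)%VS = fullv /\ directv (U1 + U2 + U3 + U4).
Proof.
move=> pP sPE cPE E1 E2 E3 E4; split.
  rewrite E1 E2 E3 E4 !gr_add !addv0 sPE -gr_full; apply: gr_perm.
  by rewrite -!catA.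
have u4 : uniq (((P ++ E) ++ A) ++ B).
  by rewrite -!catA (perm_uniq pP) (Phi_uniq SL).
have s4 : {subset ((P ++ E) ++ A) ++ B <= Phi}.
  by move=> a; rewrite -!catA (perm_mem pP).
have u3 : uniq ((P ++ E) ++ A) by move: u4; rewrite cat_uniq => /andP[].
have s3 : {subset (P ++ E) ++ A <= Phi}.
  by move=> a aA; apply: s4; rewrite mem_cat aA.
have u2 : uniq (P ++ E) by move: u3; rewrite cat_uniq => /andP[].
have s2 : {subset P ++ E <= Phi}.
  by move=> a aA; apply: s3; rewrite mem_cat aA.
by apply: directv4; rewrite E1 E2 ?E3 ?E4 ?gr_add gr_cap // ?capv0.
Qed.

(** ** Three commuting subalgebras of type A_2 *)

Section Trinification.
Variables (E : 'I_3 -> seq Q) (d : 'I_3 -> 'I_3 -> Q) (r : Q).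
Hypothesis CE : forall j, closed_subsystem (E j).
Hypothesis EE : forall j a,
  a \in E j <-> exists k l, k != l /\ a = d j k - d j l.
Hypothesis d0 : forall j, d j 0 = 0.
Hypothesis Eorth : forall i j a b, i != j -> a \in E i -> b \in E j ->
  <<a, cx b>> = 0.
Hypothesis Edef : forall j c, c \in spn (E j) ->
  (forall a, a \in E j -> <<a, c>> = 0) -> c = 0.
Hypothesis rp : forall (j k a b : 'I_3),
  <<r + d j k, cx (d j a - d j b)>> = (a == k)%:R - (b == k)%:R.
Hypothesis mroot : forall (a b c : 'I_3), r + d 2 c + d 1 b + d 0 a \in Phi.
Let m (j : 'I_(3 * 3 * 3)) : Q :=
  r + d 2 (mxtens_unindex j).2 + d 1 (mxtens_unindex (mxtens_unindex j).1).2
    + d 0 (mxtens_unindex (mxtens_unindex j).1).1.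
Hypothesis minj : injective m.
Hypothesis modE : forall j, module_family (E j) m.
Local Notation s := (fun j => gr (spn (E j)) (E j)).

Lemma trini_rd j k : r + d j k \in Phi.
Proof.
case: j => -[|[|[|//]]] lt.
- have -> : Ordinal lt = 0 by exact: val_inj.
  by have := mroot k 0 0; rewrite !d0 !addr0.
- have -> : Ordinal lt = 1 by exact: val_inj.
  by have := mroot 0 k 0; rewrite !d0 !addr0.
- have -> : Ordinal lt = 2 by exact: val_inj.
  by have := mroot 0 0 k; rewrite !d0 !addr0.
Qed.

Definition trini_rep (j : 'I_3) (x : L) : 'M[K]_3 := A2_rep (d j) r x.

Lemma trini_iso j : iso_sl (s j) (trini_rep j).
Proof. exact: A2_iso_sl (CE j) (EE j) (d0 j) (@Edef j) r (trini_rd j) (rp j). Qed.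

Lemma trini_commute i j : i != j -> commuting (s i) (s j).
Proof.
move=> ij; apply: gr_commute; try exact: cl_uniq; try exact: cl_sub.
by move=> a b; apply: Eorth.
Qed.

Lemma trini_typical_r j : A2_typical (E j) (d j) r (root_vector r).
Proof. exact: A2_typical_r (CE j) (EE j) (d0 j) r (trini_rd j) (rp j). Qed.

(** The i-th subalgebra commutes with the j-th one, which contains the root
    vectors used by shift. *)
Lemma trini_typical_shift i j k u : i != j ->
  A2_typical (E i) (d i) r u -> A2_typical (E i) (d i) r (shift (d j) k u).
Proof.
move=> ij tu; rewrite /shift; case: (eqVneq k 0) => // k0.
apply: (A2_typical_lie (CE i) (EE i) (d0 i)) tu => x xi.
apply: (trini_commute (i := j) (j := i)) => //; first by rewrite eq_sym.
exact: (d_vector (CE j) (EE j) (d0 j) k0).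
Qed.

Definition trini_basis (j : 'I_(3 * 3 * 3)) : L :=
  shift (d 0) (mxtens_unindex (mxtens_unindex j).1).1
    (shift (d 1) (mxtens_unindex (mxtens_unindex j).1).2
      (shift (d 2) (mxtens_unindex j).2 (root_vector r))).

Lemma trini_basisE (a b c : 'I_3) :
  trini_basis (mxtens_index (mxtens_index (a, b), c)) =
  shift (d 0) a (shift (d 1) b (shift (d 2) c (root_vector r))).
Proof. by rewrite /trini_basis !mxtens_indexK. Qed.

Lemma trini_family : root_family m trini_basis.
Proof.
have sw j := shift_wsp (CE j) (EE j) (d0 j).
have sn j := shift_neq0 (CE j) (EE j) (d0 j).
have rP : r \in Phi by have := trini_rd 0 0; rewrite d0 addr0.
have [rw r0] := root_vectorP rP.
split=> // j; first exact: mroot.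
  by do 3!apply: (sw).
have H2 (c : 'I_3) : shift (d 2) c (root_vector r) \in wsp (r + d 2 c) by apply: (sw).
have H1 (b c : 'I_3) : shift (d 1) b (shift (d 2) c (root_vector r)) \in
    wsp (r + d 2 c + d 1 b) by apply: (sw).
have P1 (b c : 'I_3) : r + d 2 c + d 1 b \in Phi by have := mroot 0 b c; rewrite d0 addr0.
apply: (sn _ _ _ _ (P1 _ _) (mroot _ _ _) (H1 _ _)).
apply: (sn _ _ _ _ (trini_rd _ _) (P1 _ _) (H2 _)).
exact: (sn _ _ _ _ rP (trini_rd _ _) rw r0).
Qed.

Lemma trini_acts0 x : x \in s 0 ->
  acts trini_basis x ((trini_rep 0 x *t 1%:M) *t 1%:M).
Proof.
move=> xs j; case: (mxtens_indexP j) => ab c; case: (mxtens_indexP ab) => a b.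
rewrite tens_left (tens_left (fun q => trini_basis (mxtens_index (q, c)))).
rewrite trini_basisE; set u := shift (d 1) b _.
have tu : A2_typical (E 0) (d 0) r u.
  by do 2!apply: trini_typical_shift => //; apply: trini_typical_r.
by rewrite tu //; apply: eq_bigr => l _; rewrite trini_basisE.
Qed.

Lemma trini_acts1 x : x \in s 1 ->
  acts trini_basis x ((1%:M *t trini_rep 1 x) *t 1%:M).
Proof.
move=> xs j; case: (mxtens_indexP j) => ab c; case: (mxtens_indexP ab) => a b.
rewrite tens_left (tens_right (fun q => trini_basis (mxtens_index (q, c)))).
rewrite trini_basisE; set u := shift (d 2) c _.
have tu : A2_typical (E 1) (d 1) r u.
  by apply: trini_typical_shift => //; apply: trini_typical_r.
rewrite -(shift_lie (CE 0) (EE 0) (d0 0)); last first.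
  by move=> y; apply: (trini_commute (i := 1) (j := 0)).
by rewrite tu // shift_sum; apply: eq_bigr => l _; rewrite trini_basisE.
Qed.

Lemma trini_acts2 x : x \in s 2 ->
  acts trini_basis x ((1%:M *t 1%:M) *t trini_rep 2 x).
Proof.
move=> xs j; case: (mxtens_indexP j) => ab c; case: (mxtens_indexP ab) => a b.
have -> : (1%:M *t 1%:M : 'M[K]_(3 * 3)) = 1%:M by exact: tens11.
rewrite tens_right trini_basisE.
rewrite -(shift_lie (CE 0) (EE 0) (d0 0)); last first.
  by move=> y; apply: (trini_commute (i := 2) (j := 0)).
rewrite -(shift_lie (CE 1) (EE 1) (d0 1)); last first.
  by move=> y; apply: (trini_commute (i := 2) (j := 1)).
rewrite trini_typical_r // !shift_sum; apply: eq_bigr => l _.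
by rewrite trini_basisE.
Qed.

Variables A B : seq Q.
Hypothesis AE : forall a, a \in A <-> exists j, a = m j.
Hypothesis BE : forall a, a \in B <-> exists j, a = - m j.

Lemma trini_tensor : tensor_module3 (s 0) (s 1) (s 2) (gr 0%VS A)
  (trini_rep 0) (trini_rep 1) (trini_rep 2).
Proof.
apply: (tensor3_of_acts (family_indep trini_family)).
- exact: family_span trini_family AE.
- exact: trini_acts0.
- exact: trini_acts1.
- exact: trini_acts2.
Qed.

Lemma trini_tensor_dual : tensor_module3 (s 0) (s 1) (s 2) (gr 0%VS B)
  (dual_rep (trini_rep 0)) (dual_rep (trini_rep 1)) (dual_rep (trini_rep 2)).
Proof.
have [w' dw] := dual_family_exists trini_family.
have dual j x M : x \in s j -> acts trini_basis x M -> acts w' x (- M^T).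
  move=> xs xM; exact: dual_acts (cl_uniq (CE j)) (cl_sub (CE j)) (cl_opp (CE j))
    trini_family dw (modE j) xs xM.
apply: (tensor3_of_acts (family_indep dw.1)).
- exact: family_span dw.1 BE.
- move=> x xs; rewrite /dual_rep -!dual_tens_l.
  by apply: (dual 0) => //; apply: trini_acts0.
- move=> x xs; rewrite /dual_rep -dual_tens_r -dual_tens_l.
  by apply: (dual 1) => //; apply: trini_acts1.
- move=> x xs.
  have -> : (1%:M *t 1%:M : 'M[K]_(3 * 3)) = 1%:M by exact: tens11.
  rewrite /dual_rep -dual_tens_r; apply: (dual 2) => //.
  have := trini_acts2 xs.
  by have -> : (1%:M *t 1%:M : 'M[K]_(3 * 3)) = 1%:M by exact: tens11.
Qed.

Hypothesis Euniq : uniq (E 0 ++ E 1 ++ E 2).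

Lemma trini_sum : (\sum_(j < 3) s j)%VS =
  gr (spn (E 0 ++ E 1 ++ E 2)) (E 0 ++ E 1 ++ E 2).
Proof.
rewrite 3!big_ord_recl big_ord0 addv0 !gr_add !spn_cat.
have -> : lift ord0 ord0 = 1 :> 'I_3 by exact: val_inj.
by have -> : lift ord0 (lift ord0 ord0) = 2 :> 'I_3 by exact: val_inj.
Qed.

Lemma trini_directv (U : 'I_3 -> {vspace L}) : U =1 s ->
  directv (\sum_(j < 3) U j).
Proof.
move=> UE; have Eb j a : a \in E j -> a \in Phi by apply: cl_sub.
have u12 : uniq (E 1 ++ E 2) by move: Euniq; rewrite cat_uniq => /and3P[].
have s12 : {subset E 1 ++ E 2 <= Phi}.
  by move=> a; rewrite mem_cat => /orP[]; apply: Eb.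
have s012 : {subset E 0 ++ E 1 ++ E 2 <= Phi}.
  by move=> a; rewrite mem_cat => /orP[]; [apply: Eb | apply: s12].
apply: directv_sum3; rewrite !UE ?gr_add -?spn_cat; apply: gr_cap => //;
  apply: spn_disjoint; try exact: Edef.
  move=> a b aE; rewrite mem_cat => /orP[bE|bE].
    exact: (@Eorth 0 1).
  exact: (@Eorth 0 2).
by move=> a b aE bE; apply: (@Eorth 1 2).
Qed.

End Trinification.

(** ** Gradings *)

Section Grading.
Variables (P : seq Q) (f : Q -> 'Z_3).
Hypothesis CP : closed_subsystem P.
Hypothesis fD : forall a b, a \in P -> b \in P -> f (a + b) = f a + f b.
Hypothesis fN : forall a, a \in P -> f (- a) = - f a.

(* The Cartan subalgebra has degree 0. *)
Definition graded (k : 'Z_3) : {vspace L} :=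
  gr (if k == 0 then spn P else 0%VS) [seq a <- P | f a == k].

Lemma graded_bracket k l x y :
  x \in graded k -> y \in graded l -> lie x y \in graded (k + l).
Proof.
have uk j : uniq [seq a <- P | f a == j] by rewrite filter_uniq // (cl_uniq CP).
have inP j a : a \in [seq a <- P | f a == j] -> a \in P /\ f a = j.
  by rewrite mem_filter => /andP[/eqP-> ->].
have ing a z : a \in P -> z \in wsp a -> z \in graded (f a).
  move=> aP; have aF : a \in [seq b <- P | f b == f a].
    by rewrite mem_filter eqxx.
  exact: (subvP (wsp_gr _ aF)).
move=> xk yl; move: x xk y yl.
apply: (gr_ind (uk k)) => [y yg|x1 x2 H1 H2 y yg|c|a x /inP[aP <-] xa].
- by rewrite lie0l mem0v.
- by rewrite lieDl1 memvD ?H1 ?H2.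
- case: (eqVneq k 0) => [-> _|_]; last first.
    by rewrite memv0 => /eqP-> y _; rewrite linear0 lie0l mem0v.
  rewrite add0r; apply: (gr_ind (uk l)) => [|y1 y2 H1 H2|d|b y /inP[bP <-] yb].
  + by rewrite lie0r mem0v.
  + by rewrite lieDr1 memvD.
  + by rewrite (theta_abelian RD) mem0v.
  + by move/wspP: (yb) => ->; rewrite memvZ // ing.
- apply: (gr_ind (uk l)) => [|y1 y2 H1 H2|d|b y /inP[bP <-] yb].
  + by rewrite lie0r mem0v.
  + by rewrite lieDr1 memvD.
  + case: (eqVneq l 0) => [-> _|_].
      by rewrite (lie_theta_r _ xa) addr0 memvZ // ing.
    by rewrite memv0 => /eqP->; rewrite linear0 lie0r mem0v.
  + have aPhi := cl_sub CP aP; have bPhi := cl_sub CP bP.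
    have [E|ba] := eqVneq b (- a).
      have [k' ->] : exists k, lie x y = k *: theta (cx a).
        by apply: lie_opposite => //; rewrite -E.
      rewrite memvZ // E fN // addrN; apply: theta_gr.
      by rewrite /= spn_mem.
    have [abP|abP] := boolP (a + b \in Phi).
      by rewrite -fD // ing ?(cl_add CP) // lie_wsp.
    by rewrite (@lie_nonroot2 a b x y) ?mem0v.
Qed.

Lemma graded_sum (G : 'Z_3 -> {vspace L}) : G =1 graded ->
  gr (spn P) P = (G 0%R + G 1%R + G 2%R)%VS /\
  directv (G 0%R + G 1%R + G 2%R).
Proof.
move=> GE.
have pP : perm_eq ([seq a <- P | f a == 0] ++ [seq a <- P | f a == 1] ++
    [seq a <- P | f a == 2]) P.
  apply: uniq_perm; last first.
  - move=> a; rewrite !mem_cat !mem_filter -!andb_orl.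
    by case: (f a) => -[|[|[|//]]] lt; rewrite ?andbT.
  - exact: (cl_uniq CP).
  rewrite !cat_uniq !filter_uniq ?(cl_uniq CP) // andbT /=.
  apply/andP; split.
    rewrite has_cat negb_or; apply/andP; split; apply/hasPn => a;
      by rewrite !mem_filter => /andP[/eqP-> _].
  by apply/hasPn => a; rewrite !mem_filter => /andP[/eqP-> _].
have uP := cl_uniq CP; have sP := cl_sub CP; split.
  rewrite !GE !gr_add /= !addv0 -catA; apply: gr_perm.
  by rewrite perm_sym.
have u3 : uniq (([seq a <- P | f a == 0] ++ [seq a <- P | f a == 1]) ++
    [seq a <- P | f a == 2]) by rewrite -catA (perm_uniq pP).
have s3 : {subset ([seq a <- P | f a == 0] ++ [seq a <- P | f a == 1]) ++
    [seq a <- P | f a == 2] <= Phi}.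
  by move=> a; rewrite -catA (perm_mem pP); apply: sP.
have u2 : uniq ([seq a <- P | f a == 0] ++ [seq a <- P | f a == 1]).
  by move: u3; rewrite cat_uniq => /andP[].
have s2 : {subset [seq a <- P | f a == 0] ++ [seq a <- P | f a == 1] <= Phi}.
  by move=> a aA; apply: s3; rewrite mem_cat aA.
by apply: directv3; rewrite !GE ?gr_add gr_cap // ?capv0.
Qed.

End Grading.

End SimplyLaced.

(** * Octonions as roots of a complex Lie algebra *)

Section ComplexPairing.
Variable R : realType.
Local Notation C := R[i].
Implicit Types (a b : oct R) (c d : oct C).

Definition pairing a c : C := oform (oct_complex a) c.

Lemma oct_complexD a b : oct_complex (a + b) = oct_complex a + oct_complex b.
Proof. by rewrite /oct_complex raddfD. Qed.

Lemma oct_complexN a : oct_complex (- a) = - oct_complex a.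
Proof. by rewrite /oct_complex raddfN. Qed.

Lemma pairingDl a b c : pairing (a + b) c = pairing a c + pairing b c.
Proof. by rewrite /pairing oct_complexD oformDl. Qed.

Lemma pairingNl a c : pairing (- a) c = - pairing a c.
Proof. by rewrite /pairing oct_complexN oformNl. Qed.

Lemma pairingBl a b c : pairing (a - b) c = pairing a c - pairing b c.
Proof. by rewrite pairingDl pairingNl. Qed.

Lemma pairing0l c : pairing 0 c = 0.
Proof. by rewrite -(subrr (0 : oct R)) pairingBl subrr. Qed.

Lemma pairing_is_linear a : linear (pairing a : oct C -> C^o).
Proof. by move=> k c d; rewrite /pairing oformDr oformZr. Qed.

HB.instance Definition _ a := GRing.isLinear.Build C (oct C) C^o _ (pairing a)
  (pairing_is_linear a).

Lemma pairing_real a b : pairing a (oct_complex b) = (oform a b)%:C.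
Proof.
rewrite /pairing !oformE rmorphM rmorph_sum /= rmorph_nat; congr (_ * _).
by apply: eq_bigr => k _; rewrite !mxE rmorphM.
Qed.

Lemma pairing_oe (k : 'I_8) c : pairing (oe R k) c = 2 * c 0 k.
Proof.
rewrite /pairing oformE; congr (_ * _); rewrite (bigD1 k) //= big1 => [|j jk].
  by rewrite !mxE eqxx rmorph1 mul1r addr0.
by rewrite !mxE val_eqE (negPf jk) rmorph0 mul0r.
Qed.

Lemma pairing_oe_r a (k : nat) : (k < 8)%N -> pairing a (oe C k) = 2 * (co a k)%:C.
Proof.
move=> lt; rewrite /pairing oformC oformE; congr (_ * _).
rewrite (bigD1 (inord k)) //= big1 => [|j jk].
  by rewrite !mxE inordK // eqxx mul1r addr0.
rewrite !mxE; case: eqP => [E|_]; last by rewrite mul0r.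
by case/eqP: jk; apply: val_inj; rewrite /= inordK.
Qed.

Lemma pairing_inj a b : (forall c, pairing a c = pairing b c) -> a = b.
Proof.
move=> E; apply/rowP => k; have := E (oe C k); rewrite !pairing_oe_r //.
move/mulfI; rewrite pnatr_eq0 => /(_ isT) /(@complexI _ _ _).
by rewrite /co inord_val.
Qed.

End ComplexPairing.

(* Locked to keep unification from unfolding the linear functions. *)
HB.lock Definition functional (R : realType) (a : oct R) : 'Hom(oct R[i], R[i]^o) :=
  linfun (pairing a : oct R[i] -> R[i]^o).

Arguments functional {R}.

Section ComplexRoots.
Variable R : realType.
Local Notation C := R[i].
Implicit Types (a b : oct R) (c d : oct C).

Lemma functionalE a c : functional a c = pairing a c.
Proof. by rewrite functional.unlock lfunE. Qed.

Definition Phi_list : seq (oct R) := [seq half R v | v <- roots].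

Lemma Phi_listP a : a \in Phi_list <-> Phi_E8 R a.
Proof. by rewrite Phi_E8E. Qed.

Lemma double_unit_root (k : nat) : (k < 8)%N -> vscale 2 (unitv k) \in roots.
Proof.
have /allP H : all (fun k => vscale 2 (unitv k) \in roots) (iota 0 8).
  by rewrite roots.unlock; vm_compute.
by move=> lt; apply: H; rewrite mem_iota.
Qed.

Lemma functionalDl a b c :
  (functional (a + b) c : C) = (functional a c : C) + (functional b c : C).
Proof. by rewrite !functionalE pairingDl. Qed.

Lemma functionalC a b :
  (functional a (oct_complex b) : C) = functional b (oct_complex a).
Proof. by rewrite !functionalE !pairing_real oformC. Qed.

Lemma Phi_simply_laced :
  @simply_laced C (oct R) (oct C) (@functional R) (@oct_complex R) Phi_list.
Proof.
have cxr a b : functional a (oct_complex b) = (oform a b)%:C.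
  by rewrite functionalE pairing_real.
split=> [|a b c|a b|a b|a|||a|a b|a b|c H].
- exact: pchar_num.
- exact: functionalDl.
- exact: oct_complexD.
- exact: functionalC.
- rewrite cxr => E; apply: oform_eq0; exact: (@complexI _ _ 0).
- rewrite map_inj_in_uniq ?uniq_roots // => v w vr wr; apply: half_inj;
    exact: roots_size.
- by move=> a /Phi_listP/Phi_opp/Phi_listP.
- by rewrite cxr => /Phi_listP/Phi_norm ->; rewrite rmorph_nat.
- move=> /Phi_listP aP /Phi_listP bP; rewrite !cxr.
  have [->|->|[->|->|->]] := Phi_pair aP bP.
  + exact: Or31.
  + exact: Or32.
  + by apply: Or33; apply: Or31; rewrite rmorphN rmorph1.
  + by apply: Or33; apply: Or32; rewrite rmorph0.
  + by apply: Or33; apply: Or33; rewrite rmorph1.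
- move=> /Phi_listP aP /Phi_listP bP; rewrite cxr => E.
  apply/Phi_listP/Phi_add => //; apply: complexI.
  by rewrite E rmorphN rmorph1.
- apply/rowP => k; rewrite mxE; apply: (@mulfI _ (2 : C)).
    by rewrite pnatr_eq0.
  rewrite mulr0 -pairing_oe -functionalE; apply: H.
  rewrite -vec_unit -half_double; apply: map_f.
  exact: double_unit_root.
Qed.

End ComplexRoots.

Section E8Roots.
Variables (R : realType) (L : lieAlgType R[i]) (h : {vspace L}).
Variable theta : 'Hom(oct R[i], L).
Hypothesis H : simple_with_roots fullv h (Phi_E8 R) theta.
Local Notation C := R[i].
Local Notation wsp := (@wsp C (oct R) (oct C) L (@functional R) theta).

Lemma complex_span_E8 c : complex_span (Phi_E8 R) c.
Proof.
exists [seq oct_complex a | a <- Phi_list R].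
  by move=> _ /mapP[a /Phi_listP aP ->]; exists a.
have -> : c = \sum_(k < 8) c 0 k *: oct_complex (oe R k).
  rewrite [LHS]row_sum_delta; apply: eq_bigr => k _; congr (_ *: _).
  by apply/rowP => j; rewrite !mxE eqxx val_eqE /=; case: (j == k);
    rewrite ?rmorph1 ?rmorph0.
rewrite memv_suml // => k _; rewrite memvZ // memv_span // map_f //.
rewrite -vec_unit -half_double; apply: map_f; exact: double_unit_root.
Qed.

(** Roots in the sense of the hypothesis are functionals on the whole of L of
    which only the values on the Cartan subalgebra matter; here they become
    octonions, and root spaces the joint eigenspaces of the theta c. *)
Lemma E8_root_decomposition :
  @root_decomposition C (oct R) (oct C) L (@functional R) theta (Phi_list R).
Proof.
case: H => [[_ _ simp] [_ hab hself hdiag] hE inj rootE].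
have inh c : theta c \in h by apply/hE; exists c => //; apply: complex_span_E8.
have inj' c : theta c = 0 -> c = 0 by apply: inj; apply: complex_span_E8.
have kt : lker theta == 0%VS.
  by rewrite -subv0; apply/subvP => c; rewrite memv_ker memv0 => /eqP/inj' ->.
pose lam a : 'Hom(L, C^o) := (functional a \o theta^-1)%VF.
have lamE a c : lam a (theta c) = pairing a c.
  by rewrite comp_lfunE lker0_lfunK // functionalE.
have ofE a c : oform (oct_complex a) c = functional a c by rewrite functionalE.
have hselfc x : (forall c, lie (theta c) x = 0) -> exists c, x = theta c.
  move=> x0; have /hE[c _ <-] : x \in h; last by exists c.
  by apply: hself; rewrite ?memvf // => t /hE[c _ <-].
split.
- exact: inj'.
- by move=> c d; apply: hab; apply: inh.
- exact: hselfc.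
- move=> a /Phi_listP aP; have [_ [x x0 [_ xl]]] : is_root fullv h (lam a).
    by apply/rootE; exists a => // c _; apply: lamE.
  apply/negP => /eqP w0; move/eqP: x0; apply; apply/eqP.
  by rewrite -memv0 -w0; apply/wspP => c; rewrite xl ?inh // lamE functionalE.
- move=> a; rewrite inE negb_or => /andP[a0 aP]; apply/eqP; rewrite -subv0.
  apply/subvP => x /wspP xa; rewrite memv0; apply: contraNT aP => x0.
  have /rootE[b bP bE] : is_root fullv h (lam a).
    split; last first.
      exists x => //; split; first exact: memvf.
      by move=> _ /hE[c _ <-]; rewrite xa lamE functionalE.
    apply: contrapT => nt; move/eqP: a0; apply; apply: pairing_inj => c.
    rewrite pairing0l -lamE; apply/eqP; apply: contraT => ne.
    by case: nt; exists (theta c).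
  apply/Phi_listP; suff -> : a = b by [].
  by apply: pairing_inj => c; rewrite -lamE bE //; apply: complex_span_E8.
- apply/eqP; rewrite eqEsubv subvf /=; apply/subvP => x _.
  have [s sP] := hdiag _ (memvf x); apply/subvP; apply/span_subvP => y ys.
  have [y0|y0] := eqVneq y 0; first by rewrite y0 mem0v.
  have [l [_ yl]] := sP _ ys.
  have [[t th lt]|nt] := pselect (exists2 t, t \in h & l t != 0).
    have /rootE[a /Phi_listP aP aE] : is_root fullv h l.
      by split; [exists t | exists y => //; split; rewrite ?memvf].
    have aW : a \in 0 :: Phi_list R by rewrite inE aP orbT.
    apply: (subvP (sumv_seq_sup _ aW)).
    apply/wspP => c; rewrite yl ?inh // functionalE aE //.
    exact: complex_span_E8.
  have [c ->] : exists c, y = theta c.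
    apply: hselfc => c; rewrite yl ?inh //.
    apply/eqP; rewrite scaler_eq0; apply/orP; left; apply: contraT => ne.
    by case: nt; exists (theta c) => //; apply: inh.
  apply: (subvP (sumv_seq_sup _ (mem_head _ _))); apply/wspP => d.
  by rewrite hab ?inh // functionalE pairing0l scale0r.
- move=> J Jid; apply: simp; first exact: subvf.
  by move=> x y _; apply: Jid.
Qed.

End E8Roots.

(** * The subsystems in the complex Cartan subalgebra *)

Section ComplexSubsystems.
Variable R : realType.
Local Notation C := R[i].
Implicit Types (a b e x y : oct R) (c : oct C) (i : 'I_4) (s : seq (oct R)).
Local Notation half := (@half R).
Local Notation fn := (@functional R).
Local Notation cx := (@oct_complex R).
Local Notation Phi := (Phi_list R).
Local Notation spn := (@spn C (oct R) (oct C) cx).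
Local Notation "<< a , c >>" := (fn a c : C) : ring_scope.

Lemma fn_cx a b : <<a, cx b>> = (oform a b)%:C.
Proof. by rewrite functionalE pairing_real. Qed.

Lemma fn_cx0 a b : oform a b = 0 -> <<a, cx b>> = 0.
Proof. by rewrite fn_cx => ->; rewrite rmorph0. Qed.

Lemma cx_half v : cx (half v) = 2^-1 *: vec C v.
Proof.
apply/rowP => k; rewrite !mxE rmorphM fmorphV rmorph_nat; congr (_ * _).
by rewrite rmorph_int.
Qed.

Lemma frame_complex c :
  3 *: c = \sum_(t <- flatten trianglez) <<half t, c>> *: cx (half t).
Proof.
rewrite -(@tight_frame C) ?pnatr_eq0 //; apply: eq_bigr => t _.
by rewrite functionalE /pairing oformC cx_half.
Qed.

Lemma three_neq0 : (3 : C) != 0.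
Proof. by rewrite pnatr_eq0. Qed.

(* Each term of the frame belongs to one of the four triangles. *)
Lemma frame_ind (U : {vspace oct C}) c :
  (forall (j : 'I_4) (t : seq int), t \in tri j -> <<half t, c>> *: cx (half t) \in U) ->
  c \in U.
Proof.
move=> H; rewrite -(scale1r c) -(mulVf three_neq0) -scalerA memvZ // frame_complex.
rewrite big_seq memv_suml // => t /flattenP[T /(nthP nil)[j lt <-] tj].
exact: (H (Ordinal (lt : (j < 4)%N))).
Qed.

Lemma tri_ext_list i t : t \in tri i -> half t \in ext_list R i.
Proof. by move=> ti; rewrite map_f // mem_cat ti. Qed.

Lemma list_uniq (s : seq (seq int)) : {subset s <= roots} -> uniq s ->
  uniq [seq half v | v <- s].
Proof.
move=> sr us; rewrite map_inj_in_uniq // => v w vs ws; apply: half_inj;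
  exact/roots_size/sr.
Qed.

Lemma perp_size i : uniq (perp i) && (size (perp i) == 72).
Proof.
move: i; apply: (@ord4_ind (fun n => uniq (perp n) && (size (perp n) == 72))).
by rewrite /perp roots.unlock; vm_compute.
Qed.

Lemma ext_size i : uniq (ext i) && (size (ext i) == 6).
Proof.
by move: i; apply: (@ord4_ind (fun n => uniq (ext n) && (size (ext n) == 6)));
  vm_compute.
Qed.

Lemma perp_list_uniq i : uniq (perp_list R i).
Proof.
by apply: list_uniq; [exact: perp_roots | have /andP[] := perp_size i].
Qed.

Lemma ext_list_uniq i : uniq (ext_list R i).
Proof.
by apply: list_uniq; [exact: ext_roots | have /andP[] := ext_size i].
Qed.

(** If a + b is a root then <a, b> = -1, so that a + b is the reflection of a in
    b; and - a is the reflection of a in itself. *)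
Lemma closed_reflections s : uniq s -> [set` s] `<=` Phi_E8 R ->
  root_system [set` s] -> closed_subsystem Phi s.
Proof.
move=> us sP [_ _ refl _ _].
have refl' a b : a \in s -> b \in s -> b - oform b a *: a \in s.
  by move=> as_ bs; rewrite -(cartan_integerE b (sP _ as_)); apply: refl.
split=> // [a /sP/Phi_listP //|a as_|a b as_ bs].
  have := refl' _ _ as_ as_; rewrite (Phi_norm (sP _ as_)).
  by rewrite scaler_nat mulr2n opprD addrA subrr sub0r.
move=> /Phi_listP/(Phi_add (sP _ as_) (sP _ bs)) ab.
by have := refl' _ _ bs as_; rewrite ab scaleN1r opprK.
Qed.

Lemma closed_perp i : closed_subsystem Phi (perp_list R i).
Proof.
have E : [set` perp_list R i] = Phi_perp R i by rewrite Phi_perpE.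
apply: closed_reflections; rewrite ?E; first exact: perp_list_uniq.
  by move=> x [].
by have [] := type_E6 R i.
Qed.

Lemma closed_ext i : closed_subsystem Phi (ext_list R i).
Proof.
have E : [set` ext_list R i] = Phi_ext R i by rewrite Phi_extE.
apply: closed_reflections; rewrite ?E; first exact: ext_list_uniq.
  by move=> x /ext_listE/ext_root.
by have [] := type_A2 R i.
Qed.

Lemma perp_ext i a b : a \in perp_list R i -> b \in ext_list R i ->
  <<a, cx b>> = 0.
Proof. by move=> ap be; apply: fn_cx0; exact: perp_orth_ext ap be. Qed.

Lemma ext_perp i a b : a \in ext_list R i -> b \in perp_list R i ->
  <<a, cx b>> = 0.
Proof. by move=> ae bp; rewrite fn_cx0 // oformC (perp_orth_ext bp ae). Qed.

Lemma ext_ext i j a b : i != j -> a \in ext_list R i -> b \in ext_list R j ->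
  <<a, cx b>> = 0.
Proof. by move=> ij ai bj; apply: fn_cx0; exact: ext_orth ij ai bj. Qed.

(** The form is nondegenerate on the span of the triangle, and of its
    orthogonal complement, because the tight frame splits accordingly. *)
Lemma spn_ext_nondeg i c : c \in spn (ext_list R i) ->
  (forall a, a \in ext_list R i -> <<a, c>> = 0) -> c = 0.
Proof.
move=> cs ort; apply/eqP; rewrite -memv0; apply: frame_ind => j t tj.
rewrite (_ : <<half t, c>> = 0) ?scale0r ?mem0v //.
have [E|ji] := eqVneq j i; first by rewrite ort // -E tri_ext_list.
apply: spn_orth cs => b be; apply: (ext_ext ji) => //; exact: tri_ext_list.
Qed.

Lemma spn_perp_nondeg i c : c \in spn (perp_list R i) ->
  (forall a, a \in perp_list R i -> <<a, c>> = 0) -> c = 0.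
Proof.
move=> cs ort; apply/eqP; rewrite -memv0; apply: frame_ind => j t tj.
rewrite (_ : <<half t, c>> = 0) ?scale0r ?mem0v //.
have [E|ji] := eqVneq j i; last by rewrite ort // (ext_other ji) // tri_ext_list.
apply: spn_orth cs => b be; apply: ext_perp be; rewrite -E; exact: tri_ext_list.
Qed.

Lemma spn_full i : (spn (perp_list R i) + spn (ext_list R i) = fullv)%VS.
Proof.
apply/eqP; rewrite eqEsubv subvf /=; apply/subvP => c _.
apply: frame_ind => j t tj; rewrite memvZ //; have te := tri_ext_list tj.
have [E|ji] := eqVneq j i.
  by apply: (subvP (addvSr _ _)); apply: spn_mem; rewrite -E.
apply: (subvP (addvSl _ _)); apply: spn_mem; exact: ext_other te.
Qed.

Lemma spn_cap i : (spn (perp_list R i) :&: spn (ext_list R i) = 0)%VS.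
Proof.
apply: (@spn_disjoint _ _ _ fn).
  exact: perp_ext.
exact: spn_perp_nondeg.
Qed.

Definition trini_ext i (j : 'I_3) : seq (oct R) := ext_list R (lift i j).

Definition trini_exts i : seq (oct R) :=
  trini_ext i 0 ++ trini_ext i 1 ++ trini_ext i 2.

Lemma ord3_cases (j : 'I_3) : [\/ j = 0, j = 1 | j = 2].
Proof.
by case: j => -[|[|[|//]]] lt;
  [constructor 1|constructor 2|constructor 3]; apply: val_inj.
Qed.

Lemma trini_extsP i a : a \in trini_exts i <-> exists j, a \in trini_ext i j.
Proof.
rewrite !mem_cat; split=> [/or3P[]|[j]]; [by exists 0|by exists 1|by exists 2|].
by case: (ord3_cases j) => -> ->; rewrite ?orbT.
Qed.

Lemma trini_exts_perp i : {subset trini_exts i <= perp_list R i}.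
Proof.
move=> a /trini_extsP[j]; apply: ext_other; by rewrite eq_sym neq_lift.
Qed.

(** In the frame expansion of a root orthogonal to the i-th triangle, only the
    three other triangles contribute. *)
Lemma spn_trini i : spn (trini_exts i) = spn (perp_list R i).
Proof.
apply/eqP; rewrite eqEsubv; apply/andP; split.
  by apply: sub_span => _ /mapP[a /trini_exts_perp ap ->]; apply: map_f.
apply/span_subvP => _ /mapP[a ap ->]; apply: frame_ind => j t tj.
have te := tri_ext_list tj; case: (unliftP i j) => [j' E|E]; last first.
  rewrite (_ : <<half t, cx a>> = 0) ?scale0r ?mem0v //.
  by rewrite E in te; apply: ext_perp te ap.
rewrite memvZ // spn_mem //; apply/trini_extsP; exists j'.
by rewrite /trini_ext -E.
Qed.

Lemma trini_exts_uniq i : uniq (trini_exts i).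
Proof.
have dis (j k : 'I_3) a : j != k -> a \in trini_ext i j -> a \in trini_ext i k -> False.
  move=> jk aj ak; have jk' : lift i j != lift i k by rewrite (inj_eq (@lift_inj _ i)).
  have := ext_orth jk' aj ak; rewrite (Phi_norm (ext_root aj)) => /eqP.
  by rewrite pnatr_eq0.
rewrite !cat_uniq !ext_list_uniq /= !andbT; apply/andP; split; apply/hasPn => a.
  by rewrite mem_cat => /orP[]aj; apply/negP => a0; apply: dis a0 aj.
by move=> aj; apply/negP => a1; apply: dis a1 aj.
Qed.

Lemma complex_spanE s c : complex_span [set` s] c <-> c \in spn s.
Proof.
split=> [[t tP ct]|cs].
  apply: (subvP _ _ ct); apply/span_subvP => _ /tP[a as_ <-]; exact: spn_mem.
by exists [seq cx a | a <- s] => // _ /mapP[a as_ ->]; exists a.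
Qed.

End ComplexSubsystems.

(** * The 81 roots over the weights of 3 *)

Section FiberRoots.
Variables (R : realType) (i : 'I_4).
Implicit Types (a e : oct R) (p q : 'I_27) (k l : 'I_3) (j : 'I_(27 * 3)).
Local Notation Phi := (Phi_list R).
Local Notation P := (perp_list R i).
Local Notation E := (ext_list R i).
Local Notation d := (dwt R i).

Definition fiber_root p : oct R := nth 0 (fiber_list R i) p.

(* The index set of an external tensor product, as used for matrices. *)
Definition tensor_root j : oct R :=
  fiber_root (mxtens_unindex j).1 + d (mxtens_unindex j).2.

Lemma size_fiber : size (fiber_list R i) = 27.
Proof.
have [/andP[_ /eqP s27] _ _] := fiber_check i 0 (mem_head 1 [:: -1]).
by rewrite size_map -[RHS]s27.
Qed.

Lemma fiber_uniq : uniq (fiber_list R i).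
Proof.
have [/andP[u _] _ _] := fiber_check i 0 (mem_head 1 [:: -1]).
by apply: list_uniq => //; apply: fiberz_roots.
Qed.

Lemma fiber_rootP a : in_fiber i 0 a <-> exists p, a = fiber_root p.
Proof.
rewrite -fiber_listP; split=> [/(nthP 0)[n]|[p ->]].
  by rewrite size_fiber => lt <-; exists (Ordinal lt).
by apply: mem_nth; rewrite size_fiber.
Qed.

Lemma fiber_root_in p : in_fiber i 0 (fiber_root p).
Proof. by apply/fiber_rootP; exists p. Qed.

Lemma fiber_root_inj : injective fiber_root.
Proof.
move=> p q /eqP; rewrite nth_uniq ?size_fiber //; last exact: fiber_uniq.
by move/eqP/val_inj.
Qed.

Lemma fiber_root_map : [seq fiber_root p | p <- enum 'I_27] =i fiber_list R i.
Proof.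
move=> a; apply/mapP/idP => [[p _ ->]|].
  exact/fiber_listP/fiber_root_in.
by move/fiber_listP/fiber_rootP => [p ->]; exists p; rewrite // mem_enum.
Qed.

Lemma fiber_shift_in p k : in_fiber i k (fiber_root p + d k).
Proof. by rewrite -[d k]subr0 -(dwt0 R i); apply/in_fiber_shift/fiber_root_in. Qed.

Lemma tensor_root_in j : in_fiber i (mxtens_unindex j).2 (tensor_root j).
Proof. exact: fiber_shift_in. Qed.

Lemma tensor_root_onto k a : in_fiber i k a -> exists2 p, 
  a = fiber_root p + d k & a = tensor_root (mxtens_index (p, k)).
Proof.
move/(in_fiber_shift 0)/fiber_rootP=> [p E]; exists p.
  by rewrite -E dwt0 sub0r subrK.
by rewrite /tensor_root mxtens_indexK /= -E dwt0 sub0r subrK.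
Qed.

Lemma tensor_rootP a : (exists j, a = tensor_root j) <-> exists k, in_fiber i k a.
Proof.
split=> [[j ->]|[k /tensor_root_onto[p _ ->]]].
  by exists (mxtens_unindex j).2; apply: tensor_root_in.
by exists (mxtens_index (p, k)).
Qed.

Lemma tensor_root_inj : injective tensor_root.
Proof.
move=> j j' E; have := tensor_root_in j; rewrite E.
move/(in_fiber_uniq (tensor_root_in j')) => E2.
apply: (can_inj (@mxtens_unindexK _ _)); move: E E2.
rewrite /tensor_root; case: (mxtens_unindex j) (mxtens_unindex j') => p k [q l] /=.
by move=> + El; rewrite El => /addIr/fiber_root_inj ->.
Qed.

Lemma in_fiber_not_opp k a e : in_fiber i k a -> e \in P -> a != - e.
Proof.
move=> fa eP; apply: contraTneq (in_fiber_not_perp fa) => ->; rewrite negbK.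
exact: cl_opp (closed_perp R i) _ eP.
Qed.

Lemma fiber_module : module_family Phi P fiber_root.
Proof.
split=> [e p eP|e p eP /Phi_listP aP].
  exact: in_fiber_not_opp (fiber_root_in p) eP.
have [q ->] := (fiber_rootP _).1 (in_fiber_perp (fiber_root_in p) eP aP).
by exists q.
Qed.

Lemma tensor_module_perp : module_family Phi P tensor_root.
Proof.
split=> [e j eP|e j eP /Phi_listP aP].
  exact: in_fiber_not_opp (tensor_root_in j) eP.
have [p _ ->] := tensor_root_onto (in_fiber_perp (tensor_root_in j) eP aP).
by eexists.
Qed.

Lemma tensor_module_ext : module_family Phi E tensor_root.
Proof.
split=> [e j /ext_listP[k [l [_ ->]]]|e j /ext_listP[k [l [kl ->]]] /Phi_listP aP].
  by rewrite opprB; apply: in_fiber_not_ext (tensor_root_in j).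
have lE := in_fiber_step (tensor_root_in j) kl aP.
rewrite lE; have [p _ ->] := tensor_root_onto (in_fiber_shift k (tensor_root_in j)).
by eexists.
Qed.

Lemma fiber_linked p : linked P [seq fiber_root q | q <- enum 'I_27]
  (fiber_root p) (fiber_root 0).
Proof.
have [e [eF ep e0]] := fiber_link ((fiber_listP _ _).2 (fiber_root_in p)) erefl.
by exists e; split=> //; rewrite fiber_root_map.
Qed.

Definition tensor_list : seq (oct R) := [seq tensor_root j | j <- enum 'I_(27 * 3)].

Lemma tensor_listP a : a \in tensor_list <-> exists j, a = tensor_root j.
Proof.
split=> [/mapP[j _ ->]|[j ->]]; first by exists j.
by apply: map_f; rewrite mem_enum.
Qed.

Lemma neg_tensor_listP a :
  a \in [seq - b | b <- tensor_list] <-> exists j, a = - tensor_root j.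
Proof.
split=> [/mapP[_ /mapP[j _ ->] ->]|[j ->]]; first by exists j.
by apply/map_f/map_f; rewrite mem_enum.
Qed.

(* It suffices to compare sizes, 72 + 6 + 81 + 81 = 240, and that all roots
   occur. *)
Lemma root_partition :
  perm_eq (P ++ E ++ tensor_list ++ [seq - b | b <- tensor_list]) Phi.
Proof.
set s := _ ++ _; have us : uniq Phi := Phi_uniq (Phi_simply_laced R).
have sub : {subset Phi <= s}.
  move=> a /Phi_listP; have [_ ->] := Phi_partition R i; rewrite !mem_cat.
  case=> [[/ext_listE -> |/perp_listE ->]|[w ww aw]]; rewrite ?orbT //.
  case: ww aw => -[k _ <-] => [/in_fiberP|/in_fiber_neg] ak.
    have /tensor_listP -> : exists j, a = tensor_root j by apply/tensor_rootP; exists k.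
    by rewrite !orbT.
  have [j E] : exists j, - a = tensor_root j by apply/tensor_rootP; exists k.
  have /neg_tensor_listP -> : exists j, a = - tensor_root j.
    by exists j; rewrite -E opprK.
  by rewrite !orbT.
have /andP[_ /eqP sp] := perp_size i; have /andP[_ /eqP se] := ext_size i.
have sz : (size s <= size Phi)%N.
  by rewrite !size_cat !size_map -enumT size_enum_ord sp se size_roots.
have [_ E'] := uniq_min_size us sub sz.
by rewrite perm_sym; apply: uniq_perm => //; apply: leq_size_uniq us sub sz.
Qed.

End FiberRoots.

(** * The decomposition of e_8 *)

Section Decomposition.
Variables (R : realType) (L : lieAlgType R[i]) (h : {vspace L}).
Variable theta : 'Hom(oct R[i], L).
Hypothesis H : simple_with_roots fullv h (Phi_E8 R) theta.
Local Notation C := R[i].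
Local Notation fn := (@functional R).
Local Notation cx := (@oct_complex R).
Local Notation Phi := (Phi_list R).
Local Notation spn := (@spn C (oct R) (oct C) cx).
Local Notation wsp := (@wsp C (oct R) (oct C) L fn theta).
Local Notation gr := (@gr C (oct R) (oct C) L fn theta).
Local Notation "<< a , c >>" := (fn a c : C) : ring_scope.
Let SL := Phi_simply_laced R.
Let RD := E8_root_decomposition H.

Lemma root_vectorsE (s : seq (oct R)) (Psi : set (oct R)) :
  (forall a, Psi a <-> a \in s) ->
  root_vectors theta Psi = [set x | exists2 a, a \in s & x \in wsp a].
Proof.
move=> PE; apply/seteqP; split=> x [a /PE as_ ax]; exists a => //.
  by apply/wspP => c; rewrite functionalE; apply: ax.
by move=> c; move/wspP: ax => ->; rewrite functionalE.
Qed.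

Lemma generated_gr s (Psi : set (oct R)) : closed_subsystem Phi s ->
  (forall a, Psi a <-> a \in s) ->
  generated_subalgebra (root_vectors theta Psi) (gr (spn s) s).
Proof. by move=> cs /root_vectorsE ->; have := gr_generated SL RD cs. Qed.

Lemma generated_uniq (A : set L) (g g' : {vspace L}) :
  generated_subalgebra A g -> generated_subalgebra A g' -> g = g'.
Proof.
move=> [sg Ag ming] [sg' Ag' ming']; apply/eqP; rewrite eqEsubv.
by rewrite ming // ming'.
Qed.

Lemma gr_lspan (s : seq (oct R)) (Psi : set (oct R)) x : uniq s ->
  (forall a, Psi a <-> a \in s) ->
  x \in gr 0%VS s <-> lspan (root_vectors theta Psi) x.
Proof.
move=> us /root_vectorsE ->; split=> [|[t tP xt]].
  case/(grP us)=> c [X [c0 Xw ->]]; exists [seq X a | a <- s].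
    by move=> _ /mapP[a as_ ->]; exists a.
  move: c0; rewrite memv0 => /eqP ->; rewrite linear0 add0r.
  by rewrite big_seq memv_suml // => a as_; apply: memv_span; apply: map_f.
apply: (subvP _ _ xt); apply/span_subvP => y /tP[a as_].
apply: (subvP (@wsp_gr _ _ _ _ fn theta 0%VS s a as_)).
Qed.

Variable i : 'I_4.
Local Notation P := (perp_list R i).
Local Notation E := (ext_list R i).
Local Notation F := (@fiber_root R i).
Local Notation d := (dwt R i).

Lemma perpE a : Phi_perp R i a <-> a \in P.
Proof. by rewrite perp_listE. Qed.

Lemma extE a : Phi_ext R i a <-> a \in E.
Proof. by rewrite ext_listE. Qed.

Lemma fiber_pairing k a b :
  <<F 0 + d k, cx (d a - d b)>> = (a == k)%:R - (b == k)%:R.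
Proof.
rewrite fn_cx (in_fiber_diff a b (fiber_shift_in R i 0 k)) rmorphB !rmorph_nat.
by rewrite (eq_sym k) (eq_sym k).
Qed.

(* F_0 + d_k is a root over v_k, and the two agree on the plane. *)
Lemma weight_pairing k c : c \in spn E -> <<F 0 + d k, c>> = <<wt R i k, c>>.
Proof.
move=> cE; apply/eqP; rewrite -subr_eq0 -(chiB SL); apply/eqP.
apply: spn_orth cE => b bE; apply: fn_cx0.
have [_ _] := (in_fiberP _ _ _).2 (fiber_shift_in R i 0 k); apply.
exists [:: b] => [y|]; first by rewrite inE => /eqP ->; apply/extE.
by apply: memv_span; apply: mem_head.
Qed.

Lemma fiber_shift_root p k : F p + d k \in Phi.
Proof. by apply/Phi_listP; apply: in_fiber_root (fiber_shift_in R i p k). Qed.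

Lemma pairing_split x y : (forall c, c \in spn P -> <<x, c>> = <<y, c>>) ->
  (forall c, c \in spn E -> <<x, c>> = <<y, c>>) -> x = y.
Proof.
move=> xyP xyE; apply: pairing_inj => c; rewrite -!functionalE.
have : c \in (spn P + spn E)%VS by rewrite spn_full memvf.
by case/memv_addP=> u uP [v vE ->]; rewrite !linearD /= xyP // xyE.
Qed.

Lemma fiber_separated p q : p != q ->
  exists2 c, c \in spn P & <<F p, c>> != <<F q, c>>.
Proof.
move=> pq; apply: contrapT => nex; move/eqP: pq; apply.
apply: (@fiber_root_inj R i); apply: pairing_split => c cS.
  by apply/eqP; apply: contrapT => /negP ne; case: nex; exists c.
apply/eqP; rewrite -subr_eq0 -(chiB SL); apply/eqP.
apply: spn_orth cS => b /ext_listP[k [l [_ ->]]]; apply: fn_cx0.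
by rewrite oformBl !(in_fiber_diff _ _ (fiber_root_in R i _)) subrr.
Qed.

(** Were a weight of the fiber minus another one, F_p + F_q would lie in the
    plane of the triangle, hence be twice its projection v_0, of norm 8/3;
    but F_p + F_q lies in the lattice. *)
Lemma fiber_not_opposite p q :
  exists2 c, c \in spn P & <<F p, c>> != <<- F q, c>>.
Proof.
apply: contrapT => nex.
have [[pP pd] [qP qd]] := (fiber_root_in R i p, fiber_root_in R i q).
have wE : wt R i 0 \in <<E>>%VS by apply: wt_span.
have wtE : F p + F q = 2 *: wt R i 0.
  apply: pairing_split => c cS.
    have -> : <<2 *: wt R i 0, c>> = 0.
      apply: spn_orth cS => b bP; apply: fn_cx0; rewrite oformZl oformC.
      rewrite (@oform_span _ E) ?mulr0 // => a aE; exact: perp_orth_ext bP aE.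
    rewrite (chiD SL); apply/eqP; rewrite addr_eq0 -(chiN SL).
    by apply: contrapT => /negP ne; case: nex; exists c.
  apply/eqP; rewrite -subr_eq0 -(chiB SL); apply/eqP.
  apply: spn_orth cS => b /ext_listP[k [l [_ ->]]]; apply: fn_cx0.
  rewrite oformBl oformDl oformZl !(in_fiber_diff _ _ (fiber_root_in R i _)).
  by rewrite !oformBr !dwtE !oformBr !wt_gram; ring.
have [z zE _] := Phi_int pP qP.
have : oform (F p + F q) (F p + F q) = 4 + 2 * z%:~R.
  by rewrite oformDl !oformDr (oformC (F q)) zE !Phi_norm //; ring.
rewrite wtE oformZl oformZr wt_gram eqxx /= => E.
have : (3 * (4 + 2 * z))%:~R = 8%:~R :> R.
  by rewrite rmorphM rmorphD rmorphM /= -[8%:~R]/(8 : R) -E; field.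
by move/eqP; rewrite eqr_int => /eqP; lia.
Qed.

Lemma perp_simple_with_roots :
  simple_with_roots (gr (spn P) P) (theta @: spn P)%VS (Phi_perp R i) theta.
Proof.
have CP := closed_perp R i.
have SE c : complex_span (Phi_perp R i) c <-> c \in spn P.
  rewrite -complex_spanE (_ : Phi_perp R i = [set` P]) //.
  by apply/seteqP; split=> a /perpE.
split.
- have [b bP conn] := perp_connected R i; apply: (gr_simple SL RD CP bP) => //.
    move=> a /conn[e [eP ea eb]]; exists e; rewrite !fn_cx eP.
    by rewrite !(inj_eq (@complexI _) _ 0).
  exact: spn_perp_nondeg.
- by have := gr_cartan SL RD CP.
- move=> t; split=> [/memv_imgP[c cS ->]|[c /SE cS <-]]; last exact: memv_img.
  by exists c => //; apply/SE.
- by move=> c _; apply: (theta_inj RD).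
move=> lam; rewrite (is_rootP SL RD CP); split=> -[a /perpE aP ac]; exists a => //.
  by move=> c /SE /ac ->; rewrite functionalE.
by move=> c cS; rewrite ac ?functionalE //; apply/SE.
Qed.

Lemma e8_decomposition :
  exists (e6 h6 sl3 V W : {vspace L})
         (rho : L -> 'M[C]_27) (sigma : L -> 'M[C]_3),
    [/\ [/\ generated_subalgebra (root_vectors theta (Phi_perp R i)) e6,
            simple_with_roots e6 h6 (Phi_perp R i) theta,
            generated_subalgebra (root_vectors theta (Phi_ext R i)) sl3,
            iso_sl sl3 sigma &
            commuting e6 sl3],
        forall c, complex_span (Phi_ext R i) c ->
          sigma (theta c) =
            diag_mx (\row_k oform (oct_complex (wt R i k)) c),
        [/\ minuscule_rep e6 h6 rho,
            minuscule_rep e6 h6 (dual_rep rho) &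
            ~ isomorphic_rep e6 rho (dual_rep rho)],
        [/\ forall x, x \in V <->
              lspan (root_vectors theta
                (\bigcup_(w in weights_3 (wt R i))
                   projection_fiber (Phi_ext R i) w)) x,
            forall x, x \in W <->
              lspan (root_vectors theta
                (\bigcup_(w in weights_3bar (wt R i))
                   projection_fiber (Phi_ext R i) w)) x,
            tensor_module2 e6 sl3 V rho sigma &
            tensor_module2 e6 sl3 W (dual_rep rho) (dual_rep sigma)] &
        (e6 + sl3 + V + W)%VS = fullv /\ directv (e6 + sl3 + V + W)].
Proof.
have CP := closed_perp R i; have CE := closed_ext R i.
have PE := @perp_ext R i; have EE := @ext_listP R i; have d0 := dwt0 R i.
have Froot := fiber_shift_root; have rp := fiber_pairing.
have minj := @tensor_root_inj R i.
have modF := @fiber_module R i; have modP := @tensor_module_perp R i.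
have modE := @tensor_module_ext R i; have link0 := @fiber_linked R i.
have sep := fiber_separated; have AE := @tensor_listP R i.
have BE := @neg_tensor_listP R i.
have us : uniq (P ++ E ++ tensor_list R i ++ [seq - b | b <- tensor_list R i]).
  by rewrite (perm_uniq (root_partition R i)); apply: Phi_uniq SL.
move: us; rewrite !cat_uniq => /and3P[_ _ /and3P[_ _ /and3P[uA _ uB]]].
exists (gr (spn P) P), (theta @: spn P)%VS, (gr (spn E) E).
exists (gr 0%VS (tensor_list R i)), (gr 0%VS [seq - b | b <- tensor_list R i]).
exists (fiber_rep fn theta F), (A2_fiber_rep fn theta d F 0).
split; [split|idtac|split|split|].
- exact: generated_gr CP perpE.
- exact: perp_simple_with_roots.
- exact: generated_gr CE extE.
- exact: (A2_iso_sl SL RD CE EE d0 (@spn_ext_nondeg R i) (Froot 0) rp).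
- exact: (gP_gE_commute SL RD CP CE PE).
- move=> c cE; have cS : c \in spn E.
    apply/complex_spanE; move: cE; congr complex_span.
    by apply/seteqP; split=> a /extE.
  rewrite /A2_fiber_rep (A2_rep_theta SL RD CE EE d0 (Froot 0) rp cS); congr diag_mx.
  by apply/rowP => k; rewrite !mxE weight_pairing // functionalE.
- exact: (fiber_minuscule SL RD CP d0 Froot minj modF link0 sep).
- exact: (dual_fiber_minuscule SL RD CP d0 Froot minj modF link0 sep).
- exact: (fiber_not_selfdual SL RD 0 CP d0 Froot minj modF fiber_not_opposite).
- move=> x; apply: gr_lspan => // a; rewrite AE tensor_rootP.
  split=> [[_ [k _ <-] /in_fiberP]|[k /in_fiberP ak]]; first by exists k.
  by exists (wt R i k) => //; exists k.
- move=> x; apply: gr_lspan => // a; rewrite BE.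
  split=> [[_ [k _ <-] /in_fiber_neg ak]|[j ->]].
    have [j E'] : exists j, - a = tensor_root R i j by apply/tensor_rootP; exists k.
    by exists j; rewrite -E' opprK.
  exists (- wt R i (mxtens_unindex j).2); first by exists (mxtens_unindex j).2.
  by apply/in_fiber_neg; rewrite opprK; apply: tensor_root_in.
- exact: (tensor_V SL RD CP CE PE EE d0 Froot rp minj modF link0 AE).
- exact: (tensor_W SL RD CP CE PE EE d0 Froot rp minj modF modP modE link0 BE).
exact: (gr_decomposition SL RD (root_partition R i) (spn_full R i) (spn_cap R i)).
Qed.

End Decomposition.

(** * The trinification of e_6 *)

Section TrinificationRoots.
Variables (R : realType) (i : 'I_4).
Implicit Types (a e : oct R) (j : 'I_(3 * 3 * 3)) (f : 'I_3 -> 'I_3).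
Local Notation Phi := (Phi_list R).
Local Notation P := (perp_list R i).
Local Notation E := (trini_ext R i).
Local Notation d := (gdwt R i).
Local Notation r := (glue R i).

Definition glue_root j : oct R :=
  r + d 2 (mxtens_unindex j).2 + d 1 (mxtens_unindex (mxtens_unindex j).1).2
    + d 0 (mxtens_unindex (mxtens_unindex j).1).1.

Definition glue_index f : 'I_(3 * 3 * 3) :=
  mxtens_index (mxtens_index (f 0, f 1), f 2).

Lemma glue_root_index f : glue_root (glue_index f) = trini_root R i f.
Proof. by rewrite /glue_root /glue_index !mxtens_indexK /= trini_root3. Qed.

Lemma glue_indexK j : exists f, glue_index f = j.
Proof.
case Ej: (mxtens_unindex j) => [ab c]; case Eab: (mxtens_unindex ab) => [a b].
exists (fun k : 'I_3 => if k == 0 then a else if k == 1 then b else c).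
by rewrite -[RHS]mxtens_unindexK Ej -[ab]mxtens_unindexK Eab.
Qed.

Lemma glue_index_eq f f' : f =1 f' -> glue_index f = glue_index f'.
Proof. by move=> ff; rewrite /glue_index !ff. Qed.

Lemma glue_root_inj : injective glue_root.
Proof.
move=> j j'; have [[f <-] [f' <-]] := (glue_indexK j, glue_indexK j').
by rewrite !glue_root_index => /trini_root_inj/glue_index_eq.
Qed.

Lemma glue_root_perp j : glue_root j \in P.
Proof. by have [f <-] := glue_indexK j; rewrite glue_root_index trini_perp. Qed.

Lemma glue_root_Phi (a b c : 'I_3) : r + d 2 c + d 1 b + d 0 a \in Phi.
Proof.
have := cl_sub (closed_perp R i) (glue_root_perp (mxtens_index (mxtens_index (a, b), c))).
by rewrite /glue_root !mxtens_indexK.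
Qed.

Lemma glue_module k : module_family Phi (E k) glue_root.
Proof.
split=> [e j eE|e j /gdwt_ext[l [m [lm ->]]]]; have [f <-] := glue_indexK j;
  rewrite glue_root_index.
  apply: (@trini_root_not_ext _ i f k).
  exact: cl_opp (closed_ext R (lift i k)) _ eE.
move=> /Phi_listP /(trini_root_step lm)[f' <-].
by exists (glue_index f'); rewrite glue_root_index.
Qed.

Lemma gdwt_trini_ext k a : a \in E k <->
  exists l m, l != m /\ a = d k l - d k m.
Proof. exact: gdwt_ext. Qed.

Lemma glue_pairing (k l a b : 'I_3) :
  (functional (r + d k l) (oct_complex (d k a - d k b)) : R[i]) =
  (a == l)%:R - (b == l)%:R.
Proof.
rewrite fn_cx -[LHS]/((oform (r + d k l) (d k a - d k b))%:C).
rewrite oformDl !oformBr !glue_oform !gdwt_gram (eq_sym l a) (eq_sym l b).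
rewrite (eq_sym 0 a) (eq_sym 0 b) !rmorphD !rmorphN !rmorphD !rmorphN.
by rewrite !rmorph_nat; ring.
Qed.

Definition glue_list : seq (oct R) := [seq glue_root j | j <- enum 'I_(3 * 3 * 3)].

Lemma glue_list_grade a : a \in glue_list -> grade i a = 1.
Proof.
case/mapP=> j _ ->; have [f <-] := glue_indexK j.
by rewrite glue_root_index grade_trini.
Qed.

Lemma glue_list_perp a : a \in glue_list -> a \in P.
Proof. by case/mapP=> j _ ->; apply: glue_root_perp. Qed.

Lemma perp_Phi a : a \in P -> Phi_E8 R a.
Proof. by case/perp_listP. Qed.

Lemma neg_glue_list_grade a : a \in [seq - b | b <- glue_list] -> grade i a = 2.
Proof.
case/mapP=> b bg ->; rewrite gradeN ?glue_list_grade //; first exact: val_inj.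
exact/perp_Phi/glue_list_perp.
Qed.

Lemma trini_exts_grade a : a \in trini_exts R i -> grade i a = 0.
Proof. by case/trini_extsP=> j; apply: grade_ext. Qed.

(* The degree separates the three parts, and 18 + 27 + 27 = 72. *)
Lemma trini_partition :
  perm_eq (trini_exts R i ++ glue_list ++ [seq - b | b <- glue_list]) P.
Proof.
have ug : uniq glue_list by rewrite map_inj_uniq ?enum_uniq //; exact: glue_root_inj.
set s := _ ++ _; have us : uniq s.
  rewrite cat_uniq trini_exts_uniq cat_uniq ug (map_inj_uniq (@oppr_inj _)) ug /= andbT.
  apply/andP; split; apply/hasPn => a.
    rewrite mem_cat => ag; apply/negP => /trini_exts_grade a0.
    by case/orP: ag => [/glue_list_grade|/neg_glue_list_grade]; rewrite a0.
  by move=> /neg_glue_list_grade a2; apply/negP => /glue_list_grade; rewrite a2.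
have sub : {subset s <= P}.
  move=> a; rewrite mem_cat => /orP[/trini_exts_perp //|].
  rewrite mem_cat => /orP[/glue_list_perp //|/mapP[b /glue_list_perp bP ->]].
  exact: cl_opp (closed_perp R i) _ bP.
have sz : (size P <= size s)%N.
  have /andP[_ /eqP sp] := perp_size i; rewrite size_map sp /s /trini_exts.
  have e6 k : size (E k) = 6.
    by have /andP[_ /eqP se] := ext_size (lift i k); rewrite size_map se.
  by rewrite !size_cat !e6 !size_map -enumT size_enum_ord.
have [_ E'] := uniq_min_size us sub sz.
by apply: uniq_perm => //; apply: perp_list_uniq.
Qed.

Lemma trini_cases a : a \in P ->
  [\/ a \in trini_exts R i, a \in glue_list | a \in [seq - b | b <- glue_list]].
Proof.
rewrite -(perm_mem trini_partition) mem_cat => /orP[aE|]; first exact: Or31.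
by rewrite mem_cat => /orP[ag|ag]; [exact: Or32 | exact: Or33].
Qed.

Lemma grade0E : perm_eq [seq a <- P | grade i a == 0] (trini_exts R i).
Proof.
apply: uniq_perm; first exact/filter_uniq/perp_list_uniq.
  exact: trini_exts_uniq.
move=> a; rewrite mem_filter; apply/andP/idP => [[a0]|aE].
  case/trini_cases=> // [/glue_list_grade|/neg_glue_list_grade] E';
    by rewrite E' in a0.
by rewrite trini_exts_grade // trini_exts_perp.
Qed.

Lemma grade1E a : a \in [seq a <- P | grade i a == 1] <-> exists j, a = glue_root j.
Proof.
rewrite mem_filter; split=> [/andP[a1]|[j ->]].
  case/trini_cases=> [/trini_exts_grade E'|/mapP[j _ ->]|/neg_glue_list_grade E'].
  - by rewrite E' in a1.
  - by exists j.
  - by rewrite E' in a1.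
by rewrite glue_root_perp glue_list_grade // map_f // mem_enum.
Qed.

Lemma grade2E a : a \in [seq a <- P | grade i a == 2] <-> exists j, a = - glue_root j.
Proof.
rewrite mem_filter; split=> [/andP[a2]|[j ->]].
  case/trini_cases=> [/trini_exts_grade E'|/glue_list_grade E'|].
  - by rewrite E' in a2.
  - by rewrite E' in a2.
  - by case/mapP=> _ /mapP[j _ ->] ->; exists j.
rewrite (cl_opp (closed_perp R i) (glue_root_perp j)) andbT.
by rewrite neg_glue_list_grade // !map_f // mem_enum.
Qed.

End TrinificationRoots.

Section Trinification.
Variables (R : realType) (L : lieAlgType R[i]) (h : {vspace L}).
Variable theta : 'Hom(oct R[i], L).
Hypothesis H : simple_with_roots fullv h (Phi_E8 R) theta.
Variable i : 'I_4.
Local Notation C := R[i].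
Local Notation fn := (@functional R).
Local Notation cx := (@oct_complex R).
Local Notation Phi := (Phi_list R).
Local Notation spn := (@spn C (oct R) (oct C) cx).
Local Notation gr := (@gr C (oct R) (oct C) L fn theta).
Local Notation P := (perp_list R i).
Local Notation E := (trini_ext R i).
Let SL := Phi_simply_laced R.
Let RD := E8_root_decomposition H.

Lemma e6_trinification (e6 : {vspace L}) :
  generated_subalgebra (root_vectors theta (Phi_perp R i)) e6 ->
  exists (s : 'I_3 -> {vspace L}) (sigma : 'I_3 -> L -> 'M[C]_3)
         (G : 'Z_3 -> {vspace L}),
    [/\ forall j,
          generated_subalgebra
            (root_vectors theta (Phi_ext R (lift i j))) (s j) /\
          iso_sl (s j) (sigma j),
        forall j k, j != k -> commuting (s j) (s k),
        G 0 = (\sum_(j < 3) s j)%VS /\ directv (\sum_(j < 3) s j),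
        tensor_module3 (s 0) (s 1) (s 2) (G 1)
          (sigma 0) (sigma 1) (sigma 2) /\
        tensor_module3 (s 0) (s 1) (s 2) (G 2)
          (dual_rep (sigma 0)) (dual_rep (sigma 1)) (dual_rep (sigma 2)) &
        [/\ e6 = (G 0%R + G 1%R + G 2%R)%VS,
            directv (G 0%R + G 1%R + G 2%R) &
            forall a b x y,
              x \in G a -> y \in G b -> lie x y \in G (a + b)]].
Proof.
have CP := closed_perp R i.
move=> /(generated_uniq (generated_gr H CP (perpE i))) <-.
have CE k : closed_subsystem Phi (E k) := closed_ext R (lift i k).
have EE := @gdwt_trini_ext R i; have d0 := @gdwt0 R i.
have Eorth j k a b : j != k -> a \in E j -> b \in E k -> fn a (cx b) = 0.
  by move=> jk; apply: ext_ext; rewrite (inj_eq (@lift_inj _ i)).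
have Edef j := @spn_ext_nondeg R (lift i j).
have rp := @glue_pairing R i; have mroot := @glue_root_Phi R i.
have minj := @glue_root_inj R i; have modE := @glue_module R i.
have AE := @grade1E R i; have BE := @grade2E R i.
have fD a b : a \in P -> b \in P -> grade i (a + b) = grade i a + grade i b.
  by move=> /perp_Phi aP /perp_Phi bP; apply: gradeD.
have fN a : a \in P -> grade i (- a) = - grade i a.
  by move=> /perp_Phi; apply: gradeN.
pose G := graded fn cx theta P (grade i).
have G1 : G 1 = gr 0%VS [seq a <- P | grade i a == 1] by [].
have G2 : G 2 = gr 0%VS [seq a <- P | grade i a == 2] by [].
exists (fun j => gr (spn (E j)) (E j)).
exists (trini_rep fn theta (gdwt R i) (glue R i)), G.
split.
- move=> j; split; last exact: (trini_iso SL RD CE EE d0 Edef rp mroot).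
  exact: (generated_gr H (CE j) (@extE R (lift i j))).
- by move=> j k; apply: (trini_commute SL RD CE Eorth).
- split; last exact: (trini_directv SL RD CE Eorth Edef (trini_exts_uniq R i)).
  rewrite (trini_sum fn cx theta E) /G /graded eqxx -(spn_trini R i).
  exact/gr_perm/grade0E.
- rewrite G1 G2; split.
    have := trini_tensor SL RD CE EE d0 Eorth rp mroot minj AE.
    exact.
  exact: (trini_tensor_dual SL RD CE EE d0 Eorth rp mroot minj modE BE).
have [e6E dG] := graded_sum SL RD CP (f := grade i) (G := G) (fun=> erefl).
split=> // a b x y; exact: (graded_bracket SL RD CP fD fN).
Qed.

End Trinification.

(** * The theorem *)

Theorem mainTheorem5 (R : realType) :
  (* Phi(E8) and the four triangles of integral Okubo idempotents *)
  [/\ root_system_of_type cartan_E8 (Phi_E8 R),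
      Phi_E8 R #= `I_240,
      forall x : oct R,
        [/\ E8_lattice x, x <> 0 & okubo x x = x] <->
        exists i, triangle R i x &
      [set x : oct R | exists i, triangle R i x] #= `I_12] /\
  (* A2 and A2^4 *)
  [/\ forall i, root_system_of_type cartan_A2 (Phi_ext R i),
      [set x : oct R | exists i, Phi_ext R i x] `<=` Phi_E8 R &
      root_system_of_type cartan_A2_4
        [set x : oct R | exists i, Phi_ext R i x]] /\
  forall i : 'I_4,
  (* (1) *)
  [/\ root_system_of_type cartan_E6 (Phi_perp R i),
      Phi_perp R i #= `I_72,
      Phi_ext R i #= `I_6 &
  exists v : 'I_3 -> oct R,
    [/\ sl3_frame (Phi_ext R i) v,
        weights_3 v `|` weights_3bar v #= `I_6,
        forall w, (weights_3 v `|` weights_3bar v) w ->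
          [/\ projection_fiber (Phi_ext R i) w #= `I_27,
              projection_fiber (Phi_ext R i) w `&` Phi_ext R i = set0 &
              projection_fiber (Phi_ext R i) w `&` Phi_perp R i = set0],
        Phi_ext R i `&` Phi_perp R i = set0 /\
        Phi_E8 R =
          Phi_ext R i `|` Phi_perp R i `|`
          \bigcup_(w in weights_3 v `|` weights_3bar v)
             projection_fiber (Phi_ext R i) w &
    forall (L : lieAlgType R[i]) (h : {vspace L}) (theta : 'Hom(oct R[i], L)),
      simple_with_roots fullv h (Phi_E8 R) theta ->
      exists (e6 h6 sl3 V W : {vspace L})
             (rho : L -> 'M[R[i]]_27) (sigma : L -> 'M[R[i]]_3),
        [/\ [/\ generated_subalgebra (root_vectors theta (Phi_perp R i)) e6,
                simple_with_roots e6 h6 (Phi_perp R i) theta,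
                generated_subalgebra (root_vectors theta (Phi_ext R i)) sl3,
                iso_sl sl3 sigma &
                commuting e6 sl3],
            forall c, complex_span (Phi_ext R i) c ->
              sigma (theta c) =
                diag_mx (\row_k oform (oct_complex (v k)) c),
            [/\ minuscule_rep e6 h6 rho,
                minuscule_rep e6 h6 (dual_rep rho) &
                ~ isomorphic_rep e6 rho (dual_rep rho)],
            [/\ forall x, x \in V <->
                  lspan (root_vectors theta
                    (\bigcup_(w in weights_3 v)
                       projection_fiber (Phi_ext R i) w)) x,
                forall x, x \in W <->
                  lspan (root_vectors theta
                    (\bigcup_(w in weights_3bar v)
                       projection_fiber (Phi_ext R i) w)) x,
                tensor_module2 e6 sl3 V rho sigma &
                tensor_module2 e6 sl3 W (dual_rep rho) (dual_rep sigma)] &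
            (e6 + sl3 + V + W)%VS = fullv /\ directv (e6 + sl3 + V + W)]]]
  /\
  (* (2) *)
  [/\ other_triangles R i #= `I_9,
      antipodal (other_triangles R i) #= `I_18,
      antipodal (other_triangles R i) `<=` Phi_perp R i,
      root_system_of_type cartan_A2_3 (antipodal (other_triangles R i)) /\
      lspan (antipodal (other_triangles R i)) = lspan (Phi_perp R i) &
    forall (L : lieAlgType R[i]) (h : {vspace L}) (theta : 'Hom(oct R[i], L)),
      simple_with_roots fullv h (Phi_E8 R) theta ->
    forall e6 : {vspace L},
      generated_subalgebra (root_vectors theta (Phi_perp R i)) e6 ->
      exists (s : 'I_3 -> {vspace L}) (sigma : 'I_3 -> L -> 'M[R[i]]_3)
             (G : 'Z_3 -> {vspace L}),
        [/\ forall j,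
              generated_subalgebra
                (root_vectors theta (Phi_ext R (lift i j))) (s j) /\
              iso_sl (s j) (sigma j),
            forall j k, j != k -> commuting (s j) (s k),
            G 0 = (\sum_(j < 3) s j)%VS /\ directv (\sum_(j < 3) s j),
            tensor_module3 (s 0) (s 1) (s 2) (G 1)
              (sigma 0) (sigma 1) (sigma 2) /\
            tensor_module3 (s 0) (s 1) (s 2) (G 2)
              (dual_rep (sigma 0)) (dual_rep (sigma 1)) (dual_rep (sigma 2)) &
            [/\ e6 = (G 0%R + G 1%R + G 2%R)%VS,
                directv (G 0%R + G 1%R + G 2%R) &
                forall a b x y,
                  x \in G a -> y \in G b -> lie x y \in G (a + b)]]].
Proof.
split; first by split; [exact: type_E8 | exact: card_E8 | exact: idempotentsE |
  exact: card_triangles].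
split.
  split; [exact: type_A2 | | exact: type_A2_4].
  by move=> x [i /extE/ext_root].
move=> i; split.
  split; [exact: type_E6 | exact: card_perp | exact: card_ext |].
  exists (wt R i); split.
  - exact: ext_frame.
  - exact: weights_card.
  - exact: fiber_card.
  - exact: Phi_partition.
  - by move=> L h theta H; apply: e8_decomposition H i.
split.
- exact: card_others.
- exact: card_antipodal_others.
- rewrite antipodal_others Phi_perpE; apply: hset_sub; exact: others_perp.
- by split; [exact: type_A2_3 | exact: span_others].
- by move=> L h theta H e6; apply: e6_trinification H i e6.
Qed.
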